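(* Let $n\ge 4$ and $p=p_0(n)$. Assume that $f\in H^1(\mathbf{R}^n)$ and $g\in L^2(\mathbf{R}^n)$ are both non-negative, do not vanish identically, and have compact support contained in $\{x\in\mathbf{R}^n : |x|\le R\}$, where $R$ is a positive constant. Suppose that the initial value problem $$u_{tt}-\Delta u=|u|^p\ \text{ in } \mathbf{R}^n\times[0,\infty),\qquad u(x,0)=\varepsilon f(x),\quad u_t(x,0)=\varepsilon g(x)$$ has a solution $(u,u_t)\in C([0,T(\varepsilon)),H^1(\mathbf{R}^n)\times L^2(\mathbf{R}^n))$ with $$\mathrm{supp}(u,u_t)\subset\{(x,t)\in\mathbf{R}^n\times[0,\infty) : |x|\le t+R\},$$ where $T(\varepsilon)$ is the lifespan. Then there exists a positive constant $\varepsilon_0=\varepsilon_0(f,g,n,p,R)$ such that $T(\varepsilon)$ has to satisfy $$T(\varepsilon)\le\exp\left(C\varepsilon^{-p(p-1)}\right)\quad\text{for } 0<\varepsilon\le\varepsilon_0,$$ where $C$ is a positive constant independent of $\varepsilon$.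
   Context: The number $p_0(n)$ is the positive root of the quadratic equation $2+(n+1)p-(n-1)p^2=0$ in $p$, i.e. $p_0(n)=\dfrac{n+1+\sqrt{n^2+10n-7}}{2(n-1)}$. Here $\varepsilon>0$ is a (small) parameter and $u=u(x,t)$ is a scalar real-valued unknown. The lifespan is $T(\varepsilon)=\sup\{t>0 : \text{there exists a solution } u(x,t) \text{ of the initial value problem for the arbitrarily fixed data } (f,g)\}$, i.e. the maximal existence time. ''Solution'' means a classical solution if $p\ge 2$, or a weak solution, i.e. a solution of the associated integral equation, if $1<p<2$; in the theorem the solution is taken in the class $C([0,T(\varepsilon)),H^1(\mathbf{R}^n)\times L^2(\mathbf{R}^n))$. With this regularity and support condition, $F(t)=\int_{\mathbf{R}^n}u(x,t)\,dx$ is twice continuously differentiable in $t$ on $[0,T(\varepsilon))$, with $F''(t)=\int_{\mathbf{R}^n}|u(x,t)|^p\,dx$. *)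

(* Defs.v *)
From HB Require Import structures.
From mathcomp Require Import all_boot all_order all_algebra.
From mathcomp Require Import all_classical all_reals all_analysis.
From mathcomp Require Import ring lra.

Set Implicit Arguments.
Unset Strict Implicit.
Unset Printing Implicit Defensive.
Import Order.TTheory GRing.Theory Num.Theory.
Import numFieldNormedType.Exports.

Local Open Scope classical_set_scope.
Local Open Scope ring_scope.

Definition rV_display : measure_display. Proof. exact. Qed.

Section measurable_rV.
Context {R : realType} {n : nat}.

Let coor (i : 'I_n) (x : 'rV[R]_n) : R := x ord0 i.

Let rV_set0 : g_sigma_preimage coor set0.
Proof. exact: sigma_algebra0. Qed.

Let rV_setC A : g_sigma_preimage coor A -> g_sigma_preimage coor (~` A).
Proof. exact: sigma_algebraC. Qed.

Let rV_bigcup (F : _^nat) : (forall i, g_sigma_preimage coor (F i)) ->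
  g_sigma_preimage coor (\bigcup_i (F i)).
Proof. exact: sigma_algebra_bigcup. Qed.

HB.instance Definition _ := @isMeasurable.Build rV_display
  'rV[R]_n (g_sigma_preimage coor) rV_set0 rV_setC rV_bigcup.

End measurable_rV.

Section lebesgue_rV.
Context {R : realType}.

Lemma measurable_coor n (i : 'I_n) :
  measurable_fun setT (fun x : 'rV[R]_n => x ord0 i).
Proof.
move=> _ Y mY; rewrite setTI; apply: sub_sigma_algebra => /=.
rewrite -bigcup_seq/=; exists i => /=; first by rewrite mem_index_enum.
by exists Y => //; rewrite setTI.
Qed.

Lemma measurable_fun_rVP d (T : measurableType d) n (f : T -> 'rV[R]_n) :
  measurable_fun setT f <-> forall i, measurable_fun setT (fun x => f x ord0 i).
Proof.
split=> [mf i|mf].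
  exact: (measurableT_comp (measurable_coor i) mf).
pose C := \big[setU/set0]_(i < n)
  preimage_set_system setT (fun x : 'rV[R]_n => x ord0 i) measurable.
apply: (@measurability _ _ _ _ _ _ C) => // _ [B + <-].
rewrite /C -bigcup_seq => -[i _ [A mA <-]].
by rewrite !setTI -[X in measurable X]setTI; exact: mf.
Qed.

Definition rV_cons n (z : measurableTypeR R * 'rV[R]_n) : 'rV[R]_n.+1 :=
  row_mx (z.1 : R)%:M z.2.

Lemma measurable_rV_cons n : measurable_fun setT (@rV_cons n).
Proof.
apply/measurable_fun_rVP => i; rewrite /rV_cons.
case: (@splitP 1 n i) => j ij.
- have -> : (fun z : measurableTypeR R * 'rV[R]_n =>
      (row_mx (z.1 : R)%:M z.2 : 'rV_(1 + n)) ord0 i) = fst.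
    apply/funext => z; have -> : i = lshift n j by exact/val_inj.
    by rewrite row_mxEl mxE !ord1 eqxx mulr1n.
  exact: measurable_fst.
- have -> : (fun z : measurableTypeR R * 'rV[R]_n =>
      (row_mx (z.1 : R)%:M z.2 : 'rV_(1 + n)) ord0 i) =
      (fun x : 'rV[R]_n => x ord0 j) \o snd.
    apply/funext => z; have -> : i = rshift 1 j by exact/val_inj.
    by rewrite row_mxEr.
  by apply: measurableT_comp => //; exact: measurable_coor.
Qed.

Definition rV_uncons n (x : 'rV[R]_n.+1) : measurableTypeR R * 'rV[R]_n :=
  (x ord0 ord0, rsubmx (x : 'rV[R]_(1 + n))).

Lemma rV_consK n : cancel (@rV_cons n) (@rV_uncons n).
Proof.
move=> [a v]; rewrite /rV_uncons /rV_cons /= row_mxKr; congr pair.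
transitivity ((row_mx a%:M v : 'rV_(1 + n)) ord0 (lshift n ord0)).
  by congr (row_mx _ _ _ _); exact/val_inj.
by rewrite row_mxEl mxE eqxx mulr1n.
Qed.

Lemma measurable_rV_uncons n : measurable_fun setT (@rV_uncons n).
Proof.
apply: measurable_fun_pair; first exact: measurable_coor.
apply/measurable_fun_rVP => i /=.
have -> : (fun x : 'rV[R]_(1 + n) => rsubmx x ord0 i) =
          (fun x : 'rV[R]_(1 + n) => x ord0 (rshift 1 i)).
  by apply/funext => x; rewrite mxE.
exact: (@measurable_coor n.+1).
Qed.

Local Open Scope ereal_scope.

Section lebesgue_step.
Variables (n : nat) (mu : {sigma_finite_measure set 'rV[R]_n -> \bar R}).

Definition lebesgue_cons : set 'rV[R]_n.+1 -> \bar R :=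
  pushforward (@lebesgue_measure R \x mu) (@rV_cons n).

Let measurable_preimage_rV_cons (A : set 'rV[R]_n.+1) :
  measurable A -> measurable (@rV_cons n @^-1` A).
Proof.
by move=> mA; rewrite -[X in measurable X]setTI; exact: measurable_rV_cons.
Qed.

Let lebesgue_cons0 : lebesgue_cons set0 = 0.
Proof. by rewrite /lebesgue_cons /pushforward preimage_set0 measure0. Qed.

Let lebesgue_cons_ge0 A : 0 <= lebesgue_cons A.
Proof. exact: (measure_ge0 (@lebesgue_measure R \x mu)). Qed.

Let lebesgue_cons_sigma_additive : semi_sigma_additive lebesgue_cons.
Proof.
move=> F mF tF mUF; rewrite /lebesgue_cons /pushforward preimage_bigcup.
apply: measure_semi_sigma_additive.
- by move=> k; exact: measurable_preimage_rV_cons.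
- apply/trivIsetP => /= i j _ _ ij; rewrite -preimage_setI.
  by move/trivIsetP : tF => /(_ _ _ _ _ ij) ->//; rewrite preimage_set0.
- by rewrite -preimage_bigcup; exact: measurable_preimage_rV_cons.
Qed.

HB.instance Definition _ := isMeasure.Build _ _ _ lebesgue_cons
  lebesgue_cons0 lebesgue_cons_ge0 lebesgue_cons_sigma_additive.

Let lebesgue_cons_sigma_finite : sigma_finite setT lebesgue_cons.
Proof.
have /sigma_finiteP[F [FT ndF Foo]] := sigma_finiteT (@lebesgue_measure R).
have /sigma_finiteP[G [GT ndG Goo]] := sigma_finiteT mu.
exists (fun k => @rV_uncons n @^-1` (F k `*` G k)).
  rewrite -preimage_bigcup (_ : \bigcup_k _ = setT) ?preimage_setT//.
  apply/seteqP; split=> // -[x y] _.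
  have [i _ Fx] : (\bigcup_k F k) x by rewrite -FT.
  have [j _ Gy] : (\bigcup_k G k) y by rewrite -GT.
  exists (maxn i j) => //; split => /=.
    by move: x Fx; exact/subsetPset/ndF/leq_maxl.
  by move: y Gy; exact/subsetPset/ndG/leq_maxr.
move=> k; have [mF Fk] := Foo k; have [mG Gk] := Goo k; split.
  rewrite -[X in measurable X]setTI; apply: measurable_rV_uncons => //.
  exact: measurableX.
rewrite /lebesgue_cons /pushforward -comp_preimage.
rewrite (_ : _ \o _ = id) ?preimage_id; last first.
  by apply/funext => z /=; rewrite rV_consK.
by rewrite product_measure1E// lte_mul_pinfty// ge0_fin_numE.
Qed.

HB.instance Definition _ := Measure_isSigmaFinite.Build _ _ _
  lebesgue_cons lebesgue_cons_sigma_finite.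

End lebesgue_step.

Fixpoint lebesgue_rV (n : nat) : {sigma_finite_measure set 'rV[R]_n -> \bar R} :=
  match n with
  | 0 => \d_(0%R : 'rV[R]_0)
  | m.+1 => lebesgue_cons (lebesgue_rV m)
  end.

Lemma lebesgue_rV_box n (A : 'I_n -> set (measurableTypeR R)) :
  (forall i, measurable (A i)) ->
  lebesgue_rV n [set x : 'rV[R]_n | forall i, A i (x ord0 i)] =
  \prod_(i < n) lebesgue_measure (A i).
Proof.
elim: n A => [|n IHn] A mA.
  by rewrite big_ord0 /= diracE mem_set// => -[].
rewrite big_ord_recl /= /lebesgue_cons /pushforward.
have -> : @rV_cons n @^-1` [set x | forall i, A i (x ord0 i)] =
    A ord0 `*` [set x : 'rV[R]_n | forall i, A (lift ord0 i) (x ord0 i)].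
  have e0 z : rV_cons z ord0 ord0 = z.1.
    by rewrite -[in RHS](rV_consK z).
  have eS z (i : 'I_n) : rV_cons z ord0 (lift ord0 i) = z.2 ord0 i.
    rewrite -[in RHS](rV_consK z) [RHS]mxE; congr (rV_cons z _ _).
    exact/val_inj.
  apply/seteqP; split=> [z /= Az|z [/= A0 AS] i].
    by split=> [|i]; rewrite -?e0 -?eS; exact: Az.
  by case: (unliftP ord0 i) => [j ->|->]; rewrite ?e0 ?eS.
rewrite product_measure1E//; last first.
  have -> : [set x : 'rV[R]_n | forall i, A (lift ord0 i) (x ord0 i)] =
      \bigcap_(i in [set: 'I_n]) [set x | A (lift ord0 i) (x ord0 i)].
    by apply/seteqP; split=> x Ax i => [_|]; exact: (Ax i).
  apply: fin_bigcap_measurable => // i _.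
  rewrite -[X in measurable X]setTI.
  exact: (measurable_coor i measurableT (mA (lift ord0 i))).
by congr (_ * _); rewrite (IHn (fun i => A (lift ord0 i))).
Qed.
End lebesgue_rV.

Section strauss.
Context {R : realType}.

Definition p0 (n : nat) : R :=
  (n%:R + 1 + Num.sqrt (n%:R ^+ 2 + 10 * n%:R - 7)) / (2 * (n%:R - 1)).

Lemma p0P (n : nat) (p : R) : (1 < n)%N ->
  p = p0 n <-> 0 < p /\ 2 + (n%:R + 1) * p - (n%:R - 1) * p ^+ 2 = 0.
Proof.
rewrite -(ltr_nat R) /p0; set m : R := n%:R => m_gt1.
have m1_gt0 : 0 < m - 1 by lra.
set D := m ^+ 2 + 10 * m - 7.
have D_ge0 : 0 <= D by rewrite /D; nra.
have sD := sqr_sqrtr D_ge0.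
have s_ge0 := sqrtr_ge0 D.
split=> [->|[p_gt0 pE]].
  split; first by apply: divr_gt0; lra.
  have m1_neq0 : m - 1 != 0 by rewrite gt_eqF.
  transitivity ((D - Num.sqrt D ^+ 2) / (4 * (m - 1))).
    by move: (Num.sqrt D) => a; rewrite /D; field.
  by rewrite sD subrr mul0r.
have q_gt0 : 0 < (m - 1) * p - (m + 1).
  by rewrite -(pmulr_rgt0 _ p_gt0); nra.
have DE : D = (2 * (m - 1) * p - (m + 1)) ^+ 2.
  apply/eqP; rewrite -subr_eq0; apply/eqP.
  rewrite -[RHS](mulr0 (4 * (m - 1))) -pE /D; ring.
have -> : Num.sqrt D = 2 * (m - 1) * p - (m + 1).
  by rewrite DE sqrtr_sqr ger0_norm//; nra.
by field; rewrite gt_eqF.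
Qed.

End strauss.

Section function_spaces.
Context {R : realType} {n : nat}.
Implicit Types (x y xi : 'rV[R]_n) (f g h phi : 'rV[R]_n -> R) (i : 'I_n).

Let mu := @lebesgue_rV R n.

Definition dotr x y : R := \sum_(i < n) x ord0 i * y ord0 i.

(* The norm `|x| of the library on 'rV[R]_n is the sup norm. *)
Definition enorm x : R := Num.sqrt (dotr x x).

Definition partial i phi : 'rV[R]_n -> R :=
  fun x => 'D_(delta_mx ord0 i) phi x.

Definition smooth phi : Prop := forall s : seq 'I_n,
  let psi := foldr partial phi s in
  continuous psi /\ forall i x, derivable psi x (delta_mx ord0 i).

Definition test_function phi : Prop :=
  smooth phi /\ exists r : R, forall x, r < enorm x -> phi x = 0.

Definition L2norm f : \bar R := 'N[mu]_2%:E[EFin \o f].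

Definition in_L2 f : Prop := f \in Lfun mu 2%:E.

Definition weak_partial i f g : Prop := forall phi, test_function phi ->
  \int[mu]_x (f x * partial i phi x) = - \int[mu]_x (g x * phi x).

Definition in_H1 f : Prop := in_L2 f /\
  exists Df : 'I_n -> 'rV[R]_n -> R,
    forall i, in_L2 (Df i) /\ weak_partial i f (Df i).

(* Essential support contained in the closed Euclidean ball of radius r. *)
Definition supp_in_ball (r : R) f : Prop :=
  {ae mu, forall x, r < enorm x -> f x = 0}.

Section curves.
Variable I : set R.
Implicit Types v w : R -> 'rV[R]_n -> R.

Definition C0_L2 v : Prop := forall t, I t ->
  in_L2 (v t) /\
  L2norm (fun x => v s x - v t x) @[s --> within I (nbhs t)] --> 0%E.

Definition C0_H1 v : Prop := C0_L2 v /\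
  exists Dv : 'I_n -> R -> 'rV[R]_n -> R, forall i,
    C0_L2 (Dv i) /\ forall t, I t -> weak_partial i (v t) (Dv i t).

Definition L2_time_derivative v w : Prop := forall t, I t ->
  L2norm (fun x => (s - t)^-1 * (v s x - v t x) - w t x)
    @[s --> within I t^'] --> 0%E.

End curves.

(* With trig = cos and trig = sin these are, up to sign, the real and the
   imaginary part of the Fourier transform of f at xi. *)
Definition fourier (trig : R -> R) f xi : R :=
  \int[mu]_x (trig (dotr xi x) * f x).

(* Symbol of the propagator W(t) = sin(t sqrt(-Delta)) / sqrt(-Delta). *)
Definition sinW (t r : R) : R := if r == 0 then t else sin (t * r) / r.

(* The integral equation
     u(t) = W'(t) u0 + W(t) u1 + \int_0^t W(t - s) |u(s)|^p ds
   associated with u_tt - Delta u = |u|^p, u(0) = u0, u_t(0) = u1, where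
   W'(t) = cos(t sqrt(-Delta)), read on the Fourier side. The integrability
   requirements make every term meaningful. *)
Definition integral_equation (p : R) (u0 u1 : 'rV[R]_n -> R) (I : set R)
    (u : R -> 'rV[R]_n -> R) : Prop :=
  forall t, I t ->
  [/\ mu.-integrable setT (EFin \o u t),
      mu.-integrable setT (fun x => (`|u t x| `^ p)%:E),
      lebesgue_measure.-integrable `[0, t]
        (fun s => (\int[mu]_x (`|u s x| `^ p))%:E) &
      forall xi trig, trig = cos \/ trig = sin ->
        fourier trig (u t) xi =
          cos (t * enorm xi) * fourier trig u0 xi +
          sinW t (enorm xi) * fourier trig u1 xi +
          \int[lebesgue_measure]_(s in `[0, t])
            (sinW (t - s) (enorm xi) *
             fourier trig (fun x => `|u s x| `^ p) xi)].

Definition lifetime (T : \bar R) : set R := [set t | 0 <= t /\ (t%:E < T)%E].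

(* (u, ut) solves u_tt - Delta u = |u|^p on [0, T) with data (u0, u1) and
   belongs to C([0, T), H^1 x L^2). *)
Definition wave_solution (p : R) (u0 u1 : 'rV[R]_n -> R) (T : \bar R)
    (u ut : R -> 'rV[R]_n -> R) : Prop :=
  [/\ C0_H1 (lifetime T) u, C0_L2 (lifetime T) ut,
      L2_time_derivative (lifetime T) u ut,
      {ae mu, forall x, u 0 x = u0 x} /\ {ae mu, forall x, ut 0 x = u1 x} &
      integral_equation p u0 u1 (lifetime T) u].

Definition lifespan (p : R) f g (eps : R) : \bar R :=
  ereal_sup [set t%:E | t in [set t : R | 0 < t /\
    exists u ut, wave_solution p (eps \*o f) (eps \*o g) t%:E u ut]].

End function_spaces.

(* Main.v *)
Require Import Defs.
From mathcomp Require Import all_boot all_order all_algebra.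
From mathcomp Require Import all_classical all_reals all_analysis.
From mathcomp Require Import measurable_realfun normal_distribution.
From mathcomp Require Import ring lra.

Set Implicit Arguments.
Unset Strict Implicit.
Unset Printing Implicit Defensive.
Import Order.TTheory GRing.Theory Num.Theory.
Import numFieldNormedType.Exports.

Local Open Scope classical_set_scope.
Local Open Scope ring_scope.

(** Write [n = m + 1], [q = m / 2 - 1 / p], [tau = t + rad + 1], [F] for the integral of
    [f] and [G s] for the integral of [|u(s)|^p].

    The integral equation is known at real frequencies only, but everything has
    bounded support, so it may be read at imaginary ones. For a fixed direction the two
    sides of the equation are the values of a bounded linear functional at the
    functions [a |-> cos (r a)]. Letting [r] tend to [0] in the Taylor expansion
    shows, by induction on the degree, that the functional vanishes on all even
    monomials, hence on [cosh] ([functional_cosh], [hyperbolic_identity]). The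
    propagators are now positive, and so are the data and the nonlinearity;
    with [cosh >= 1] this bounds the exponential moments of [u(t)] from below
    by those of a mass at the origin ([exponential_moment_ge]):
    [int cosh(xi . x) u(t) >= cosh(|xi| t) eps F + int_0^t sinh(|xi| (t - s)) / |xi| G(s) ds].

    Multiply by [exp (- |xi| tau)] and average over the frequencies of size about
    [k] in a half space. Coordinates in which the exponent is quadratic turn the
    average into a Gaussian integral ([light_weight_le]): the averaged weight
    is at most [(2 pi / (k tau))^(m/2) exp (- k (tau - |x|) / 2)], which has the amplitude
    of a spherical wave and lives at distance [1 / k] from the light cone
    ([light_moment_ge]).

    Hoelder's inequality turns a lower bound of a pairing with such a weight into
    one of [G t]. For [k = 1] the data give [G t >= c eps^p tau^(q - 1)]
    ([power_integral_data]). Superposing all dyadic [k] with suitable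
    coefficients gives [G t >= c tau^(q - 1) (1 + ln tau)^(1 - p) M(t)^p], where
    [M t = int_0^t (t - s) / tau (s + rad + 1)^(- q) G(s) ds]
    ([power_integral_memory]). At [p = p0 n] the two powers of [tau] agree
    ([critical_exponent]); this is what leaves only logarithms in the rest of
    the argument.

    Put [theta = ln tau] and [g = tau^(1 - q) G]. The two bounds become
    [g >= alpha] with [alpha = c eps^p] and [beta M^p <= (1 + theta)^(p - 1) g],
    while [M theta] is at least the integral of [(1 - exp (- (theta - s))) g s]
    in [s] ([memory_ge]). If [u] lives up to logarithmic time [L] and
    [L alpha^(p - 1)] is large, then feeding these into each other along the times
    [L (1 - 2^(- j - 1))] gives [M L >= L m0 A^j] with [A > 1] for every [j],
    which is absurd ([iteration_bound]). Hence [L <= C eps^(- p (p - 1))]. *)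

(** * Taylor remainders of circular and hyperbolic functions *)

Section analytic_continuation.
Context {R : realType}.
Implicit Types (a b r rho M : R) (phi psi C S : R -> R).

Lemma is_derive_continuous phi psi :
  (forall a, is_derive a (1:R) psi (phi a)) -> continuous psi.
Proof.
by move=> d a; apply/differentiable_continuous/derivable1_diffP/ex_derive.
Qed.

Lemma norm_le_of_derive (f g df dg : R -> R) a : 0 <= a ->
  (forall x, is_derive x (1:R) f (df x)) -> (forall x, is_derive x (1:R) g (dg x)) ->
  f 0 = 0 -> g 0 = 0 ->
  (forall x, 0 <= x <= a -> `|df x| <= dg x) -> `|f a| <= g a.
Proof.
move=> a0 Df Dg f0 g0 le.
have cf := is_derive_continuous Df; have cg := is_derive_continuous Dg.
rewrite ler_norml; apply/andP; split.
- have [c] := @MVT_segment R (g + f) (fun x => dg x + df x) 0 a a0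
    (fun x _ => is_deriveD (Dg x) (Df x))
    (@continuous_subspaceT _ _ _ _ (fun x => continuousD (cg x) (cf x))).
  rewrite in_itv /= => ci.
  rewrite !fctE f0 g0 addr0 !subr0 => e.
  have : 0 <= g a + f a.
    rewrite e mulr_ge0//.
    by have := le _ ci; rewrite ler_norml => /andP[]; lra.
  by lra.
- have [c] := @MVT_segment R (g - f) (fun x => dg x - df x) 0 a a0
    (fun x _ => is_deriveB (Dg x) (Df x))
    (@continuous_subspaceT _ _ _ _ (fun x => continuousB (cg x) (cf x))).
  rewrite in_itv /= => ci.
  rewrite !fctE f0 g0 !subr0 => e.
  have : 0 <= g a - f a.
    rewrite e mulr_ge0//.
    by have := le _ ci; rewrite ler_norml => /andP[]; lra.
  by lra.
Qed.

Definition even_taylor (s : R) N a : R :=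
  \sum_(k < N) s ^+ k * (a ^+ (2 * k) / ((2 * k)`!)%:R).

Definition odd_taylor (s : R) N a : R :=
  \sum_(k < N) s ^+ k * (a ^+ (2 * k).+1 / ((2 * k).+1`!)%:R).

Lemma is_derive_monomial k a :
  is_derive a (1:R) (fun x : R => x ^+ k.+1 / (k.+1)`!%:R) (a ^+ k / k`!%:R).
Proof.
have -> : (fun x : R => x ^+ k.+1 / (k.+1)`!%:R) =
    (k.+1`!%:R)^-1 \*: (id ^+ k.+1 : R -> R).
  by rewrite exprfctE; apply/funext => x /=; rewrite mulrC.
apply: is_derive_eq.
rewrite factS natrM /GRing.scale /= mulr1 invfM.
have k1 : (k.+1%:R : R) != 0 by rewrite pnatr_eq0.
have k2 : (k`!%:R : R) != 0 by rewrite pnatr_eq0 -lt0n fact_gt0.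
by move: (k.+1%:R) (k`!%:R) k1 k2 => c d c0 d0; field; rewrite d0 c0.
Qed.

Lemma is_derive_odd_taylor s N a :
  is_derive a (1:R) (odd_taylor s N) (even_taylor s N a).
Proof.
have -> : odd_taylor s N =
  \sum_(k < N) (fun x => s ^+ k * (x ^+ (2 * k).+1 / (2 * k).+1`!%:R)).
  by apply/funext => x; rewrite fct_sumE.
apply: is_derive_sum => k.
have H := @is_deriveZ _ _ _ _ (s ^+ k) _ _ _ (is_derive_monomial (2 * k) a).
exact: H.
Qed.

Lemma is_derive_even_taylor s N a :
  is_derive a (1:R) (even_taylor s N.+1) (s * odd_taylor s N a).
Proof.
have -> : even_taylor s N.+1 = cst 1 +
  \sum_(k < N) (fun x => s ^+ k.+1 * (x ^+ (2 * k).+2 / (2 * k).+2`!%:R)).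
  apply/funext => x; rewrite fctE fct_sumE /even_taylor big_ord_recl /=.
  rewrite muln0 !expr0 fact0 divr1 mulr1; congr (_ + _).
  by apply: eq_bigr => i _; rewrite /bump /= add1n mulnS.
rewrite -[X in is_derive _ _ _ X]add0r; apply: is_deriveD.
rewrite mulr_sumr; apply: is_derive_sum => k.
have H := @is_deriveZ _ _ _ _ (s ^+ k.+1) _ _ _ (is_derive_monomial (2 * k).+1 a).
rewrite mulrA -exprS.
exact: H.
Qed.

Lemma even_taylor0 s N : even_taylor s N.+1 0 = 1.
Proof.
rewrite /even_taylor big_ord_recl big1 /=.
  by rewrite muln0 !expr0 fact0 divr1 mulr1 addr0.
by move=> i _; rewrite /bump /= add1n mulnS expr0n /= mul0r mulr0.
Qed.

Lemma odd_taylor0 s N : odd_taylor s N 0 = 0.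
Proof.
by rewrite /odd_taylor big1 // => i _; rewrite expr0n /= mul0r mulr0.
Qed.

(** The differential system treats the circular functions ([s = -1]) and the
    hyperbolic ones ([s = 1]) together: integrating the remainder of one of
    [C], [S] gives the next remainder of the other. *)
Lemma taylor_remainder_ge0 (s : R) C S (K A : R) N a :
  `|s| <= 1 -> (forall x, is_derive x (1:R) S (C x)) ->
  (forall x, is_derive x (1:R) C (s * S x)) ->
  C 0 = 1 -> S 0 = 0 -> (forall x, 0 <= x <= A -> `|C x| <= K) ->
  0 <= a <= A ->
  `|C a - even_taylor s N a| <= K * (a ^+ (2 * N) / (2 * N)`!%:R) /\
  `|S a - odd_taylor s N a| <= K * (a ^+ (2 * N).+1 / (2 * N).+1`!%:R).
Proof.
move=> s1 DS DC C0 S0 CK; elim: N a => [|N IH] a /andP[a0 aA].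
  have Da x : is_derive x (1:R) (S - odd_taylor s 0) (C x - even_taylor s 0 x).
    exact: (is_deriveB (DS _) (is_derive_odd_taylor _ _ _)).
  have Dg x : is_derive x (1:R) (K \*: (fun y : R => y ^+ (2 * 0).+1 / (2 * 0).+1`!%:R))
     (K * (x ^+ (2 * 0) / (2 * 0)`!%:R)).
    by apply: is_deriveZ; exact: is_derive_monomial.
  have H x : 0 <= x <= A -> `|C x - even_taylor s 0 x| <= K * (x ^+ (2 * 0) / (2 * 0)`!%:R).
    move=> xA; rewrite /even_taylor big_ord0 subr0 muln0 expr0 fact0 divr1 mulr1.
    exact: CK.
  split; first by apply: H; rewrite a0.
  have := @norm_le_of_derive _ _ _ _ a a0 Da Dg.
  rewrite !fctE => X; apply: X.
  - by rewrite S0 odd_taylor0 subr0.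
  - by rewrite /= expr0n /= mul0r scaler0.
  - by move=> x /andP[x0 xa]; apply: H; rewrite x0 (le_trans xa).
have H1 x : 0 <= x <= A ->
    `|C x - even_taylor s N.+1 x| <= K * (x ^+ (2 * N.+1) / (2 * N.+1)`!%:R).
  move=> /andP[x0 xA].
  have Da y : is_derive y (1:R) (C - even_taylor s N.+1) (s * S y - s * odd_taylor s N y).
    exact: (is_deriveB (DC _) (is_derive_even_taylor _ _ _)).
  have Dg y : is_derive y (1:R) (K \*: (fun y : R => y ^+ (2 * N).+2 / (2 * N).+2`!%:R))
     (K * (y ^+ (2 * N).+1 / (2 * N).+1`!%:R)).
    by apply: is_deriveZ; exact: is_derive_monomial.
  have := @norm_le_of_derive _ _ _ _ x x0 Da Dg.
  rewrite !fctE mulnS => X; apply: X.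
  - by rewrite C0 even_taylor0 subrr.
  - by rewrite /= expr0n /= mul0r scaler0.
  - move=> y /andP[y0 yx]; rewrite -mulrBr normrM.
    apply: (le_trans (ler_piMl _ s1)) => //.
    by have [|_] := IH y; rewrite ?y0 ?(le_trans yx).
split; first by apply: H1; rewrite a0.
have Da x : is_derive x (1:R) (S - odd_taylor s N.+1) (C x - even_taylor s N.+1 x).
  exact: (is_deriveB (DS _) (is_derive_odd_taylor _ _ _)).
have Dg x : is_derive x (1:R) (K \*: (fun y : R => y ^+ (2 * N.+1).+1 / (2 * N.+1).+1`!%:R))
   (K * (x ^+ (2 * N.+1) / (2 * N.+1)`!%:R)).
  by apply: is_deriveZ; exact: is_derive_monomial.
have := @norm_le_of_derive _ _ _ _ a a0 Da Dg.
rewrite !fctE => X; apply: X.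
- by rewrite S0 odd_taylor0 subr0.
- by rewrite /= expr0n /= mul0r scaler0.
- by move=> x /andP[x0 xa]; apply: H1; rewrite x0 (le_trans xa).
Qed.

Lemma taylor_remainder (s : R) C S (K A : R) N a :
  `|s| <= 1 -> (forall x, is_derive x (1:R) S (C x)) ->
  (forall x, is_derive x (1:R) C (s * S x)) ->
  C 0 = 1 -> S 0 = 0 -> (forall x, C (- x) = C x) -> (forall x, S (- x) = - S x) ->
  (forall x, 0 <= x <= A -> `|C x| <= K) ->
  `|a| <= A ->
  `|C a - even_taylor s N a| <= K * (`|a| ^+ (2 * N) / (2 * N)`!%:R) /\
  `|S a - odd_taylor s N a| <= K * (`|a| ^+ (2 * N).+1 / (2 * N).+1`!%:R).
Proof.
move=> s1 DS DC C0 S0 Ce So CK aA.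
have H := @taylor_remainder_ge0 s C S K A N `|a| s1 DS DC C0 S0 CK.
have [a0|a0] := leP 0 a.
  by move: aA H; rewrite (ger0_norm a0) => aA; apply; rewrite a0.
have e : even_taylor s N (- a) = even_taylor s N a.
  by rewrite /even_taylor; apply: eq_bigr => i _; rewrite !exprM sqrrN.
have o : odd_taylor s N (- a) = - odd_taylor s N a.
  rewrite /odd_taylor -sumrN; apply: eq_bigr => i _.
  by rewrite !exprS !exprM sqrrN !mulNr mulrN.
have := H; rewrite (ltr0_norm a0) Ce e So o -opprD normrN; apply.
by move: aA; rewrite (ltr0_norm a0) => ->; rewrite oppr_ge0 ltW.
Qed.

Definition coshR a : R := (expR a + expR (- a)) / 2.
Definition sinhR a : R := (expR a - expR (- a)) / 2.

Lemma is_derive_sinh a : is_derive a (1:R) sinhR (coshR a).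
Proof.
have -> : sinhR = (2^-1) \*: (expR - (expR \o -%R)).
  by apply/funext => x; exact: mulrC.
apply: is_derive_eq.
by rewrite mulrN1 opprK; exact: mulrC.
Qed.

Lemma is_derive_cosh a : is_derive a (1:R) coshR (sinhR a).
Proof.
have -> : coshR = (2^-1) \*: (expR + (expR \o -%R)).
  by apply/funext => x; exact: mulrC.
apply: is_derive_eq.
by rewrite mulrN1; exact: mulrC.
Qed.

(** The one-dimensional wave propagator applies [phi] to the initial position and
    a primitive [psi] of [phi] to the initial velocity and to the source. *)
Definition derivative_pair phi psi :=
  continuous phi /\ forall a, is_derive a (1:R) psi (phi a).

End analytic_continuation.

(** * From cosines to the hyperbolic cosine *)

Section functional_cosh.
Context {R : realType}.
Implicit Types (a b r rho M : R) (phi psi C S : R -> R).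

Lemma derivative_pair_taylor (s : R) N :
  derivative_pair (even_taylor s N) (odd_taylor s N).
Proof.
split; last by move=> a; exact: is_derive_odd_taylor.
case: N => [|N].
  have -> : even_taylor s 0 = cst 0 by apply/funext => a; rewrite /even_taylor big_ord0.
  by move=> a; exact: cvg_cst.
exact: is_derive_continuous (is_derive_even_taylor s N).
Qed.

Lemma derivative_pair_monomial k :
  derivative_pair (fun a : R => a ^+ k / k`!%:R)
    (fun a : R => a ^+ k.+1 / (k.+1)`!%:R).
Proof.
split; last exact: is_derive_monomial.
by move=> a; apply: cvgM; [exact: exprn_continuous|exact: cvg_cst].
Qed.

Lemma derivative_pair_lin c phi1 psi1 phi2 psi2 :
  derivative_pair phi1 psi1 -> derivative_pair phi2 psi2 ->
  derivative_pair (fun a => phi1 a + c * phi2 a) (fun a => psi1 a + c * psi2 a).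
Proof.
move=> [c1 d1] [c2 d2]; split.
  move=> a; apply: cvgD; first exact: c1.
  by apply: cvgM; [exact: cvg_cst|exact: c2].
move=> a.
have H1 := d1 a; have H2 := d2 a.
exact: (is_deriveD H1 (@is_deriveZ _ _ _ _ c _ _ _ H2)).
Qed.

Lemma derivative_pair_trig r : r != 0 ->
  derivative_pair (fun a => cos (r * a)) (fun a => sin (r * a) / r).
Proof.
move=> r0; split.
  move=> a; apply: continuous_comp; last exact: continuous_cos.
  by apply: cvgM; [exact: cvg_cst|exact: cvg_id].
move=> a.
have -> : (fun a => sin (r * a) / r) = r^-1 \*: (sin \o (r \*: id)).
  by apply/funext => x; exact: mulrC.
apply: is_derive_eq.
change (r^-1 * (cos (r * a) * (r * 1)) = cos (r * a)).
by rewrite mulr1 mulrCA mulVf // mulr1.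
Qed.

Lemma derivative_pair_hyp : derivative_pair (@coshR R) (@sinhR R).
Proof.
split; last exact: is_derive_sinh.
exact: is_derive_continuous (@is_derive_cosh R).
Qed.

Lemma even_taylor_scale r N a : even_taylor (-1) N (r * a) = even_taylor (- r ^+ 2) N a.
Proof.
rewrite /even_taylor; apply: eq_bigr => k _.
by rewrite [(r * a) ^+ _]exprMn [r ^+ (2 * k)]exprM !mulrA -exprMn mulN1r.
Qed.

Lemma odd_taylor_scale r N a : odd_taylor (-1) N (r * a) = r * odd_taylor (- r ^+ 2) N a.
Proof.
rewrite /odd_taylor mulr_sumr; apply: eq_bigr => k _.
rewrite [(r * a) ^+ _]exprMn [r ^+ (2 * k).+1]exprS [r ^+ (2 * k)]exprM !mulrA.
by rewrite [_ * r]mulrC -[r * _ * r ^+ 2 ^+ k]mulrA -exprMn mulN1r.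
Qed.

Lemma cos_taylor_remainder r rho N a : 0 < r -> 0 <= rho -> `|a| <= rho ->
  `|cos (r * a) - even_taylor (- r ^+ 2) N a| <= r ^+ (2 * N) * (1 + rho) ^+ (2 * N).+1 /\
  `|sin (r * a) / r - odd_taylor (- r ^+ 2) N a| <= r ^+ (2 * N) * (1 + rho) ^+ (2 * N).+1.
Proof.
move=> r0 rho0 arho.
have [] := @taylor_remainder R (-1) cos sin 1 `|r * a| N (r * a).
- by rewrite normrN normr1.
- by move=> x; rewrite mulN1r; exact: is_derive_cos.
- exact: cos0.
- exact: sin0.
- exact: cosN.
- exact: sinN.
- by move=> x _; rewrite ler_norml cos_geN1 cos_le1.
- by [].
have step k : `|a| ^+ k <= (1 + rho) ^+ k.
  apply: lerXn2r; rewrite ?nnegrE //; lra.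
have fac k : (`|r * a| ^+ k / k`!%:R) <= r ^+ k * (1 + rho) ^+ k.
  rewrite normrM (gtr0_norm r0) exprMn.
  apply: (@le_trans _ _ (r ^+ k * `|a| ^+ k)).
    rewrite ler_pdivrMr ?ltr0n ?fact_gt0 // ler_peMr //.
      by rewrite mulr_ge0 // exprn_ge0 // ltW.
    by rewrite ler1n fact_gt0.
  by rewrite ler_wpM2l // exprn_ge0 // ltW.
rewrite !mul1r even_taylor_scale odd_taylor_scale => H1 H2; split.
  apply: (le_trans H1); apply: (le_trans (fac _)).
  rewrite ler_wpM2l ?exprn_ge0 ?(ltW r0) // [leRHS]exprS ler_peMl ?exprn_ge0; lra.
have -> : sin (r * a) / r - odd_taylor (- r ^+ 2) N a =
    (sin (r * a) - r * odd_taylor (- r ^+ 2) N a) / r.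
  by field; rewrite gt_eqF.
rewrite normrM normfV (gtr0_norm r0) ler_pdivrMr //.
apply: (le_trans H2); apply: (le_trans (fac _)).
by rewrite exprS -mulrA mulrC.
Qed.

Lemma cosh_taylor_remainder rho N a : 0 <= rho -> `|a| <= rho ->
  `|coshR a - even_taylor 1 N a| <= expR rho * (exp_coeff rho (2 * N) + exp_coeff rho (2 * N).+1) /\
  `|sinhR a - odd_taylor 1 N a| <= expR rho * (exp_coeff rho (2 * N) + exp_coeff rho (2 * N).+1).
Proof.
move=> rho0 arho.
have [] := @taylor_remainder R 1 coshR sinhR (expR rho) rho N a.
- by rewrite normr1.
- exact: is_derive_sinh.
- by move=> x; rewrite mul1r; exact: is_derive_cosh.
- by rewrite /coshR oppr0 expR0; lra.
- by rewrite /sinhR oppr0 expR0; lra.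
- by move=> x; rewrite /coshR opprK addrC.
- by move=> x; rewrite /sinhR opprK; lra.
- move=> x /andP[x0 xr].
  have h1 : expR x <= expR rho by rewrite ler_expR.
  have h2 : expR (- x) <= expR rho by rewrite ler_expR; lra.
  have h3 := expR_gt0 x; have h4 := expR_gt0 (- x).
  by rewrite /coshR ger0_norm; lra.
- by [].
have fac k : `|a| ^+ k / k`!%:R <= exp_coeff rho k.
  rewrite /exp_coeff /= ler_wpM2r ?invr_ge0 ?ler0n //.
  by apply: lerXn2r; rewrite ?nnegrE.
have pos k : 0 <= exp_coeff rho k by exact: exp_coeff_ge0.
move=> H1 H2; split.
  apply: (le_trans H1); rewrite ler_wpM2l ?expR_ge0 //.
  by apply: (le_trans (fac _)); rewrite lerDl.
apply: (le_trans H2); rewrite ler_wpM2l ?expR_ge0 //.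
by apply: (le_trans (fac _)); rewrite lerDr.
Qed.

Section functional.
Variables (rho C : R) (L : (R -> R) -> (R -> R) -> R).
Hypothesis rho0 : 0 <= rho.
Hypothesis C0 : 0 <= C.
Hypothesis L_lin : forall c phi1 psi1 phi2 psi2,
  derivative_pair phi1 psi1 -> derivative_pair phi2 psi2 ->
  L (fun a => phi1 a + c * phi2 a) (fun a => psi1 a + c * psi2 a) =
  L phi1 psi1 + c * L phi2 psi2.
Hypothesis L_bound : forall M phi psi, derivative_pair phi psi ->
  (forall a, `|a| <= rho -> `|phi a| <= M /\ `|psi a| <= M) ->
  `|L phi psi| <= C * M.
Hypothesis L_cos : forall r, 0 < r ->
  L (fun a => cos (r * a)) (fun a => sin (r * a) / r) = 0.

Let d k := L (fun a : R => a ^+ (2 * k) / (2 * k)`!%:R)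
  (fun a : R => a ^+ (2 * k).+1 / (2 * k).+1`!%:R).

Let L_taylor s N : L (even_taylor s N) (odd_taylor s N) = \sum_(k < N) s ^+ k * d k.
Proof.
elim: N => [|N IH].
  rewrite big_ord0; apply/eqP; rewrite -normr_le0 -[leRHS](mulr0 C).
  apply: L_bound; first exact: derivative_pair_taylor.
  by move=> a _; rewrite /even_taylor /odd_taylor !big_ord0 normr0.
rewrite big_ord_recr /= -IH -L_lin.
- congr L; apply/funext => a; first by rewrite /even_taylor big_ord_recr.
  by rewrite /odd_taylor big_ord_recr.
- exact: derivative_pair_taylor.
- exact: derivative_pair_monomial.
Qed.

Let L_sub M phi1 psi1 phi2 psi2 :
  derivative_pair phi1 psi1 -> derivative_pair phi2 psi2 ->
  (forall a, `|a| <= rho ->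
     `|phi1 a - phi2 a| <= M /\ `|psi1 a - psi2 a| <= M) ->
  `|L phi1 psi1 - L phi2 psi2| <= C * M.
Proof.
move=> h1 h2 h; rewrite -mulN1r -L_lin //; apply: L_bound.
  exact: derivative_pair_lin.
by move=> a /h; rewrite !mulN1r.
Qed.

Let d0 k : d k = 0.
Proof.
elim/ltn_ind: k => k IH.
pose K := C * (1 + rho) ^+ (2 * k.+1).+1.
have K0 : 0 <= K by apply: mulr_ge0 => //; apply: exprn_ge0; rewrite addr_ge0.
have H r : 0 < r -> `|d k| <= K * r ^+ 2.
  move=> r0.
  have := @L_sub (r ^+ (2 * k.+1) * (1 + rho) ^+ (2 * k.+1).+1) _ _ _ _
    (derivative_pair_trig (lt0r_neq0 r0)) (derivative_pair_taylor (- r ^+ 2) k.+1)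
    (fun a => cos_taylor_remainder k.+1 r0 rho0).
  rewrite L_cos // L_taylor big_ord_recr big1 /=; last first.
    by move=> i _; rewrite IH // mulr0.
  rewrite sub0r add0r normrN normrM normrX normrN normrX (gtr0_norm r0) -exprM.
  rewrite mulrCA -/K mulnS exprD -mulrA [X in _ <= X]mulrCA.
  by rewrite ler_pM2l ?exprn_gt0 // mulrC.
apply/eqP; rewrite -normr_le0; apply/ler_addgt0Pr => e e0; rewrite add0r.
have [K1 q0] : 0 < K + 1 /\ 0 < e / (K + 1) by split; rewrite ?divr_gt0 //; lra.
have := H (Num.sqrt (e / (K + 1))).
rewrite sqrtr_gt0 (sqr_sqrtr (ltW q0)) => /(_ q0) h; apply: (le_trans h).
rewrite mulrA ler_pdivrMr //; nra.
Qed.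

(** Letting [r] tend to [0] in the Taylor expansion of [cos (r a)] shows, degree after
    degree, that [L] vanishes on the even monomials; the Taylor polynomials of
    [coshR] converge to it uniformly on bounded sets. *)
Lemma functional_cosh : L coshR sinhR = 0.
Proof.
have H N : `|L coshR sinhR| <=
    C * expR rho * (exp_coeff rho (2 * N) + exp_coeff rho (2 * N).+1).
  have := L_sub derivative_pair_hyp (derivative_pair_taylor 1 N)
    (fun a => cosh_taylor_remainder N rho0).
  by rewrite L_taylor big1 ?subr0 ?mulrA // => i _; rewrite d0 mulr0.
apply/eqP; rewrite -normr_le0.
have c1 : exp_coeff rho (2 * N)%N @[N --> \oo] --> (0 : R).
  apply: cvg_comp (@cvg_exp_coeff R rho) => P [m _ Pm]; exists m => // N /= mN.
  by apply: Pm; rewrite /= (leq_trans mN) // leq_pmull.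
have c2 : exp_coeff rho (2 * N).+1 @[N --> \oo] --> (0 : R).
  apply: cvg_comp (@cvg_exp_coeff R rho) => P [m _ Pm]; exists m => // N /= mN.
  by apply: Pm; rewrite /= (leq_trans mN) // ltnW // ltnS leq_pmull.
have c3 : C * expR rho * (exp_coeff rho (2 * N) + exp_coeff rho (2 * N).+1)
    @[N --> \oo] --> C * expR rho * (0 + 0).
  by apply: cvgM; [exact: cvg_cst|exact: cvgD].
rewrite addr0 mulr0 in c3.
by apply: (ler_cvg_to (cvg_cst `|L coshR sinhR|) c3); near=> N; exact: H.
Unshelve. all: by end_near.
Qed.

End functional.
End functional_cosh.

(** * D'Alembert means *)

Section wave_functional.
Context {R : realType} d (T : measurableType d) (mu : {measure set T -> \bar R}).
Variable Y : T -> R.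
Hypothesis mY : measurable_fun setT Y.
Implicit Types (h K : T -> R) (phi psi : R -> R) (b c k M : R).

Local Notation integrableT h := (mu.-integrable setT (EFin \o h)).

Lemma integrable_measurable h : integrableT h -> measurable_fun setT h.
Proof. by move=> ih; apply/measurable_EFinP; exact: measurable_int ih. Qed.

Lemma bounded_mul_integrable h K M : measurable_fun setT K -> integrableT h ->
  0 <= M -> {ae mu, forall x, h x != 0 -> `|K x| <= M} ->
  integrableT (fun x => K x * h x) /\
  `|\int[mu]_x (K x * h x)| <= M * \int[mu]_x `|h x|.
Proof.
move=> mK ih M0 KM.
have mh := integrable_measurable ih.
have mKh : measurable_fun setT (fun x => K x * h x) by exact: measurable_funM.
have ihn := integrable_norm ih.
have le : (\int[mu]_x `|(K x * h x)%:E| <= M%:E * \int[mu]_x `|h x|%:E)%E.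
  rewrite -ge0_integralZl //; last by apply/measurable_EFinP; exact: measurableT_comp.
  apply: ae_ge0_le_integral => //.
  - by apply: measurableT_comp => //; exact/measurable_EFinP.
  - by move=> x _; rewrite -EFinM lee_fin mulr_ge0.
  - by apply: measurable_funeM; apply/measurable_EFinP; exact: measurableT_comp.
  - apply: filterS KM => x KM _ /=; rewrite lee_fin normrM.
    have [->|h0] := eqVneq (h x) 0; first by rewrite normr0 !mulr0.
    by rewrite ler_wpM2r // KM.
have fin : (\int[mu]_x `|h x|%:E)%E \is a fin_num by exact: (integrable_fin_num _ ihn).
have iKh : integrableT (fun x => K x * h x).
  apply/integrableP; split; first exact/measurable_EFinP.
  by apply: (le_lt_trans le); rewrite -(fineK fin) -EFinM ltry.
split => //; apply: (le_trans (le_normr_Rintegral _ iKh)) => //.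
rewrite -lee_fin EFinM /Rintegral fineK //; last first.
  exact: (integrable_fin_num _ (integrable_norm iKh)).
by rewrite fineK.
Qed.

(** Twice the solution at time [k] of the one-dimensional wave equation with
    initial position [phi] and zero velocity, read along [Y] and integrated against [h]. *)
Definition dalembert phi k h : R :=
  \int[mu]_x ((phi (k + Y x) + phi (k - Y x)) * h x).

Let supported b h := {ae mu, forall x, h x != 0 -> `|Y x| <= b}.

Lemma dalembert_measurable phi k : continuous phi ->
  measurable_fun setT (fun x => phi (k + Y x) + phi (k - Y x)).
Proof.
move=> cphi; have mphi := continuous_measurable_fun cphi.
apply: measurable_funD; apply: measurableT_comp => //.
  by apply: measurable_funD => //; exact: measurable_cst.
by apply: measurable_funB => //; exact: measurable_cst.
Qed.

Lemma dalembert_bound phi k h b rho M : continuous phi -> integrableT h ->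
  supported b h -> `|k| + b <= rho -> (forall a, `|a| <= rho -> `|phi a| <= M) ->
  0 <= M ->
  integrableT (fun x => (phi (k + Y x) + phi (k - Y x)) * h x) /\
  `|dalembert phi k h| <= 2 * M * \int[mu]_x `|h x|.
Proof.
move=> cphi ih bh kb phiM M0; apply: bounded_mul_integrable => //.
- exact: dalembert_measurable.
- by rewrite mulr_ge0.
- apply: filterS bh => x Yb /Yb {}Yb.
  apply: (le_trans (ler_normD _ _)); rewrite mulrDl mul1r lerD //; apply: phiM.
    by apply: (le_trans (ler_normD _ _)); apply: le_trans kb; rewrite lerD2l.
  by apply: (le_trans (ler_normB _ _)); apply: le_trans kb; rewrite lerD2l.
Qed.

Lemma continuous_bounded_on phi rho : continuous phi ->
  exists2 M, 0 <= M & forall a, `|a| <= rho -> `|phi a| <= M.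
Proof.
move=> cphi.
have : bounded_set (phi @` `[- rho, rho]).
  apply/compact_bounded/continuous_compact; last exact: segment_compact.
  exact: continuous_subspaceT.
move=> [M [Mr HM]]; exists (`|M| + 1); first by rewrite addr_ge0.
move=> a ar; apply: (HM (`|M| + 1)).
  by rewrite (le_lt_trans (ler_norm M)) // ltrDl.
by exists a => //; rewrite /= in_itv /= -ler_norml.
Qed.

Lemma dalembert_integrable phi k h b : continuous phi -> integrableT h ->
  supported b h -> integrableT (fun x => (phi (k + Y x) + phi (k - Y x)) * h x).
Proof.
move=> cphi ih bh; have [M M0 HM] := continuous_bounded_on (`|k| + b) cphi.
by have [] := dalembert_bound cphi ih bh (lexx _) HM M0.
Qed.

Lemma dalembert_lin phi1 phi2 c k h b : continuous phi1 -> continuous phi2 ->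
  integrableT h -> supported b h ->
  dalembert (fun a => phi1 a + c * phi2 a) k h =
  dalembert phi1 k h + c * dalembert phi2 k h.
Proof.
move=> c1 c2 ih bh.
have i1 := @dalembert_integrable _ k _ _ c1 ih bh.
have i2 := @dalembert_integrable _ k _ _ c2 ih bh.
rewrite /dalembert -RintegralZl // -RintegralD //; last first.
  by have := integrableZl measurableT c i2; apply: eq_integrable.
by apply: eq_Rintegral => x _; ring.
Qed.

Section time.
Variables (t lam b : R) (w : R -> T -> R).
Hypothesis t0 : 0 <= t.
Hypothesis lam0 : 0 < lam.
Hypothesis b0 : 0 <= b.
Hypothesis iw : forall s, 0 <= s <= t -> integrableT (w s).
Hypothesis sw : forall s, 0 <= s <= t -> supported b (w s).
Hypothesis cw : forall s, 0 <= s <= t -> forall e, 0 < e ->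
  exists2 del, 0 < del & forall s', 0 <= s' <= t -> `|s' - s| < del ->
    \int[mu]_x `|w s' x - w s x| <= e.
Hypothesis gw : lebesgue_measure.-integrable `[0, t]
  (fun s => (\int[mu]_x `|w s x|)%:E).

Let rho := lam * t + b.
Let D psi s := dalembert psi (lam * (t - s)) (w s).

Let in_rho s : 0 <= s <= t -> `|lam * (t - s)| + b <= rho.
Proof.
by move=> /andP[s0 st]; rewrite ger0_norm ?mulr_ge0 ?subr_ge0 ?(ltW lam0) // lerD2r ler_pM2l //; lra.
Qed.

(** Continuity in time serves as a proof of measurability; [psi] is Lipschitz on
    bounded sets because its derivative [phi] is bounded there. *)
Let dalembert_time_continuous phi psi : derivative_pair phi psi ->
  {within `[0, t], continuous (D psi)}.
Proof.
move=> [cphi dpsi].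
have cpsi := is_derive_continuous dpsi.
have [M M0 HM] := continuous_bounded_on rho cpsi.
have [M1 M10 HM1] := continuous_bounded_on rho cphi.
have lip a a' : `|a| <= rho -> `|a'| <= rho -> `|psi a - psi a'| <= M1 * `|a - a'|.
  wlog : a a' / a' <= a => [H ar ar'|aa' ar ar'].
    have [/H->//|/ltW h] := leP a' a.
    by rewrite distrC [`|a - a'|]distrC; exact: H.
  have [c] := MVT_segment aa' (fun x _ => dpsi x)
     (continuous_subspaceT cpsi).
  rewrite in_itv /= => /andP[ac ca'] ->; rewrite normrM ler_wpM2r // HM1 //.
  by move: ar ar'; rewrite !ler_norml => /andP[? ?] /andP[? ?]; apply/andP; split; lra.
apply/subspace_continuousP => s /=; rewrite in_itv /= => st.
apply/cvgrPdist_le => e e0.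
pose W := \int[mu]_x `|w s x|.
have W0 : 0 <= W by apply: Rintegral_ge0.
have p1 : 0 < e / 2 / (2 * M + 1) by rewrite !divr_gt0 //; lra.
have [del del0 Hdel] := cw st p1.
have p2 : 0 < e / 2 / (2 * M1 * lam * W + 1).
  rewrite !divr_gt0 // ltr_wpDl // !mulr_ge0 // ltW //.
rewrite near_withinE; apply/nbhs_ballP.
exists (Num.min del (e / 2 / (2 * M1 * lam * W + 1))); first by rewrite /= lt_min del0.
move=> s'; rewrite /ball /= lt_min distrC => /andP[d1 d2]; rewrite in_itv /= => s't.
have h1 := Hdel _ s't d1.
have iws' := iw s't; have iws := iw st.
have [idiff ddiff] : integrableT (fun x => w s' x - w s x) /\
    supported b (fun x => w s' x - w s x).
  split.
    by have := integrableB measurableT iws' iws; apply: eq_integrable.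
  apply: filterS2 (sw s't) (sw st) => x h h' ne.
  have [e1|/h//] := eqVneq (w s' x) 0.
  by apply: h'; move: ne; rewrite e1 sub0r oppr_eq0.
have [_ B1] := dalembert_bound cpsi idiff ddiff (in_rho s't) HM M0.
pose K x := (psi (lam * (t - s') + Y x) + psi (lam * (t - s') - Y x)) -
  (psi (lam * (t - s) + Y x) + psi (lam * (t - s) - Y x)).
have mK : measurable_fun setT K.
  by apply: measurable_funB; exact: dalembert_measurable.
have kk : `|lam * (t - s') - lam * (t - s)| = lam * `|s' - s|.
  rewrite -mulrBr normrM (gtr0_norm lam0) distrC; congr (_ * `|_|); ring.
have KM : {ae mu, forall x, w s x != 0 -> `|K x| <= 2 * M1 * lam * `|s' - s|}.
  apply: filterS (sw st) => x h /h {}h.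
  have l1 : `|psi (lam * (t - s') + Y x) - psi (lam * (t - s) + Y x)| <= M1 * (lam * `|s' - s|).
    apply: (le_trans (lip _ _ _ _)).
    - by apply: (le_trans (ler_normD _ _)); apply: le_trans (in_rho s't); rewrite lerD2l.
    - by apply: (le_trans (ler_normD _ _)); apply: le_trans (in_rho st); rewrite lerD2l.
    - by rewrite opprD addrACA subrr addr0 kk.
  have l2 : `|psi (lam * (t - s') - Y x) - psi (lam * (t - s) - Y x)| <= M1 * (lam * `|s' - s|).
    apply: (le_trans (lip _ _ _ _)).
    - by apply: (le_trans (ler_normB _ _)); apply: le_trans (in_rho s't); rewrite lerD2l.
    - by apply: (le_trans (ler_normB _ _)); apply: le_trans (in_rho st); rewrite lerD2l.
    - by rewrite opprD addrACA opprK addNr addr0 kk.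
  rewrite /K opprD addrACA; apply: (le_trans (ler_normD _ _)).
  by apply: (le_trans (lerD l1 l2)); rewrite -mulrDl -!mulrA; lra.
have [iK B2] := bounded_mul_integrable mK iws (ltac:(by rewrite !mulr_ge0 // ltW) : 0 <= 2 * M1 * lam * `|s' - s|) KM.
have -> : D psi s - D psi s' = - (dalembert psi (lam * (t - s')) (fun x => w s' x - w s x) +
     \int[mu]_x (K x * w s x)).
  rewrite /D /dalembert -RintegralD //; last first.
    exact: (@dalembert_integrable _ (lam * (t - s')) _ _ cpsi idiff ddiff).
  rewrite -opprB; congr (- _); rewrite -RintegralB //.
  - by apply: eq_Rintegral => x _; rewrite /K; ring.
  - exact: (@dalembert_integrable _ _ _ _ cpsi iws' (sw s't)).
  - exact: (@dalembert_integrable _ _ _ _ cpsi iws (sw st)).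
rewrite normrN; apply: (le_trans (ler_normD _ _)).
have b1 : 2 * M * \int[mu]_x `|w s' x - w s x| <= e / 2.
  apply: (@le_trans _ _ (2 * M * (e / 2 / (2 * M + 1)))).
    by rewrite ler_wpM2l // mulr_ge0.
  by rewrite mulrA ler_pdivrMr; nra.
have b2 : 2 * M1 * lam * `|s' - s| * W <= e / 2.
  have P0 : 0 <= 2 * M1 * lam * W by rewrite !mulr_ge0 // ltW.
  move: d2; rewrite ltr_pdivlMr; last lra.
  have := normr_ge0 (s' - s); nra.
by have := lerD (le_trans B1 b1) (le_trans B2 b2); rewrite -splitr.
Qed.

Lemma dalembert_time_integrable phi psi M : derivative_pair phi psi ->
  (forall a, `|a| <= rho -> `|psi a| <= M) -> 0 <= M ->
  lebesgue_measure.-integrable `[0, t] (EFin \o D psi) /\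
  `|\int[lebesgue_measure]_(s in `[0, t]) D psi s| <=
  2 * M * \int[lebesgue_measure]_(s in `[0, t]) \int[mu]_x `|w s x|.
Proof.
move=> dp HM M0; have [cphi dpsi] := dp.
have cpsi := is_derive_continuous dpsi.
have mD : measurable_fun `[0, t] (D psi).
  by apply: subspace_continuous_measurable_fun => //; exact: dalembert_time_continuous dp.
have bD s : `[0, t]%classic s -> `|D psi s| <= 2 * M * \int[mu]_x `|w s x|.
  rewrite /= in_itv /= => st.
  by have [] := dalembert_bound cpsi (iw st) (sw st) (in_rho st) HM M0.
have mI : measurable (`[0, t]%classic : set (measurableTypeR R)) by exact: measurable_itv.
have igM := integrableZl mI (2 * M) gw.
have iD : lebesgue_measure.-integrable `[0, t] (EFin \o D psi).
  apply: le_integrable igM => //; first exact/measurable_EFinP.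
  move=> s /bD bs /=; rewrite lee_fin; apply: (le_trans bs); exact: ler_norm.
split => //; apply: (le_trans (le_normr_Rintegral _ iD)) => //.
rewrite -RintegralZl //; apply: le_Rintegral => //.
exact: integrable_norm.
Qed.

End time.
End wave_functional.

(** * The wave equation at imaginary frequencies *)

Section hyperbolic_identity.
Context {R : realType} d (T : measurableType d) (mu : {measure set T -> \bar R}).
Variable Y : T -> R.
Hypothesis mY : measurable_fun setT Y.
Local Notation integrableT h := (mu.-integrable setT (EFin \o h)).
Local Notation supported b h := {ae mu, forall x, h x != 0 -> `|Y x| <= b}.
Implicit Types (h : T -> R) (phi psi : R -> R).

Lemma cosD_cosB (a y : R) : cos (a + y) + cos (a - y) = 2 * cos a * cos y.
Proof. by rewrite cosD cosB; ring. Qed.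

Lemma sinD_sinB (a y : R) : sin (a + y) + sin (a - y) = 2 * sin a * cos y.
Proof. by rewrite sinD sinB; ring. Qed.

Lemma coshD_coshB (a y : R) : coshR (a + y) + coshR (a - y) = 2 * coshR a * coshR y.
Proof. by rewrite /coshR !opprD !opprK !expRD; field. Qed.

Lemma sinhD_sinhB (a y : R) : sinhR (a + y) + sinhR (a - y) = 2 * sinhR a * coshR y.
Proof. by rewrite /sinhR /coshR !opprD !opprK !expRD; field. Qed.

Lemma continuous_cosh : continuous (@coshR R).
Proof. by case: (@derivative_pair_hyp R). Qed.

Lemma mul_integrable phi h b : continuous phi -> integrableT h -> supported b h ->
  integrableT (fun x => phi (Y x) * h x).
Proof.
move=> cphi ih bh; have [M M0 HM] := continuous_bounded_on b cphi.
have mK : measurable_fun setT (phi \o Y).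
  by apply: measurableT_comp => //; exact: continuous_measurable_fun.
have [] := bounded_mul_integrable mK ih M0 _ => //.
by apply: filterS bh => x hb /hb; exact: HM.
Qed.

Lemma dalembert_factor (phi e : R -> R) k c h b :
  continuous e -> integrableT h -> supported b h ->
  (forall y, phi (k + y) + phi (k - y) = c * e y) ->
  dalembert mu Y phi k h = c * \int[mu]_x (e (Y x) * h x).
Proof.
move=> ce ih bh H; rewrite -RintegralZl //; last exact: mul_integrable ih bh.
by apply: eq_Rintegral => x _; rewrite H mulrA.
Qed.

Variables (t lam b : R) (w : R -> T -> R) (v h0 h1 : T -> R).
Hypothesis t0 : 0 <= t.
Hypothesis lam0 : 0 < lam.
Hypothesis b0 : 0 <= b.
Hypothesis iw : forall s, 0 <= s <= t -> integrableT (w s).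
Hypothesis sw : forall s, 0 <= s <= t -> supported b (w s).
Hypothesis cw : forall s, 0 <= s <= t -> forall e, 0 < e ->
  exists2 del, 0 < del & forall s', 0 <= s' <= t -> `|s' - s| < del ->
    \int[mu]_x `|w s' x - w s x| <= e.
Hypothesis gw : lebesgue_measure.-integrable `[0, t]
  (fun s => (\int[mu]_x `|w s x|)%:E).
Hypotheses (iv : integrableT v) (i0 : integrableT h0) (i1 : integrableT h1).
Hypotheses (sv : supported b v) (s0 : supported b h0) (s1 : supported b h1).

(** Twice the defect of d'Alembert's formula, with Duhamel's term for the source [w]. *)
Let L phi psi := dalembert mu Y phi 0 v - dalembert mu Y phi (lam * t) h0 -
  lam^-1 * dalembert mu Y psi (lam * t) h1 -
  lam^-1 * \int[lebesgue_measure]_(s in `[0, t])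
             dalembert mu Y psi (lam * (t - s)) (w s).

Let rho := lam * t + b.

Let mI : measurable (`[0, t]%classic : set (measurableTypeR R)).
Proof. exact: measurable_itv. Qed.

Let time_integrable phi psi : derivative_pair phi psi ->
  lebesgue_measure.-integrable `[0, t]
    (EFin \o (fun s => dalembert mu Y psi (lam * (t - s)) (w s))).
Proof.
move=> dp; have [_ dpsi] := dp.
have [M M0 HM] := continuous_bounded_on rho (is_derive_continuous dpsi).
by have [] := @dalembert_time_integrable R d T mu Y mY t lam b w lam0 iw sw cw gw
  phi psi M dp HM M0.
Qed.

Let L_lin c phi1 psi1 phi2 psi2 :
  derivative_pair phi1 psi1 -> derivative_pair phi2 psi2 ->
  L (fun a => phi1 a + c * phi2 a) (fun a => psi1 a + c * psi2 a) =
  L phi1 psi1 + c * L phi2 psi2.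
Proof.
move=> p1 p2; have [c1 d1] := p1; have [c2 d2] := p2.
have e1 := is_derive_continuous d1; have e2 := is_derive_continuous d2.
rewrite /L (dalembert_lin mY _ _ c1 c2 iv sv) (dalembert_lin mY _ _ c1 c2 i0 s0).
rewrite (dalembert_lin mY _ _ e1 e2 i1 s1).
rewrite (_ : \int[_]_(s in _) dalembert mu Y (fun a => _ + _) _ _ =
  \int[lebesgue_measure]_(s in `[0, t]) dalembert mu Y psi1 (lam * (t - s)) (w s) +
  c * \int[lebesgue_measure]_(s in `[0, t]) dalembert mu Y psi2 (lam * (t - s)) (w s));
  first by ring.
have I1 := time_integrable p1; have I2 := time_integrable p2.
have I2c : lebesgue_measure.-integrable `[0, t] (EFin \o
   (fun s => c * dalembert mu Y psi2 (lam * (t - s)) (w s))).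
  by have := integrableZl mI c I2; apply: eq_integrable.
rewrite -RintegralZl // -RintegralD //.
apply: eq_Rintegral => s; rewrite inE /= in_itv /= => st.
by rewrite (dalembert_lin mY _ _ e1 e2 (iw st) (sw st)).
Qed.

Let C := 2 * (\int[mu]_x `|v x| + \int[mu]_x `|h0 x| + lam^-1 * \int[mu]_x `|h1 x| +
  lam^-1 * \int[lebesgue_measure]_(s in `[0, t]) \int[mu]_x `|w s x|).

Let L_bound M phi psi : derivative_pair phi psi ->
  (forall a, `|a| <= rho -> `|phi a| <= M /\ `|psi a| <= M) ->
  `|L phi psi| <= C * M.
Proof.
move=> p HM; have [c dp] := p; have e := is_derive_continuous dp.
have rho0 : 0 <= rho by rewrite addr_ge0 // mulr_ge0 // ltW.
have M0 : 0 <= M.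
  have [|+ _] := HM 0; first by rewrite normr0.
  exact: le_trans.
have H1 a : `|a| <= rho -> `|phi a| <= M by case/HM.
have H2 a : `|a| <= rho -> `|psi a| <= M by case/HM.
have lt : `|lam * t| + b <= rho by rewrite ger0_norm // mulr_ge0 // ltW.
have l0 : `|0 : R| + b <= rho by rewrite normr0 lerD2r mulr_ge0 // ltW.
have [_ B1] := dalembert_bound mY c iv sv l0 H1 M0.
have [_ B2] := dalembert_bound mY c i0 s0 lt H1 M0.
have [_ B3] := dalembert_bound mY e i1 s1 lt H2 M0.
have [_ B4] := @dalembert_time_integrable R d T mu Y mY t lam b w lam0 iw sw cw gw
  phi psi M p H2 M0.
have li : 0 <= lam^-1 by rewrite invr_ge0 ltW.
have B3' := ler_wpM2l li B3; have B4' := ler_wpM2l li B4.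
rewrite /L; apply: (le_trans (ler_normB _ _)).
rewrite [X in _ + X]normrM (ger0_norm li).
apply: (@le_trans _ _ (C * M)); last by [].
apply: (@le_trans _ _ (2 * M * (\int[mu]_x `|v x|) + 2 * M * (\int[mu]_x `|h0 x|) +
  lam^-1 * (2 * M * \int[mu]_x `|h1 x|) + lam^-1 * (2 * M *
  \int[lebesgue_measure]_(s in `[0, t]) \int[mu]_x `|w s x|))).
  rewrite lerD //; apply: (le_trans (ler_normB _ _)); rewrite normrM (ger0_norm li).
  by rewrite lerD //; apply: (le_trans (ler_normB _ _)); rewrite lerD.
by rewrite /C le_eqVlt; apply/orP; left; apply/eqP; ring.
Qed.

Hypothesis fourier_cos : forall r, 0 < r ->
  \int[mu]_x (cos (r * Y x) * v x) =
  cos (t * (r * lam)) * \int[mu]_x (cos (r * Y x) * h0 x) +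
  sin (t * (r * lam)) / (r * lam) * \int[mu]_x (cos (r * Y x) * h1 x) +
  \int[lebesgue_measure]_(s in `[0, t])
    (sin ((t - s) * (r * lam)) / (r * lam) * \int[mu]_x (cos (r * Y x) * w s x)).

Let L_cos r : 0 < r -> L (fun a => cos (r * a)) (fun a => sin (r * a) / r) = 0.
Proof.
move=> r0.
have r_neq0 : r != 0 by rewrite gt_eqF.
have l_neq0 : lam != 0 by rewrite gt_eqF.
have dp := derivative_pair_trig r_neq0.
have [cc _] := dp.
have fc k y : cos (r * (k + y)) + cos (r * (k - y)) = 2 * cos (r * k) * cos (r * y).
  by rewrite mulrDr mulrBr cosD_cosB.
have fs k y : sin (r * (k + y)) / r + sin (r * (k - y)) / r = 2 * sin (r * k) / r * cos (r * y).
  by rewrite mulrDr mulrBr -mulrDl sinD_sinB mulrAC.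
rewrite /L (dalembert_factor cc iv sv (fc 0)).
rewrite (dalembert_factor cc i0 s0 (fc _)) (dalembert_factor cc i1 s1 (fs _)).
rewrite mulr0 cos0 fourier_cos //.
rewrite (_ : \int[_]_(s in _) dalembert _ _ _ _ _ = 2 * lam *
  \int[lebesgue_measure]_(s in `[0, t])
    (sin ((t - s) * (r * lam)) / (r * lam) * \int[mu]_x (cos (r * Y x) * w s x))).
  rewrite (_ : t * (r * lam) = r * (lam * t)); last by ring.
  by field; rewrite ?r_neq0 ?l_neq0.
rewrite -RintegralZl //.
  apply: eq_Rintegral => s; rewrite inE /= in_itv /= => st.
  rewrite (dalembert_factor cc (iw st) (sw st) (fs _)).
  rewrite (_ : (t - s) * (r * lam) = r * (lam * (t - s))); last by ring.
  by field; rewrite ?r_neq0 ?l_neq0.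
have := integrableZl mI (2 * lam)^-1 (time_integrable dp).
apply: eq_integrable => // s; rewrite inE /= in_itv /= => st.
rewrite (dalembert_factor cc (iw st) (sw st) (fs _)) -EFinM; congr (_%:E).
rewrite (_ : (t - s) * (r * lam) = r * (lam * (t - s))); last by ring.
by field; rewrite ?r_neq0 ?l_neq0.
Qed.

(** The identity at the imaginary frequency, where the sines and cosines of the
    propagator become positive hyperbolic functions. *)
Lemma hyperbolic_identity :
  lebesgue_measure.-integrable `[0, t] (fun s =>
     (sinhR (lam * (t - s)) / lam * \int[mu]_x (coshR (Y x) * w s x))%:E) /\
  \int[mu]_x (coshR (Y x) * v x) =
  coshR (lam * t) * \int[mu]_x (coshR (Y x) * h0 x) +
  sinhR (lam * t) / lam * \int[mu]_x (coshR (Y x) * h1 x) +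
  \int[lebesgue_measure]_(s in `[0, t])
    (sinhR (lam * (t - s)) / lam * \int[mu]_x (coshR (Y x) * w s x)).
Proof.
have l_neq0 : lam != 0 by rewrite gt_eqF.
have rho0 : 0 <= rho by rewrite addr_ge0 // mulr_ge0 // ltW.
have C0 : 0 <= C.
  by rewrite mulr_ge0 // !addr_ge0 ?mulr_ge0 ?invr_ge0 ?(ltW lam0) //; apply: Rintegral_ge0 => // s _; exact: Rintegral_ge0.
have := functional_cosh rho0 C0 L_lin L_bound L_cos.
have cc := continuous_cosh.
have iT : lebesgue_measure.-integrable `[0, t] (fun s =>
     (sinhR (lam * (t - s)) / lam * \int[mu]_x (coshR (Y x) * w s x))%:E).
  have := integrableZl mI (2 * lam)^-1 (time_integrable (@derivative_pair_hyp R)).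
  apply: eq_integrable => // s; rewrite inE /= in_itv /= => st.
  rewrite (dalembert_factor cc (iw st) (sw st) (sinhD_sinhB _)) -EFinM; congr (_%:E).
  by field.
rewrite /L (dalembert_factor cc iv sv (coshD_coshB 0)).
rewrite (dalembert_factor cc i0 s0 (coshD_coshB _)) (dalembert_factor cc i1 s1 (sinhD_sinhB _)).
rewrite (_ : \int[_]_(s in _) dalembert _ _ _ _ _ = 2 * lam *
  \int[lebesgue_measure]_(s in `[0, t])
    (sinhR (lam * (t - s)) / lam * \int[mu]_x (coshR (Y x) * w s x))); last first.
  rewrite -RintegralZl //; apply: eq_Rintegral => s; rewrite inE /= in_itv /= => st.
  by rewrite (dalembert_factor cc (iw st) (sw st) (sinhD_sinhB _)); field.
rewrite (_ : coshR 0 = 1); last by rewrite /coshR oppr0 expR0; field.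
move=> H; split => //; apply/eqP; rewrite -subr_eq0; apply/eqP.
by rewrite -[RHS](mulr0 2^-1) -[X in _ = _ * X]H; field.
Qed.

End hyperbolic_identity.

(** * The Euclidean norm and powers *)

Section euclidean_space.
Context {R : realType} {n : nat}.
Implicit Types (x y xi : 'rV[R]_n).
Local Notation mu := (@lebesgue_rV R n).

Lemma measurable_dotr d (T : measurableType d) (f g : T -> 'rV[R]_n) :
  measurable_fun setT f -> measurable_fun setT g ->
  measurable_fun setT (fun z => dotr (f z) (g z)).
Proof.
move=> mf mg; apply: measurable_sum => i; apply: measurable_funM.
  by move/measurable_fun_rVP : mf; exact.
by move/measurable_fun_rVP : mg; exact.
Qed.

Lemma dotr_ge0 x : 0 <= dotr x x.
Proof. by apply: sumr_ge0 => i _; rewrite -expr2 sqr_ge0. Qed.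

Lemma enorm_ge0 x : 0 <= enorm x. Proof. exact: sqrtr_ge0. Qed.

Lemma enorm_sqr x : enorm x ^+ 2 = dotr x x.
Proof. by rewrite sqr_sqrtr // dotr_ge0. Qed.

Lemma enormZ r x : 0 <= r -> enorm (r *: x) = r * enorm x.
Proof.
move=> r0; rewrite /enorm.
have -> : dotr (r *: x) (r *: x) = r ^+ 2 * dotr x x.
  by rewrite /dotr mulr_sumr; apply: eq_bigr => i _; rewrite !mxE; ring.
by rewrite sqrtrM ?sqr_ge0 // sqrtr_sqr ger0_norm.
Qed.

Lemma dotrZl r x y : dotr (r *: x) y = r * dotr x y.
Proof. by rewrite /dotr mulr_sumr; apply: eq_bigr => i _; rewrite !mxE mulrA. Qed.

Lemma measurable_enorm : measurable_fun setT (@enorm R n).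
Proof.
apply: (@measurableT_comp _ _ _ _ _ _ (fun r : R => Num.sqrt r)).
  exact: continuous_measurable_fun (@sqrt_continuous R).
by apply: measurable_dotr; exact: measurable_id.
Qed.

Lemma le_coor_enorm x i : `|x ord0 i| <= enorm x.
Proof.
rewrite -sqrtr_sqr ler_sqrt ?dotr_ge0 // /dotr (bigD1 i) //= -expr2 lerDl.
by apply: sumr_ge0 => j _; rewrite -expr2 sqr_ge0.
Qed.

Lemma le_dotr_enorm xi x : `|dotr xi x| <= (\sum_i `|xi ord0 i|) * enorm x.
Proof.
apply: (le_trans (ler_norm_sum _ _ _)); rewrite mulr_suml; apply: ler_sum => i _.
by rewrite normrM ler_wpM2l // le_coor_enorm.
Qed.

Definition eball (r : R) : set 'rV[R]_n := [set x | enorm x <= r].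

Lemma measurable_eball r : measurable (eball r).
Proof.
have := measurable_enorm measurableT (measurable_itv `]-oo, r] : measurable (_ : set (measurableTypeR R))).
by rewrite setTI; congr measurable; apply/seteqP; split => x /=; rewrite in_itv.
Qed.

Lemma eball_fin r : (mu (eball r) < +oo)%E.
Proof.
pose A (i : 'I_n) : set (measurableTypeR R) := `[- r, r]%classic.
have mA i : measurable (A i) by exact: measurable_itv.
apply: (@le_lt_trans _ _ (mu [set x : 'rV[R]_n | forall i, A i (x ord0 i)])).
  apply: le_measure; rewrite ?inE; first exact: measurable_eball.
    have -> : [set x : 'rV[R]_n | forall i, A i (x ord0 i)] =
        \bigcap_(i in [set: 'I_n]) ((fun x : 'rV[R]_n => x ord0 i) @^-1` A i).
      by apply/seteqP; split => x Ax i => [_|]; exact: (Ax i).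
    apply: fin_bigcap_measurable => // i _.
    by rewrite -[X in measurable X]setTI; exact: (measurable_coor i measurableT (mA i)).
  move=> x /= xr i; rewrite /A /= in_itv /= -ler_norml.
  exact: le_trans (le_coor_enorm x i) xr.
rewrite lebesgue_rV_box // -ge0_fin_numE; last by apply: prode_ge0 => i _.
elim/big_ind : _ => [//|a b|i _]; first exact: fin_numM.
by rewrite ge0_fin_numE // /A lebesgue_measure_itv; case: ifPn; rewrite ?ltry.
Qed.

Lemma supp_in_ballP (r : R) (h : 'rV[R]_n -> R) :
  supp_in_ball r h -> {ae mu, forall x, h x != 0 -> enorm x <= r}.
Proof.
by apply: filterS => x hx h0; rewrite leNgt; apply: contraNN h0 => /hx ->.
Qed.

End euclidean_space.

Section power_continuity.
Context {R : realType}.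

Lemma powR_subn1_le1D (p a : R) : 1 < p <= 2 -> 0 <= a -> a `^ (p - 1) <= 1 + a.
Proof.
move=> /andP[p1 p2] a0; have [a1|a1] := leP a 1.
  apply: (@le_trans _ _ (1 `^ (p - 1))); last by rewrite powR1; lra.
  by apply: ge0_ler_powR; rewrite ?nnegrE //; lra.
by apply: (@le_trans _ _ a); [apply: ler1_powR; lra|lra].
Qed.

(** For [p <= 2] the derivative [p a^(p - 1)] of the power grows at most linearly. *)
Lemma norm_powRB (p a b : R) : 1 < p <= 2 -> 0 <= a -> 0 <= b ->
  `|a `^ p - b `^ p| <= `|a - b| * (2 + a + b).
Proof.
move=> p12; have /andP[p1 p2] := p12.
wlog : a b / b <= a => [H a0 b0|ba a0 b0].
  have [/H->//|/ltW h] := leP b a.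
  by rewrite distrC [`|a - b|]distrC [2 + a + b]addrAC; exact: H.
have p0 : 0 < p by lra.
have hp := ge0_ler_powR (ltW p0) b0 a0 ba.
rewrite !ger0_norm ?subr_ge0 //.
have ha := powR_subn1_le1D p12 a0; have hb := powR_subn1_le1D p12 b0.
have [bz|b_neq0] := eqVneq b 0.
  rewrite bz powR0 ?gt_eqF // !subr0 addr0 -mulr_powRB1 // ler_wpM2l //; lra.
have {}b_neq0 : 0 < b by rewrite lt_neqAle eq_sym b_neq0.
have a_neq0 : 0 < a by exact: lt_le_trans ba.
have key : b * a `^ (p - 1) <= b `^ (p - 1) * a.
  have : (a / b) `^ (p - 1) <= a / b.
    by apply: ler1_powR; rewrite ?ler_pdivlMr ?mul1r //; lra.
  rewrite powRM ?invr_ge0 // -powR_inv1 // -powRrM mulN1r powRN.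
  by rewrite powR_inv1 // ler_pdivlMr // mulrAC ler_pdivrMr ?powR_gt0 //; rewrite mulrC [a * _]mulrC.
rewrite -(mulr_powRB1 a0 p0) -(mulr_powRB1 b0 p0).
have := powR_ge0 a (p - 1); have := powR_ge0 b (p - 1); nra.
Qed.

End power_continuity.

(** * Continuity in time of the nonlinearity *)

Section power_L1.
Context {R : realType} d (T : measurableType d) (mu : {measure set T -> \bar R}).
Local Notation integrableT h := (mu.-integrable setT (EFin \o h)).

(** Young's inequality removes the mixed term, so that integration meets
    squares only. *)
Lemma norm_powRB_young (p a b del : R) : 1 < p <= 2 -> 0 < del ->
  `| `|a| `^ p - `|b| `^ p| <=
  (1 + del^-1) * (a - b) ^+ 2 + 2 * del * (1 + b ^+ 2).
Proof.
move=> p12 del0.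
apply: (le_trans (norm_powRB p12 (normr_ge0 a) (normr_ge0 b))).
have h1 := ler_dist_dist a b.
have h2 : `|a| <= `|b| + `|a - b|.
  by have := ler_normD b (a - b); rewrite addrCA subrr addr0.
set D := `|a - b| in h1 h2 *.
have D0 : 0 <= D by exact: normr_ge0.
have b0 := normr_ge0 b.
have -> : (a - b) ^+ 2 = D ^+ 2 by rewrite /D real_normK // num_real.
have -> : b ^+ 2 = `|b| ^+ 2 by rewrite real_normK // num_real.
have d0 := normr_ge0 (`|a| - `|b|).
apply: (@le_trans _ _ (D * (2 + 2 * `|b| + D))); first by nra.
have di : 0 < del^-1 by rewrite invr_gt0.
have e1 : del * del^-1 = 1 by rewrite divff // gt_eqF.
have sq : 0 <= del^-1 * (D - del * (1 + `|b|)) ^+ 2 by rewrite mulr_ge0 ?sqr_ge0 // ltW.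
have -> : (1 + del^-1) * D ^+ 2 + 2 * del * (1 + `|b| ^+ 2) =
   D * (2 + 2 * `|b| + D) + del^-1 * (D - del * (1 + `|b|)) ^+ 2 +
   del * (1 - `|b|) ^+ 2.
  by move: (`|b|) => c; field; rewrite gt_eqF.
have sq' : 0 <= del * (1 - `|b|) ^+ 2 by rewrite mulr_ge0 ?sqr_ge0 // ltW.
by rewrite -[leRHS]addrA lerDl addr_ge0.
Qed.

Lemma power_L1_bound (p del : R) (h h' : T -> R) (B : set T) :
  1 < p <= 2 -> 0 < del -> measurable B -> (mu B < +oo)%E ->
  integrableT (fun x => `|h x| `^ p) -> integrableT (fun x => `|h' x| `^ p) ->
  integrableT (fun x => (h x) ^+ 2) -> integrableT (fun x => (h' x - h x) ^+ 2) ->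
  {ae mu, forall x, ~ B x -> h x = 0} -> {ae mu, forall x, ~ B x -> h' x = 0} ->
  \int[mu]_x `| `|h' x| `^ p - `|h x| `^ p| <=
  (1 + del^-1) * \int[mu]_x (h' x - h x) ^+ 2 +
  2 * del * (fine (mu B) + \int[mu]_x (h x) ^+ 2).
Proof.
move=> p12 del0 mB Bfin ip ip' ih2 ihh sB sB'.
have iB : integrableT (\1_B : T -> R).
  apply/integrableP; split; first by apply/measurable_EFinP; exact: measurable_indic.
  rewrite (eq_integral (fun x => (\1_B x)%:E)); last first.
    by move=> x _ /=; rewrite ger0_norm.
  by rewrite integral_indic // setIT.
have iD : integrableT (fun x => `|h' x| `^ p - `|h x| `^ p).
  by have := integrableB measurableT ip' ip; apply: eq_integrable.
have iZ (k : R) f : integrableT f -> integrableT (fun x => k * f x).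
  by move=> fi; have := integrableZl measurableT k fi; apply: eq_integrable.
have iP f g : integrableT f -> integrableT g -> integrableT (fun x => f x + g x).
  by move=> fi gi; have := integrableD measurableT fi gi; apply: eq_integrable.
have -> : fine (mu B) = \int[mu]_x (\1_B x : R).
  by rewrite /Rintegral integral_indic // setIT.
rewrite -RintegralD // -!RintegralZl //; last exact: iP.
rewrite -RintegralD //; [|exact: iZ|by apply: iZ; exact: iP].
have pos (y : R) x : 0 <= (1 + del^-1) * y ^+ 2 + 2 * del * (\1_B x + h x ^+ 2).
  apply: addr_ge0; apply: mulr_ge0; rewrite ?addr_ge0 ?sqr_ge0 ?invr_ge0 ?mulr_ge0 //;
    by rewrite ?ltW // indicE ler0n.
have iR := iP _ _ (iZ (1 + del^-1) _ ihh) (iZ (2 * del) _ (iP _ _ iB ih2)).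
rewrite /Rintegral; apply: fine_le; [exact: (integrable_fin_num _ (integrable_norm iD))|
   exact: (integrable_fin_num _ iR)|].
apply: ae_ge0_le_integral => //.
- by apply/measurable_EFinP; apply: measurableT_comp => //; exact: integrable_measurable iD.
- by move=> x _; rewrite lee_fin; exact: pos.
- exact: measurable_int iR.
apply: filterS2 sB sB' => x s s' _; rewrite lee_fin.
have [xB|xB] := pselect (B x).
  rewrite indicE mem_set //=; exact: norm_powRB_young.
by have := pos (h' x - h x) x; rewrite s // s' // !subrr normr0.
Qed.

End power_L1.

Section L2_curve.
Context {R : realType} {n : nat}.
Local Notation mu := (@lebesgue_rV R n).
Local Notation integrableT h := (mu.-integrable setT (EFin \o h)).

Lemma L2norm_sqr (h : 'rV[R]_n -> R) (e : R) : measurable_fun setT h -> 0 <= e ->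
  (L2norm h < e%:E)%E ->
  integrableT (fun x => h x ^+ 2) /\ \int[mu]_x (h x ^+ 2) <= e ^+ 2.
Proof.
move=> mh e0 he.
have E : (\int[mu]_x ((h x ^+ 2)%:E) = (L2norm h `^ 2))%E.
  rewrite /L2norm poweR_Lnorm // ; apply: eq_integral => x _.
  by rewrite /= powR_mulrn // real_normK // num_real.
have le : (\int[mu]_x ((h x ^+ 2)%:E) <= (e ^+ 2)%:E)%E.
  rewrite E -powR_mulrn // -poweR_EFin.
  apply: gt0_ler_poweR => //; rewrite ?in_itv /=.
  - by apply/andP; split; [exact: Lnorm_ge0|exact: leey].
  - by rewrite lee_fin e0 leey.
  - exact: ltW.
have i2 : integrableT (fun x => h x ^+ 2).
  apply/integrableP; split; first by apply/measurable_EFinP; exact: measurable_funX.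
  rewrite (eq_integral (fun x => (h x ^+ 2)%:E)); last first.
    by move=> x _ /=; rewrite ger0_norm // sqr_ge0.
  by apply: (le_lt_trans le); rewrite ltry.
split => //; rewrite -lee_fin /Rintegral fineK //; exact: (integrable_fin_num _ i2).
Qed.

(** On a set of finite measure the [p]-th power is continuous from L^2 to L^1
    for [p <= 2]: [del] is fixed first to make the second term of
    [power_L1_bound] small, the L^2 distance afterwards to handle the first. *)
Lemma power_L1_continuous (I : set R) (u : R -> 'rV[R]_n -> R) (p t r : R) :
  1 < p <= 2 -> C0_L2 I u ->
  (forall s, 0 <= s <= t -> I s /\ supp_in_ball r (u s)) ->
  (forall s, 0 <= s <= t -> integrableT (fun x => `|u s x| `^ p)) ->
  forall s, 0 <= s <= t -> forall e, 0 < e ->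
  exists2 del, 0 < del & forall s', 0 <= s' <= t -> `|s' - s| < del ->
    \int[mu]_x `| `|u s' x| `^ p - `|u s x| `^ p| <= e.
Proof.
move=> p12 cu Ir ip s st e e0.
have [Is rs] := Ir _ st; have [us cs] := cu _ Is.
pose K := fine (mu (eball r)) + \int[mu]_x (u s x) ^+ 2.
have K0 : 0 <= K.
  rewrite /K; apply: addr_ge0; first exact: fine_ge0.
  by apply: Rintegral_ge0 => x _; exact: sqr_ge0.
pose del := e / (4 * (K + 1)).
have K1 : 0 < 4 * (K + 1) by lra.
have del0 : 0 < del by rewrite divr_gt0.
pose eta := Num.sqrt (e / 2 / (1 + del^-1)).
have A0 : 0 < 1 + del^-1 by rewrite addr_gt0 // invr_gt0.
have q0 : 0 < e / 2 / (1 + del^-1) by rewrite !divr_gt0.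
have eta0 : 0 < eta by rewrite sqrtr_gt0.
have : \forall s' \near within I (nbhs s), (L2norm (fun x => u s' x - u s x)%R < eta%:E)%E.
  exact: (cs _ (@nbhs_open_ereal_lt _ 0 (cst eta) eta0)).
rewrite near_withinE => /nbhs_ballP[d /= d0 Hd]; exists d => // s' s't sd.
have [Is' rs'] := Ir _ s't; have [us' _] := cu _ Is'.
have L2 : (L2norm (fun x => u s' x - u s x)%R < eta%:E)%E.
  by apply: Hd => //; rewrite /ball /= distrC.
have mf (v : 'rV[R]_n -> R) : in_L2 v -> measurable_fun setT v.
  by move=> /andP[]; rewrite inE.
have mhh : measurable_fun setT (fun x => u s' x - u s x).
  by apply: measurable_funB; exact: mf.
have [ihh leh] := L2norm_sqr mhh (ltW eta0) L2.
have off s1 : supp_in_ball r (u s1) -> {ae mu, forall x, ~ eball r x -> u s1 x = 0}.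
  by apply: filterS => x H /negP; rewrite -ltNge; exact: H.
have := power_L1_bound p12 del0 (measurable_eball r) (eball_fin r) (ip _ st)
  (ip _ s't) (Lfun2_integrable_sqr us) ihh (off _ rs) (off _ rs').
move=> H; apply: (le_trans H); rewrite -/K.
have b1 : (1 + del^-1) * \int[mu]_x (u s' x - u s x) ^+ 2 <= e / 2.
  apply: (@le_trans _ _ ((1 + del^-1) * (eta ^+ 2))); first by rewrite ler_wpM2l // ltW.
  have A1 : 1 + del^-1 != 0 by rewrite gt_eqF.
  by rewrite /eta (sqr_sqrtr (ltW q0)) [leLHS]mulrC (divfK A1).
have b2 : 2 * del * K <= e / 2.
  by rewrite /del mulrA mulrAC ler_pdivrMr //; nra.
lra.
Qed.
End L2_curve.

(** * Exponential moments *)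

Section ae_Rintegral.
Context {R : realType} d (T : measurableType d) (mu : {measure set T -> \bar R}).
Local Notation integrableT h := (mu.-integrable setT (EFin \o h)).

Lemma Rintegral_ae_ge0 (h : T -> R) : integrableT h ->
  {ae mu, forall x, 0 <= h x} -> 0 <= \int[mu]_x h x.
Proof.
move=> ih h0; rewrite /Rintegral.
rewrite (@ae_eq_integral _ _ _ mu setT (EFin \o (fun x => `|h x|))) //.
- by apply: Rintegral_ge0.
- exact: measurable_int ih.
- exact: measurable_int (integrable_norm ih).
- by apply: filterS h0 => x h0 _ /=; rewrite ger0_norm.
Qed.

Lemma le_Rintegral_ae (h k : T -> R) : integrableT h -> integrableT k ->
  {ae mu, forall x, h x <= k x} -> \int[mu]_x h x <= \int[mu]_x k x.
Proof.
move=> ih ik hk; rewrite -subr_ge0 -RintegralB //; apply: Rintegral_ae_ge0.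
  by have := integrableB measurableT ik ih; apply: eq_integrable.
by apply: filterS hk => x; rewrite subr_ge0.
Qed.

End ae_Rintegral.

Section exponential_moments.
Context {R : realType} {n : nat}.
Local Notation mu := (@lebesgue_rV R n).
Local Notation integrableT h := (mu.-integrable setT (EFin \o h)).

Lemma in_L2_integrable (r : R) (h : 'rV[R]_n -> R) : in_L2 h -> supp_in_ball r h ->
  integrableT h.
Proof.
move=> h2 hr.
have mh : measurable_fun setT h by case/andP : h2; rewrite inE.
have i2 := Lfun2_integrable_sqr h2.
pose B : set 'rV[R]_n := eball r.
have mB : measurable B by exact: measurable_eball.
have iB : integrableT (\1_B : _ -> R).
  apply/integrableP; split; first by apply/measurable_EFinP; exact: measurable_indic.
  rewrite (eq_integral (fun x => (\1_B x)%:E)); last first.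
    by move=> x _ /=; rewrite ger0_norm.
  by rewrite integral_indic // setIT; exact: eball_fin.
have iS : integrableT (fun x => \1_B x + h x ^+ 2).
  by have := integrableD measurableT iB i2; apply: eq_integrable.
apply/integrableP; split; first exact/measurable_EFinP.
have [_ fin] := integrableP _ _ _ iS.
apply: le_lt_trans fin; apply: ae_ge0_le_integral => //.
- by apply/measurable_EFinP; exact: measurableT_comp.
- by do 2 apply: measurableT_comp => //; exact: integrable_measurable iS.
apply: filterS hr => x hx _ /=; rewrite lee_fin.
have hh : `|h x| ^+ 2 = h x ^+ 2 by rewrite real_normK // num_real.
have [xr|/hx ->] := leP (enorm x) r; last first.
  by rewrite normr0.
rewrite indicE mem_set //= [leRHS]ger0_norm; last by rewrite addr_ge0 ?sqr_ge0.
rewrite -hh; have := normr_ge0 (h x); nra.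
Qed.

Lemma cosh_ge1 (a : R) : 1 <= coshR a.
Proof.
have : 0 <= (expR (a / 2) - expR (- a / 2)) ^+ 2 by exact: sqr_ge0.
have e1 : expR (a / 2) ^+ 2 = expR a by rewrite -expRM_natr; congr expR; field.
have e2 : expR (- a / 2) ^+ 2 = expR (- a) by rewrite -expRM_natr; congr expR; field.
have e3 : expR (a / 2) * expR (- a / 2) = 1 by rewrite -expRD mulNr subrr expR0.
by rewrite sqrrB e1 e2 -mulr_natl e3 /coshR; lra.
Qed.

Lemma sinh_ge0 (a : R) : 0 <= a -> 0 <= sinhR a.
Proof.
by move=> a0; rewrite /sinhR divr_ge0 // subr_ge0 ler_expR; lra.
Qed.

Lemma integrable_cosh_mul r xi (h : 'rV[R]_n -> R) :
  integrableT h -> supp_in_ball r h ->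
  integrableT (fun x => coshR (dotr xi x) * h x).
Proof.
move=> ih hr.
apply: (@mul_integrable _ _ _ mu (dotr xi) _ coshR h ((\sum_i `|xi ord0 i|) * r)) => //.
- by apply: measurable_dotr => //; exact: measurable_id.
- exact: continuous_cosh.
- apply: filterS (supp_in_ballP hr) => x hx /hx xr.
  by apply: (le_trans (le_dotr_enorm _ _)); rewrite ler_wpM2l // sumr_ge0.
Qed.

Lemma le_integral_cosh_mul r xi (h : 'rV[R]_n -> R) :
  integrableT h -> supp_in_ball r h -> {ae mu, forall x, 0 <= h x} ->
  \int[mu]_x h x <= \int[mu]_x (coshR (dotr xi x) * h x).
Proof.
move=> ih hr h0; apply: le_Rintegral_ae => //; first exact: integrable_cosh_mul hr.
by apply: filterS h0 => x h0; rewrite ler_peMl // cosh_ge1.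
Qed.

(** Exponential moments grow at least as if all the mass sat at the origin;
    this is where positivity of the data and of the nonlinearity enters. *)
Lemma exponential_moment_ge (p rad eps : R) (f g : 'rV[R]_n -> R) (T : \bar R)
    (u ut : R -> 'rV[R]_n -> R) (t : R) (xi : 'rV[R]_n) :
  1 < p <= 2 -> 0 < rad -> 0 < eps -> in_L2 f -> in_L2 g ->
  {ae mu, forall x, 0 <= f x} -> {ae mu, forall x, 0 <= g x} ->
  supp_in_ball rad f -> supp_in_ball rad g ->
  wave_solution p (eps \*o f) (eps \*o g) T u ut ->
  (forall s, 0 <= s -> (s%:E < T)%E -> supp_in_ball (s + rad) (u s)) ->
  0 <= t -> (t%:E < T)%E -> 0 < enorm xi ->
  lebesgue_measure.-integrable `[0, t] (fun s =>
    (sinhR (enorm xi * (t - s)) / enorm xi * \int[mu]_x (`|u s x| `^ p))%:E) /\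
  coshR (enorm xi * t) * (eps * \int[mu]_x f x) +
  \int[lebesgue_measure]_(s in `[0, t])
    (sinhR (enorm xi * (t - s)) / enorm xi * \int[mu]_x (`|u s x| `^ p)) <=
  \int[mu]_x (coshR (dotr xi x) * u t x).
Proof.
move=> p12 rad0 eps0 f2 g2 f0 g0 fr gr [[cu _] _ _ _ ie] su t0 tT lam0.
set lam := enorm xi in lam0 *.
have lt s : 0 <= s <= t -> lifetime T s.
  by move=> /andP[s0 st]; split => //; apply: le_lt_trans tT; rewrite lee_fin.
have tt : 0 <= t <= t by rewrite t0 lexx.
have [iu _ iG ieq] := ie _ (lt _ tt).
have iw s : 0 <= s <= t -> integrableT (fun x => `|u s x| `^ p).
  by move=> /lt/ie[].
have sut s : 0 <= s <= t -> supp_in_ball (t + rad) (u s).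
  move=> /[dup] /andP[s0 st] /lt [_ sT].
  apply: filterS (su _ s0 sT) => x H xr; apply: H; lra.
have suw s : 0 <= s <= t -> supp_in_ball (t + rad) (fun x => `|u s x| `^ p).
  move=> /sut; apply: filterS => x H /H ->; rewrite normr0 powR0 //.
  by rewrite gt_eqF //; lra.
have fi := in_L2_integrable f2 fr; have gi := in_L2_integrable g2 gr.
have big (h : 'rV[R]_n -> R) : supp_in_ball rad h -> supp_in_ball (t + rad) h.
  by apply: filterS => x H xr; apply: H; lra.
have efi : integrableT (eps \*o f).
  by have := integrableZl measurableT eps fi; apply: eq_integrable.
have egi : integrableT (eps \*o g).
  by have := integrableZl measurableT eps gi; apply: eq_integrable.
have sef : supp_in_ball (t + rad) (eps \*o f).
  by apply: filterS (big _ fr) => x H /H /= ->; rewrite mulr0.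
have seg : supp_in_ball (t + rad) (eps \*o g).
  by apply: filterS (big _ gr) => x H /H /= ->; rewrite mulr0.
have mY : measurable_fun setT (dotr xi).
  by apply: measurable_dotr => //; exact: measurable_id.
pose b := (\sum_i `|xi ord0 i|) * (t + rad).
have b0 : 0 <= b by rewrite mulr_ge0 ?sumr_ge0 //; lra.
have sup (h : 'rV[R]_n -> R) : supp_in_ball (t + rad) h ->
    {ae mu, forall x, h x != 0 -> `|dotr xi x| <= b}.
  move=> /supp_in_ballP; apply: filterS => x H /H xr.
  by apply: (le_trans (le_dotr_enorm _ _)); rewrite ler_wpM2l // sumr_ge0.
have wE s : \int[mu]_x `| `|u s x| `^ p| = \int[mu]_x (`|u s x| `^ p).
  by apply: eq_Rintegral => x _; rewrite ger0_norm // powR_ge0.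
have gw : lebesgue_measure.-integrable `[0, t]
    (fun s => (\int[mu]_x `| `|u s x| `^ p|)%:E).
  by apply: eq_integrable iG => // s _; rewrite wE.
have cw := power_L1_continuous p12 cu (fun s st => conj (lt s st) (sut s st)) iw.
have four r : 0 < r ->
  \int[mu]_x (cos (r * dotr xi x) * u t x) =
  cos (t * (r * lam)) * \int[mu]_x (cos (r * dotr xi x) * (eps \*o f) x) +
  sin (t * (r * lam)) / (r * lam) * \int[mu]_x (cos (r * dotr xi x) * (eps \*o g) x) +
  \int[lebesgue_measure]_(s in `[0, t])
    (sin ((t - s) * (r * lam)) / (r * lam) *
     \int[mu]_x (cos (r * dotr xi x) * `|u s x| `^ p)).
  move=> r0.
  have := ieq (r *: xi) cos (or_introl erefl).
  rewrite /fourier enormZ ?(ltW r0) // -/lam.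
  have fE (h : 'rV[R]_n -> R) : \int[mu]_x (cos (dotr (r *: xi) x) * h x) =
      \int[mu]_x (cos (r * dotr xi x) * h x).
    by apply: eq_Rintegral => x _; rewrite dotrZl.
  have sE s : sinW s (r * lam) = sin (s * (r * lam)) / (r * lam).
    by rewrite /sinW gt_eqF // mulr_gt0.
  rewrite !fE !sE => ->; congr (_ + _); apply: eq_Rintegral => s _.
  by rewrite fE sE.
have [iH ->] := hyperbolic_identity mY t0 lam0 b0 iw (fun s st => sup _ (suw s st)) cw gw
  iu efi egi (sup _ (sut t tt)) (sup _ sef) (sup _ seg) four.
have li : 0 <= lam^-1 by rewrite invr_ge0 ltW.
have iH' : lebesgue_measure.-integrable `[0, t] (fun s =>
    (sinhR (lam * (t - s)) / lam * \int[mu]_x (`|u s x| `^ p))%:E).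
  apply: le_integrable iH => //.
    apply/measurable_EFinP; apply: measurable_funM.
      apply: measurable_funTS; apply: measurable_funM; last exact: measurable_cst.
      apply: (@measurableT_comp _ _ _ _ _ _ (@sinhR R)).
        apply: continuous_measurable_fun.
        exact: is_derive_continuous (@is_derive_sinh R).
      apply: measurable_funM; first exact: measurable_cst.
      by apply: measurable_funB => //; exact: measurable_cst.
    by apply/measurable_EFinP; exact: measurable_int iG.
  move=> s /=; rewrite in_itv /= => st; rewrite lee_fin.
  have K0 : 0 <= sinhR (lam * (t - s)) / lam.
    apply: mulr_ge0 => //; apply: sinh_ge0; rewrite mulr_ge0 ?(ltW lam0) //.
    by case/andP: st => _; rewrite subr_ge0.
  have le := le_integral_cosh_mul xi (iw _ st) (suw _ st)
      (ltac:(apply/nearW => x; exact: powR_ge0) : {ae mu, forall x, 0 <= `|u s x| `^ p}).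
  have G0 : 0 <= \int[mu]_x (`|u s x| `^ p) by apply: Rintegral_ge0 => x _; exact: powR_ge0.
  have G1 := le_trans G0 le.
  rewrite /= (ger0_norm (mulr_ge0 K0 G0)) (ger0_norm (mulr_ge0 K0 G1)).
  exact: ler_wpM2l.
split => //.
have -> : eps * \int[mu]_x f x = \int[mu]_x (eps \*o f) x by rewrite -RintegralZl.
have P (h : 'rV[R]_n -> R) : {ae mu, forall x, 0 <= h x} -> {ae mu, forall x, 0 <= (eps \*o h) x}.
  by apply: filterS => x h0; rewrite mulr_ge0 // ltW.
have h1 := le_integral_cosh_mul xi efi sef (P _ f0).
have h2 : 0 <= \int[mu]_x (coshR (dotr xi x) * (eps \*o g) x).
  apply: Rintegral_ae_ge0; first exact: integrable_cosh_mul egi seg.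
  apply: filterS (P _ g0) => x h0; rewrite mulr_ge0 //.
  exact: le_trans (cosh_ge1 _).
have h3 : 0 <= sinhR (lam * t) / lam.
  by rewrite mulr_ge0 // sinh_ge0 // mulr_ge0 // ltW.
rewrite -addrA lerD //.
  by rewrite ler_wpM2l //; exact: le_trans (cosh_ge1 _).
rewrite -[leLHS]add0r; apply: lerD; first by rewrite mulr_ge0.
apply: le_Rintegral => // s /=; rewrite in_itv /= => st.
rewrite ler_wpM2l //.
  rewrite mulr_ge0 // sinh_ge0 // mulr_ge0 ?(ltW lam0) //.
  by case/andP: st => _; rewrite subr_ge0.
apply: le_integral_cosh_mul (iw _ st) (suw _ st) _.
by apply/nearW => x; exact: powR_ge0.
Qed.

End exponential_moments.

(** * Gaussian integrals *)

Section integral_rV.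
Context {R : realType}.
Local Open Scope ereal_scope.

Lemma integral_rV_cons m (F : 'rV[R]_m.+1 -> \bar R) :
  measurable_fun setT F -> (forall x, 0 <= F x) ->
  \int[lebesgue_rV m.+1]_x F x =
  \int[lebesgue_measure]_z \int[lebesgue_rV m]_y F (rV_cons (z, y)).
Proof.
move=> mF F0.
transitivity (\int[pushforward (@lebesgue_measure R \x lebesgue_rV m) (@rV_cons R m)]_x F x).
  by [].
rewrite ge0_integral_pushforward //; last exact: measurable_rV_cons.
rewrite preimage_setT fubini_tonelli1 //.
  by apply: measurableT_comp => //; exact: measurable_rV_cons.
by move=> z; exact: F0.
Qed.

End integral_rV.

Section gaussian.
Context {R : realType}.

Lemma dotr_cons m (z : R) (y : 'rV[R]_m) (x : 'rV[R]_m.+1) :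
  dotr (rV_cons (z, y)) x = z * x ord0 ord0 + dotr y (rsubmx (x : 'rV[R]_(1 + m))).
Proof.
have e0 : rV_cons (z, y) ord0 ord0 = z.
  by rewrite -[RHS]/(z, y).1 -[in RHS](rV_consK (z, y)).
have eS i : rV_cons (z, y) ord0 (lift ord0 i) = y ord0 i.
  rewrite -[RHS]/((z, y).2 ord0 i) -[in RHS](rV_consK (z, y)) [RHS]mxE.
  by congr (rV_cons _ _ _); exact/val_inj.
rewrite /dotr big_ord_recl e0; congr (_ + _); apply: eq_bigr => i _.
rewrite eS mxE; congr (_ * x _ _); exact/val_inj.
Qed.

Lemma rsubmx_cons m (z : R) (y : 'rV[R]_m) :
  rsubmx (rV_cons (z, y) : 'rV[R]_(1 + m)) = y.
Proof. by rewrite -[RHS]/(z, y).2 -[in RHS](rV_consK (z, y)). Qed.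

Lemma rV_cons0 m (z : R) (y : 'rV[R]_m) : rV_cons (z, y) ord0 ord0 = z.
Proof. by rewrite -[RHS]/(z, y).1 -[in RHS](rV_consK (z, y)). Qed.

Lemma gaussian_integral1 (A b : R) : 0 < A ->
  (\int[lebesgue_measure]_z (expR (- (A * z ^+ 2 / 2) + b * z))%:E =
   (Num.sqrt (2 * pi / A) * expR (b ^+ 2 / (2 * A)))%:E)%E.
Proof.
move=> A0; pose s := (Num.sqrt A)^-1.
have sA : 0 < Num.sqrt A by rewrite sqrtr_gt0.
have s0 : s != 0 by rewrite invr_eq0 gt_eqF.
have s2 : s ^+ 2 = A^-1 by rewrite exprVn sqr_sqrtr // ltW.
have E z : expR (- (A * z ^+ 2 / 2) + b * z) =
   Num.sqrt (2 * pi / A) * expR (b ^+ 2 / (2 * A)) * normal_pdf (b / A) s z.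
  rewrite normal_pdfE // /normal_peak /normal_fun s2.
  rewrite (_ : A^-1 * pi *+ 2 = 2 * pi / A); last by ring.
  have P0 : Num.sqrt (2 * pi / A) != 0.
    by rewrite gt_eqF // sqrtr_gt0 divr_gt0 // mulr_gt0 // pi_gt0.
  transitivity (expR (b ^+ 2 / (2 * A)) * expR (- (z - b / A) ^+ 2 / (A^-1 *+ 2))).
    by rewrite -expRD; congr expR; field; rewrite gt_eqF.
  by move: (Num.sqrt _) P0 => P P0; field.
under eq_integral do rewrite E EFinM.
rewrite ge0_integralZl //.
- by rewrite integral_normal_pdf mule1.
- by apply/measurable_EFinP; exact: measurable_normal_pdf.
- by move=> z _; rewrite lee_fin normal_pdf_ge0.
Qed.

Lemma measurable_gaussian m (A : R) (B : 'rV[R]_m) :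
  measurable_fun setT (fun y => expR (- (A * dotr y y / 2) + dotr B y)).
Proof.
apply: (@measurableT_comp _ _ _ _ _ _ (@expR R)); first exact: measurable_expR.
apply: measurable_funD.
  apply: measurableT_comp => //; apply: measurable_funM; last exact: measurable_cst.
  apply: measurable_funM; first exact: measurable_cst.
  by apply: measurable_dotr; exact: measurable_id.
by apply: measurable_dotr => //; exact: measurable_id.
Qed.

Lemma gaussian_integral m (A : R) (B : 'rV[R]_m) : 0 < A ->
  (\int[lebesgue_rV m]_y (expR (- (A * dotr y y / 2) + dotr B y))%:E =
   (Num.sqrt (2 * pi / A) ^+ m * expR (dotr B B / (2 * A)))%:E)%E.
Proof.
move=> A0; elim: m B => [|m IH] B.
  rewrite integral_dirac //; last first.
    by apply/measurable_EFinP; exact: measurable_gaussian.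
  rewrite diracE mem_set // mul1e.
  by rewrite /dotr !big_ord0 !mulr0 !mul0r oppr0 addr0 expR0 expr0 mulr1.
rewrite integral_rV_cons; last 2 first.
- by apply/measurable_EFinP; exact: measurable_gaussian.
- by move=> x; rewrite lee_fin expR_ge0.
pose B' := rsubmx (B : 'rV[R]_(1 + m)); pose b := B ord0 ord0.
have sq (z : R) (y : 'rV[R]_m) : dotr (rV_cons (z, y)) (rV_cons (z, y)) = z ^+ 2 + dotr y y.
  by rewrite dotr_cons rV_cons0 rsubmx_cons expr2.
have dB (z : R) (y : 'rV[R]_m) : dotr B (rV_cons (z, y)) = b * z + dotr B' y.
  have dC (v w : 'rV[R]_m.+1) : dotr v w = dotr w v.
    by apply: eq_bigr => i _; exact: mulrC.
  rewrite dC dotr_cons mulrC; congr (_ + _).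
  by apply: eq_bigr => i _; exact: mulrC.
have BB : dotr B B = b ^+ 2 + dotr B' B'.
  rewrite /dotr big_ord_recl expr2; congr (_ + _).
  by apply: eq_bigr => i _; rewrite mxE; congr (B _ _ * B _ _); exact/val_inj.
have E (z : R) : (\int[lebesgue_rV m]_y (expR (- (A * dotr (rV_cons (z, y)) (rV_cons (z, y)) / 2) +
     dotr B (rV_cons (z, y))))%:E =
   (Num.sqrt (2 * pi / A) ^+ m * expR (dotr B' B' / (2 * A)))%:E *
   (expR (- (A * z ^+ 2 / 2) + b * z))%:E)%E.
  under eq_integral => y _.
    rewrite sq dB (_ : - (A * (z ^+ 2 + dotr y y) / 2) + (b * z + dotr B' y) =
      (- (A * z ^+ 2 / 2) + b * z) + (- (A * dotr y y / 2) + dotr B' y)); last by ring.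
    rewrite expRD EFinM; over.
  rewrite ge0_integralZl //; last by apply/measurable_EFinP; exact: measurable_gaussian.
  by rewrite IH muleC.
under eq_integral do rewrite E.
rewrite ge0_integralZl //; last first.
  apply/measurable_EFinP.
  apply: (@measurableT_comp _ _ _ _ _ _ (@expR R)); first exact: measurable_expR.
  apply: measurable_funD.
    apply: measurableT_comp => //; apply: measurable_funM; last exact: measurable_cst.
    by apply: measurable_funM; [exact: measurable_cst|exact: measurable_funX].
  by apply: measurable_funM => //; exact: measurable_cst.
rewrite gaussian_integral1 // -EFinM; congr (_%:E).
rewrite BB [(b ^+ 2 + _) / _]mulrDl expRD [_ ^+ m.+1]exprS.
by move: (Num.sqrt _) (expR _) (expR _) => P Q Q'; ring.
Qed.

End gaussian.

(** * Frequencies along light rays *)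

Section light_cone.
Context {R : realType} {m : nat}.
Implicit Types (k tau : R) (y : 'rV[R]_m) (x : 'rV[R]_m.+1).

(** Parabolic coordinates on frequency space: [|xi| = k (1 + |y|^2) / 2], hence
    the exponent [- |xi| tau + xi . x] is quadratic in [y]. The unit ball
    of [y] corresponds to directions in a half space. *)
Definition light_ray k y : 'rV[R]_m.+1 :=
  rV_cons (k * (1 - dotr y y) / 2, k *: y).

Lemma dotr_light_ray k y x : dotr (light_ray k y) x =
  k * (1 - dotr y y) / 2 * x ord0 ord0 + k * dotr y (rsubmx (x : 'rV[R]_(1 + m))).
Proof. by rewrite dotr_cons dotrZl. Qed.

Lemma enorm_light_ray k y : 0 <= k -> enorm (light_ray k y) = k * (1 + dotr y y) / 2.
Proof.
move=> k0; rewrite /enorm dotr_light_ray rV_cons0 rsubmx_cons.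
have dC (v w : 'rV[R]_m) : dotr v w = dotr w v.
  by apply: eq_bigr => i _; exact: mulrC.
rewrite dC dotrZl.
rewrite (_ : _ + _ = (k * (1 + dotr y y) / 2) ^+ 2); last by field.
by rewrite sqrtr_sqr ger0_norm // !mulr_ge0 // addr_ge0 // dotr_ge0.
Qed.

Lemma measurable_light_ray d (T : measurableType d) (h : T -> 'rV[R]_m) k :
  measurable_fun setT h -> measurable_fun setT (fun z => light_ray k (h z)).
Proof.
move=> mh; apply: (measurableT_comp (@measurable_rV_cons R m)).
apply: measurable_fun_pair => /=.
  apply: measurable_funM; last exact: measurable_cst.
  apply: measurable_funM; first exact: measurable_cst.
  by apply: measurable_funB; [exact: measurable_cst|exact: (measurable_dotr mh mh)].
apply/measurable_fun_rVP => i.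
rewrite (_ : (fun z => _) = (fun z => k * h z ord0 i)); last first.
  by apply/funext => z; rewrite mxE.
apply: measurable_funM; first exact: measurable_cst.
by move/measurable_fun_rVP : mh; exact.
Qed.

Lemma eball1P y : eball 1 y <-> dotr y y <= 1.
Proof.
rewrite /eball /= -enorm_sqr -[X in _ <-> _ <= X](expr1n _ 2).
by rewrite ler_sqr ?nnegrE ?enorm_ge0.
Qed.

(** The amplitude of a spherical wave, concentrated at distance [1 / k] from the
    light cone [|x| = tau]. *)
Definition light_bump k tau x : R :=
  Num.sqrt (2 * pi / (k * tau)) ^+ m * expR (- (k * (tau - enorm x) / 2)).

Lemma measurable_cosh : measurable_fun setT (@coshR R).
Proof. by apply: continuous_measurable_fun; exact: continuous_cosh. Qed.

Lemma measurable_light_weight d (T : measurableType d) (h : T -> 'rV[R]_m)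
    (l : T -> 'rV[R]_m.+1) k tau : measurable_fun setT h -> measurable_fun setT l ->
  measurable_fun setT (fun z => expR (- (enorm (light_ray k (h z)) * tau)) *
     coshR (dotr (light_ray k (h z)) (l z))).
Proof.
move=> mh ml; have mr := measurable_light_ray k mh.
apply: measurable_funM.
  apply: (@measurableT_comp _ _ _ _ _ _ (@expR R)); first exact: measurable_expR.
  apply: measurableT_comp => //; apply: measurable_funM; last exact: measurable_cst.
  by apply: measurableT_comp => //; exact: measurable_enorm.
apply: (measurableT_comp measurable_cosh).
exact: (measurable_dotr mr ml).
Qed.

(** In the unit ball [x1 (1 - |y|^2) <= |x1| (1 - |y|^2)], so each exponential of
    the hyperbolic cosine is dominated by a Gaussian in [y] of parameter [k (tau + |x1|)]. Its integral
    over the whole space, with [|x'|^2 / (tau + |x1|) <= |x| - |x1|], gives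
    the bound. *)
Lemma light_weight_le k tau x : 0 < k -> 0 < tau -> enorm x <= tau ->
  (\int[lebesgue_rV m]_(y in eball 1)
     (expR (- (enorm (light_ray k y) * tau)) * coshR (dotr (light_ray k y) x))%:E <=
   (light_bump k tau x)%:E)%E.
Proof.
move=> k0 tau0 xt.
pose x1 := x ord0 ord0; pose x' := rsubmx (x : 'rV[R]_(1 + m)).
pose A := k * (tau + `|x1|); pose B := k *: x'.
pose c := expR (- (k * (tau - `|x1|) / 2)).
pose G (B : 'rV[R]_m) y := expR (- (A * dotr y y / 2) + dotr B y).
have A0 : 0 < A by rewrite mulr_gt0 // ltr_pwDl.
have dC (v w : 'rV[R]_m) : dotr v w = dotr w v.
  by apply: eq_bigr => i _; exact: mulrC.
have NB : (-1) *: B = - B by rewrite scaleN1r.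
have GG y : eball 1 y -> expR (- (enorm (light_ray k y) * tau)) *
    coshR (dotr (light_ray k y) x) <= c / 2 * (G B y + G (- B) y).
  move=> /eball1P y1; rewrite enorm_light_ray ?(ltW k0) // dotr_light_ray -/x1 -/x'.
  have B1 : dotr B y = k * dotr y x' by rewrite dotrZl dC.
  have B2 : dotr (- B) y = - (k * dotr y x') by rewrite -NB dotrZl B1 mulN1r.
  set q := dotr y x' in B1 B2 *; set N := dotr y y in y1 *.
  have x1le : `|x1 * (1 - N)| <= `|x1| * (1 - N).
    by rewrite normrM [`|1 - N|]ger0_norm // subr_ge0.
  have [l1 l2] : x1 * (1 - N) <= `|x1| * (1 - N) /\ - (x1 * (1 - N)) <= `|x1| * (1 - N).
    by split; apply: le_trans x1le; rewrite ?ler_norm // -normrN ler_norm.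
  rewrite /G B1 B2 /coshR /c.
  have e1 : expR (- (k * (1 + N) / 2 * tau)) * expR (k * (1 - N) / 2 * x1 + k * q) <=
      expR (- (k * (tau - `|x1|) / 2)) * expR (- (A * N / 2) + k * q).
    by rewrite -!expRD ler_expR /A; nra.
  have e2 : expR (- (k * (1 + N) / 2 * tau)) * expR (- (k * (1 - N) / 2 * x1 + k * q)) <=
      expR (- (k * (tau - `|x1|) / 2)) * expR (- (A * N / 2) + - (k * q)).
    by rewrite -!expRD ler_expR /A; nra.
  lra.
have mG C : measurable_fun setT (fun y => (G C y)%:E).
  by apply/measurable_EFinP; exact: measurable_gaussian.
have c2 : 0 <= c / 2 by rewrite divr_ge0 // expR_ge0.
apply: (@le_trans _ _ (\int[lebesgue_rV m]_(y in eball 1) ((c / 2)%:E * ((G B y)%:E + (G (- B) y)%:E))%E)%E).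
  apply: ge0_le_integral => //.
  - exact: measurable_eball.
  - move=> y _; rewrite lee_fin mulr_ge0 ?expR_ge0 //.
    exact: le_trans (cosh_ge1 _).
  - apply: measurable_funTS; apply/measurable_EFinP.
    by apply: measurable_light_weight => //; exact: measurable_cst.
  - by apply: measurable_funTS; apply: measurable_funeM; exact: emeasurable_funD.
apply: (@le_trans _ _ (\int[lebesgue_rV m]_y ((c / 2)%:E * ((G B y)%:E + (G (- B) y)%:E))%E)%E).
  apply: ge0_subset_integral => //.
  - exact: measurable_eball.
  - by apply: measurable_funeM; exact: emeasurable_funD.
  - by move=> y _; rewrite -EFinD -EFinM lee_fin mulr_ge0 // addr_ge0 // expR_ge0.
rewrite ge0_integralZl //; last 2 first.
- exact: emeasurable_funD.
- by move=> y _; rewrite -EFinD lee_fin addr_ge0 // expR_ge0.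
rewrite ge0_integralD //; last 2 first.
- by move=> y _; rewrite lee_fin expR_ge0.
- by move=> y _; rewrite lee_fin expR_ge0.
rewrite !gaussian_integral // -EFinD -EFinM lee_fin.
have -> : dotr (- B) (- B) = dotr B B.
  by apply: eq_bigr => i _; rewrite !mxE mulrNN.
have BB : dotr B B = k ^+ 2 * dotr x' x' by rewrite dotrZl dC dotrZl mulrA expr2.
have xx : enorm x ^+ 2 = x1 ^+ 2 + dotr x' x'.
  rewrite enorm_sqr /dotr big_ord_recl expr2; congr (_ + _).
  by apply: eq_bigr => i _; rewrite mxE; congr (x _ _ * x _ _); exact/val_inj.
have xge : `|x1| <= enorm x by exact: le_coor_enorm.
have D0 : 0 < tau + `|x1| by rewrite ltr_pwDl.
have key : dotr x' x' / (tau + `|x1|) <= enorm x - `|x1|.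
  rewrite ler_pdivrMr //.
  have -> : dotr x' x' = (enorm x - `|x1|) * (enorm x + `|x1|).
    transitivity (enorm x ^+ 2 - `|x1| ^+ 2); last by ring.
    by rewrite xx real_normK ?num_real //; ring.
  by rewrite ler_wpM2l ?subr_ge0 // lerD2r.
have Ele : expR (- (k * (tau - `|x1|) / 2)) * expR (dotr B B / (2 * A)) <=
    expR (- (k * (tau - enorm x) / 2)).
  rewrite -expRD ler_expR BB.
  have -> : k ^+ 2 * dotr x' x' / (2 * A) = k / 2 * (dotr x' x' / (tau + `|x1|)).
    by rewrite /A; field; rewrite !gt_eqF.
  have k2 : 0 <= k / 2 by rewrite divr_ge0 // ltW.
  have := ler_wpM2l k2 key; lra.
have Ple : Num.sqrt (2 * pi / A) ^+ m <= Num.sqrt (2 * pi / (k * tau)) ^+ m.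
  apply: lerXn2r; rewrite ?nnegrE ?sqrtr_ge0 //; apply: ler_wsqrtr.
  rewrite ler_pM2l ?mulr_gt0 ?pi_gt0 // lef_pV2 ?posrE ?mulr_gt0 //.
  by rewrite /A ler_pM2l // lerDl.
rewrite /light_bump -/c in Ele *.
have -> : c / 2 * (Num.sqrt (2 * pi / A) ^+ m * expR (dotr B B / (2 * A)) +
    Num.sqrt (2 * pi / A) ^+ m * expR (dotr B B / (2 * A))) =
    Num.sqrt (2 * pi / A) ^+ m * (c * expR (dotr B B / (2 * A))).
  by field.
by apply: ler_pM => //; rewrite ?exprn_ge0 ?sqrtr_ge0 ?mulr_ge0 ?expR_ge0.
Qed.
End light_cone.

(** * Averaged exponential moments *)

Section light_moment.
Context {R : realType}.

Lemma integral_indic_mul d (T : measurableType d) (mu : {measure set T -> \bar R})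
    (D : set T) (h : T -> R) :
  (\int[mu]_(x in D) (h x)%:E = \int[mu]_x (h x * \1_D x)%:E)%E.
Proof.
rewrite integral_mkcond; apply: eq_integral => x _.
rewrite patchE indicE; by case: ifPn => _; rewrite ?mulr1 ?mulr0.
Qed.

Lemma eball1_gt0 m : 0 < fine (lebesgue_rV m (eball 1) : \bar R).
Proof.
apply: fine_gt0; rewrite eball_fin andbT.
pose A (i : 'I_m) : set (measurableTypeR R) := `[0, m.+1%:R^-1]%classic.
have mA i : measurable (A i) by exact: measurable_itv.
apply: (@lt_le_trans _ _ (lebesgue_rV m [set x : 'rV[R]_m | forall i, A i (x ord0 i)])).
  rewrite lebesgue_rV_box //.
  elim/big_ind : _ => [|a b|i _]; rewrite ?lte01 //; first exact: mule_gt0.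
  by rewrite /A lebesgue_measure_itv /= lte_fin invr_gt0 ltr0n /= sube0 lte_fin invr_gt0 ltr0n.
apply: le_measure; rewrite ?inE; last 2 first.
- exact: measurable_eball.
- move=> y Ay; apply/eball1P.
  apply: (@le_trans _ _ (\sum_(i < m) (m.+1%:R^-1 : R))).
    apply: ler_sum => i _; have := Ay i; rewrite /A /= in_itv /= => /andP[y0 y1].
    have i1 : (m.+1%:R^-1 : R) <= 1 by rewrite invf_le1 ?ler1n ?ltr0n.
    rewrite -[leRHS]mulr1; apply: ler_pM => //; exact: le_trans i1.
  rewrite sumr_const card_ord -[leLHS]mulr_natl ler_pdivrMr ?ltr0n // mul1r ler_nat.
  exact: leqnSn.
have -> : [set x : 'rV[R]_m | forall i, A i (x ord0 i)] =
    \bigcap_(i in [set: 'I_m]) ((fun x : 'rV[R]_m => x ord0 i) @^-1` A i).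
  by apply/seteqP; split => x Ax i => [_|]; exact: (Ax i).
apply: fin_bigcap_measurable => // i _.
by rewrite -[X in measurable X]setTI; exact: (measurable_coor i measurableT (mA i)).
Qed.

(** A minorant of [exp (- lam (t + b)) sinh (lam (t - s)) / lam] that is uniform
    in [k / 2 <= lam <= k], see [wave_kernel_le]. *)
Definition wave_kernel (b k t s : R) : R :=
  expR (- (k * (s + b))) * (1 - expR (- (k * (t - s)))) / (2 * k).

Lemma wave_kernel_ge0 b k t s : 0 < k -> s <= t -> 0 <= wave_kernel b k t s.
Proof.
move=> k0 st; rewrite /wave_kernel divr_ge0 //; last by rewrite mulr_ge0 // ltW.
rewrite mulr_ge0 ?expR_ge0 // subr_ge0 -[leRHS]expR0 ler_expR oppr_le0 mulr_ge0 ?subr_ge0 //.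
exact: ltW.
Qed.

Lemma wave_kernel_le b k lam t s : 0 < k -> k / 2 <= lam <= k -> 0 <= s <= t -> 0 <= b ->
  wave_kernel b k t s <= expR (- (lam * (t + b))) * (sinhR (lam * (t - s)) / lam).
Proof.
move=> k0 /andP[kl lk] /andP[s0 st] b0.
have lam0 : 0 < lam by apply: lt_le_trans kl; rewrite divr_gt0.
have -> : expR (- (lam * (t + b))) * (sinhR (lam * (t - s)) / lam) =
    expR (- (lam * (s + b))) * (1 - expR (- (2 * lam * (t - s)))) * (2 * lam)^-1.
  rewrite /sinhR.
  have e1 : expR (- (lam * (s + b))) = expR (- (lam * (t + b))) * expR (lam * (t - s)).
    by rewrite -expRD; congr expR; ring.
  have e2 : expR (- (2 * lam * (t - s))) = expR (- (lam * (t - s))) ^+ 2.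
    by rewrite -expRM_natr; congr expR; ring.
  have e3 : expR (lam * (t - s)) * expR (- (lam * (t - s))) = 1.
    by rewrite -expRD subrr expR0.
  rewrite e1 e2.
  move: (expR (- (lam * (t + b)))) (expR (lam * (t - s))) (expR (- (lam * (t - s)))) e3 => P a c ac.
  have -> : P * a * (1 - c ^+ 2) / (2 * lam) = P * (a - (a * c) * c) / (2 * lam) by field; rewrite gt_eqF.
  by rewrite ac; field; rewrite gt_eqF.
rewrite /wave_kernel.
have ts : 0 <= t - s by rewrite subr_ge0.
apply: ler_pM.
- rewrite mulr_ge0 ?expR_ge0 // subr_ge0 -[leRHS]expR0 ler_expR oppr_le0 mulr_ge0 //.
  exact: ltW.
- by rewrite invr_ge0 mulr_ge0 // ltW.
- apply: ler_pM; rewrite ?expR_ge0 //.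
  + rewrite subr_ge0 -[leRHS]expR0 ler_expR oppr_le0 mulr_ge0 //; exact: ltW.
  + by rewrite ler_expR; nra.
  + by rewrite lerD2l lerN2 ler_expR; nra.
- by rewrite lef_pV2 ?posrE ?mulr_gt0 // ler_pM2l.
Qed.

Lemma measurable_wave_kernel b k t : measurable_fun setT (wave_kernel b k t).
Proof.
apply: measurable_funM; last exact: measurable_cst.
apply: measurable_funM.
  apply: (@measurableT_comp _ _ _ _ _ _ (@expR R)); first exact: measurable_expR.
  apply: measurableT_comp => //; apply: measurable_funM; first exact: measurable_cst.
  by apply: measurable_funD => //; exact: measurable_cst.
apply: measurable_funB; first exact: measurable_cst.
apply: (@measurableT_comp _ _ _ _ _ _ (@expR R)); first exact: measurable_expR.
apply: measurableT_comp => //; apply: measurable_funM; first exact: measurable_cst.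
by apply: measurable_funB => //; exact: measurable_cst.
Qed.

Lemma wave_kernel_bound b k t s : 0 < k -> 0 <= s <= t -> 0 <= b ->
  wave_kernel b k t s <= (2 * k)^-1.
Proof.
move=> k0 /andP[s0 st] b0; rewrite /wave_kernel ler_piMl ?invr_ge0 ?mulr_ge0 ?(ltW k0) //.
apply: mulr_ile1; first exact: expR_ge0.
- rewrite subr_ge0 -[leRHS]expR0 ler_expR oppr_le0 mulr_ge0 ?subr_ge0 //; exact: ltW.
- by rewrite -[leRHS]expR0 ler_expR oppr_le0 mulr_ge0 ?addr_ge0 // ltW.
- by rewrite lerBlDr lerDl expR_ge0.
Qed.

Lemma wave_kernel_integrable b k t (G : R -> R) : 0 < k -> 0 <= b ->
  lebesgue_measure.-integrable `[0, t] (EFin \o G) ->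
  lebesgue_measure.-integrable `[0, t] (EFin \o (fun s => wave_kernel b k t s * G s)).
Proof.
move=> k0 b0 iG.
have mI : measurable (`[0, t]%classic : set (measurableTypeR R)) by exact: measurable_itv.
have iZ := integrableZl mI (2 * k)^-1 iG.
apply: le_integrable iZ => //.
  apply/measurable_EFinP; apply: measurable_funM.
    by apply: measurable_funTS; exact: measurable_wave_kernel.
  by apply/measurable_EFinP; exact: measurable_int iG.
move=> s /=; rewrite in_itv /= => st; rewrite lee_fin normrM [leRHS]normrM ler_wpM2r //.
have /andP[_ st'] := st.
have i0 : 0 <= (2 * k)^-1 by rewrite invr_ge0 mulr_ge0 // ltW.
by rewrite (ger0_norm (wave_kernel_ge0 b k0 st')) (ger0_norm i0) wave_kernel_bound.
Qed.


Section light_moment_ge.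
Variables (m : nat).
Local Notation mu := (@lebesgue_rV R m.+1).
Local Notation integrableT h := (mu.-integrable setT (EFin \o h)).

(** Averaging the exponential moments over light rays: the amplitude of the
    averaged exponential gains the decay [(k tau)^(- m / 2)] of a spherical wave. *)
Lemma light_moment_ge (p rad eps : R) (f g : 'rV[R]_m.+1 -> R) (T : \bar R)
    (u ut : R -> 'rV[R]_m.+1 -> R) (t k : R) :
  1 < p <= 2 -> 0 < rad -> 0 < eps -> in_L2 f -> in_L2 g ->
  {ae mu, forall x, 0 <= f x} -> {ae mu, forall x, 0 <= g x} ->
  supp_in_ball rad f -> supp_in_ball rad g ->
  wave_solution p (eps \*o f) (eps \*o g) T u ut ->
  (forall s, 0 <= s -> (s%:E < T)%E -> supp_in_ball (s + rad) (u s)) ->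
  0 <= t -> (t%:E < T)%E -> 0 < k ->
  ((fine (lebesgue_rV m (eball 1)) * (eps * (\int[mu]_x f x) / 2 * expR (- (k * (rad + 1))) +
     \int[lebesgue_measure]_(s in `[0, t])
        (wave_kernel (rad + 1) k t s * \int[mu]_x (`|u s x| `^ p))))%:E <=
  \int[mu]_x (`|u t x| * light_bump k (t + (rad + 1)) x)%:E)%E.
Proof.
move=> p12 rad0 eps0 f2 g2 f0 g0 fr gr ws su t0 tT k0.
have b0 : 0 <= rad + 1 by lra.
have ws' := ws; case: ws' => _ _ _ _ ie.
have [iu _ iG _] := ie _ (conj t0 tT).
have sut := su _ t0 tT.
set tau := t + (rad + 1).
pose G s := \int[mu]_x (`|u s x| `^ p).
have G0 s : 0 <= G s by apply: Rintegral_ge0 => x _; exact: powR_ge0.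
pose K := \int[lebesgue_measure]_(s in `[0, t]) (wave_kernel (rad + 1) k t s * G s).
pose F := \int[mu]_x f x.
have F0 : 0 <= F by apply: Rintegral_ae_ge0 => //; exact: in_L2_integrable f2 fr.
set c0 := _ + _.
pose W (y : 'rV[R]_m) (x : 'rV[R]_m.+1) : R := expR (- (enorm (light_ray k y) * tau)) * coshR (dotr (light_ray k y) x).
have W0 y x : 0 <= W y x.
  by rewrite mulr_ge0 ?expR_ge0 //; exact: le_trans (cosh_ge1 _).
have main y : eball 1 y -> (c0%:E <= \int[mu]_x (W y x * `|u t x|)%:E)%E.
  move=> /eball1P y1.
  have lamE : enorm (light_ray k y) = k * (1 + dotr y y) / 2.
    by rewrite enorm_light_ray // ltW.
  have y0 := dotr_ge0 y.
  have lamk : k / 2 <= enorm (light_ray k y) <= k.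
    by rewrite lamE; apply/andP; split; nra.
  have lam0 : 0 < enorm (light_ray k y).
    by case/andP : lamk => h _; apply: lt_le_trans h; rewrite divr_gt0.
  have [iS] := exponential_moment_ge p12 rad0 eps0 f2 g2 f0 g0 fr gr ws su t0 tT lam0.
  rewrite -/F; set lam := enorm _ in lamk lam0 iS *; set xi := light_ray k y.
  move=> H.
  have ic := integrable_cosh_mul xi iu sut.
  have ica : integrableT (fun x => coshR (dotr xi x) * `|u t x|).
    have := integrable_norm ic; apply: eq_integrable => // x _ /=.
    by rewrite normrM ger0_norm //; exact: le_trans (cosh_ge1 _).
  have ga : \int[mu]_x (coshR (dotr xi x) * u t x) <= \int[mu]_x (coshR (dotr xi x) * `|u t x|).
    apply: le_Rintegral => // x _; rewrite ler_wpM2l ?ler_norm //.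
    exact: le_trans (cosh_ge1 _).
  have -> : (\int[mu]_x (W y x * `|u t x|)%:E =
      (expR (- (lam * tau)) * \int[mu]_x (coshR (dotr xi x) * `|u t x|))%:E)%E.
    rewrite EFinM /Rintegral fineK; last exact: (integrable_fin_num _ ica).
    rewrite -integralZl //; apply: eq_integral => x _.
    by rewrite -EFinM [in RHS]mulrA.
  rewrite lee_fin; apply: (le_trans _ (ler_wpM2l (expR_ge0 _) (le_trans H ga))).
  rewrite mulrDr /c0 -/F; apply: lerD.
    have h1 : expR (- (k * (rad + 1))) / 2 <= expR (- (lam * tau)) * coshR (lam * t).
      have : expR (- (k * (rad + 1))) <= expR (- (lam * tau)) * expR (lam * t).
        rewrite -expRD ler_expR /tau; case/andP: lamk => _ lk; nra.
      have := mulr_ge0 (expR_ge0 (- (lam * tau))) (expR_ge0 (- (lam * t))).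
      rewrite /coshR; lra.
    have eF : 0 <= eps * F by rewrite mulr_ge0 // ltW.
    have := ler_wpM2r eF h1; lra.
  rewrite -RintegralZl //; apply: le_Rintegral => //.
  - exact: (wave_kernel_integrable k0 b0 iG).
  - have mI : measurable (`[0, t]%classic : set (measurableTypeR R)) by exact: measurable_itv.
    by have := integrableZl mI (expR (- (lam * tau))) iS; apply: eq_integrable.
  move=> s /=; rewrite in_itv /= => st.
  rewrite mulrA ler_wpM2r //; first exact: G0.
  exact: wave_kernel_le.
have c00 : 0 <= c0.
  rewrite /c0 -/F; apply: addr_ge0.
    by rewrite !mulr_ge0 ?expR_ge0 ?invr_ge0 // ltW.
  apply: Rintegral_ge0 => s; rewrite /= in_itv /= => /andP[_ st].
  by apply: mulr_ge0; [exact: wave_kernel_ge0|exact: G0].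
have mQ : measurable (@eball R m 1) by exact: measurable_eball.
have mu_ : measurable_fun setT (u t) by exact: integrable_measurable iu.
have mW : measurable_fun setT (fun z : 'rV[R]_m * 'rV[R]_m.+1 => W z.1 z.2).
  by apply: measurable_light_weight; [exact: measurable_fst|exact: measurable_snd].
have mWu y : measurable_fun setT (fun x => (W y x * `|u t x|)%:E).
  apply/measurable_EFinP; apply: measurable_funM; last exact: measurableT_comp.
  by apply: measurable_light_weight; [exact: measurable_cst|exact: measurable_id].
have mWy x : measurable_fun setT (fun y => (W y x)%:E).
  apply/measurable_EFinP.
  by apply: measurable_light_weight; [exact: measurable_id|exact: measurable_cst].
pose H z := ((\1_(eball 1) z.1 * (W z.1 z.2 * `|u t z.2|))%:E : \bar R).
have mH : measurable_fun setT H.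
  apply/measurable_EFinP; apply: measurable_funM.
    apply: (measurableT_comp (measurable_indic mQ)); exact: measurable_fst.
  apply: measurable_funM => //; apply: measurableT_comp => //.
  apply: (measurableT_comp mu_); exact: measurable_snd.
have H0 z : (0 <= H z)%E.
  by rewrite lee_fin !mulr_ge0 // indicE ler0n.
apply: (@le_trans _ _ (\int[lebesgue_rV m]_y \int[mu]_x H (y, x))%E).
  have -> : (fine (lebesgue_rV m (eball 1)) * c0)%:E =
      (\int[lebesgue_rV m]_(y in eball 1) c0%:E)%E.
    rewrite integral_cst // EFinM fineK; first by rewrite muleC.
    by rewrite ge0_fin_numE // eball_fin.
  rewrite integral_indic_mul; apply: ge0_le_integral => //.
  - by move=> y _; rewrite lee_fin mulr_ge0 // indicE ler0n.
  - apply/measurable_EFinP; apply: measurable_funM; first exact: measurable_cst.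
    exact: measurable_indic.
  - exact: (measurable_fun_fubini_tonelli_F H).
  - move=> y _; rewrite indicE.
    have [yQ|yQ] := boolP (y \in eball 1); last by rewrite mulr0; exact: integral_ge0.
    rewrite mulr1; apply: (le_trans (main y (set_mem yQ))).
    rewrite le_eqVlt; apply/orP; left; apply/eqP; apply: eq_integral => x _.
    by rewrite /H /= indicE yQ mul1r.
rewrite (fubini_tonelli H) //.
have mb : measurable_fun setT (light_bump k tau : 'rV[R]_m.+1 -> R).
  apply: measurable_funM; first exact: measurable_cst.
  apply: (@measurableT_comp _ _ _ _ _ _ (@expR R)); first exact: measurable_expR.
  apply: measurableT_comp => //; apply: measurable_funM; last exact: measurable_cst.
  apply: measurable_funM; first exact: measurable_cst.
  by apply: measurable_funB; [exact: measurable_cst|exact: measurable_enorm].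
apply: ae_ge0_le_integral => //.
- by move=> x _; exact: integral_ge0.
- exact: (measurable_fun_fubini_tonelli_G (m1 := lebesgue_rV m) H).
- move=> x _; rewrite lee_fin; apply: mulr_ge0 => //; apply: mulr_ge0; last exact: expR_ge0.
  by apply: exprn_ge0; exact: sqrtr_ge0.
- by apply/measurable_EFinP; apply: measurable_funM => //; exact: measurableT_comp.
apply: filterS sut => x sx _.
have -> : (\int[lebesgue_rV m]_y H (y, x) =
    `|u t x|%:E * \int[lebesgue_rV m]_(y in eball 1) (W y x)%:E)%E.
  rewrite [in RHS]integral_indic_mul -ge0_integralZl //.
  - by apply: eq_integral => y _; rewrite /H /= -EFinM; congr (_%:E); ring.
  - apply/measurable_EFinP; apply: measurable_funM; last exact: measurable_indic.
    by have /measurable_EFinP := mWy x.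
  - by move=> y _; rewrite lee_fin mulr_ge0 // indicE ler0n.
have [xt|/sx ->] := leP (enorm x) (t + rad); last by rewrite normr0 mul0e mul0r.
rewrite EFinM; apply: lee_wpmul2l => //.
apply: light_weight_le => //; rewrite /tau; lra.
Qed.
End light_moment_ge.
End light_moment.

(** * Dilations and volumes of balls *)

Section dilation.
Context {R : realType}.

Lemma integral_dilation1 (c : R) (f : R -> \bar R) : 0 < c ->
  measurable_fun setT f -> (forall x, 0 <= f x)%E ->
  (c%:E * \int[lebesgue_measure]_z f (c * z)%R = \int[lebesgue_measure]_z f z)%E.
Proof.
move=> c0 mf f0.
have mphi : measurable_fun setT (fun z : measurableTypeR R => c * z : measurableTypeR R).
  by apply: measurable_funM => //; exact: measurable_cst.
pose phi (z : measurableTypeR R) : measurableTypeR R := c * z.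
pose nu : {measure set (measurableTypeR R) -> \bar R} :=
  mscale (NngNum (ltW c0)) (pushforward (@lebesgue_measure R) phi).
have nuE A : measurable A -> lebesgue_measure A = nu mphi A.
  apply: lebesgue_measure_unique => _ [[a b]] _ <-.
  change (lebesgue_measure `]a, b]%classic = c%:E * lebesgue_measure (phi @^-1` `]a, b]%classic))%E.
  have -> : phi @^-1` `]a, b]%classic = `](a / c), (b / c)]%classic.
    apply/seteqP; split => z /=; rewrite !in_itv /= ltr_pdivrMr // ler_pdivlMr // mulrC //.
  rewrite !lebesgue_measure_itv /= !lte_fin ltr_pM2r ?invr_gt0 //.
  case: ifPn => _; last by rewrite mule0.
  by rewrite -!EFinD -EFinM; congr (_%:E); field; rewrite gt_eqF.
transitivity (\int[nu mphi]_z f z)%E; last first.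
  by apply: eq_measure_integral => A mA _; rewrite -nuE.
rewrite ge0_integral_mscale //.
by rewrite ge0_integral_pushforward.
Qed.

Lemma rV_consZ m (c z : R) (y : 'rV[R]_m) :
  c *: rV_cons (z, y) = rV_cons (c * z, c *: y).
Proof.
transitivity (c *: (row_mx z%:M y : 'rV[R]_(1 + m))); first by [].
by rewrite scale_row_mx /rV_cons /= scale_scalar_mx.
Qed.

Lemma measurable_scale m (c : R) : measurable_fun setT (fun x : 'rV[R]_m => c *: x).
Proof.
apply/measurable_fun_rVP => i.
rewrite (_ : (fun x => _) = (fun x : 'rV[R]_m => c * x ord0 i)); last first.
  by apply/funext => x; rewrite mxE.
by apply: measurable_funM; [exact: measurable_cst|exact: measurable_coor].
Qed.

Lemma integral_dilation n (c : R) (f : 'rV[R]_n -> \bar R) : 0 < c ->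
  measurable_fun setT f -> (forall x, 0 <= f x)%E ->
  ((c ^+ n)%:E * \int[lebesgue_rV n]_x f (c *: x)%R = \int[lebesgue_rV n]_x f x)%E.
Proof.
move=> c0; elim: n f => [|n IH] f mf f0.
  rewrite expr0 mul1e; apply: eq_integral => x _; congr f.
  by apply/rowP => -[].
have mfc : measurable_fun setT (fun x : 'rV[R]_n.+1 => f (c *: x)).
  exact: measurableT_comp mf (measurable_scale c).
rewrite !integral_rV_cons //.
have E (z : R) : ((c ^+ n)%:E * \int[lebesgue_rV n]_y f (c *: rV_cons (z, y))%R =
    \int[lebesgue_rV n]_y f (rV_cons (c * z, y))%R)%E.
  under eq_integral do rewrite rV_consZ.
  rewrite -(IH (fun y => f (rV_cons (c * z, y)))) //.
  apply: (measurableT_comp mf); apply: (measurableT_comp (@measurable_rV_cons R n)).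
  by apply: measurable_fun_pair => //; exact: measurable_cst.
have mF : measurable_fun setT (fun z : R => \int[lebesgue_rV n]_y f (rV_cons (z, y)))%E.
  apply: (measurable_fun_fubini_tonelli_F (fun zy => f (rV_cons zy))) => //.
  exact: measurableT_comp mf (@measurable_rV_cons R n).
rewrite -(integral_dilation1 c0 mF); last by move=> z; exact: integral_ge0.
under [in RHS]eq_integral do rewrite -E.
rewrite ge0_integralZl //.
- by rewrite exprS EFinM muleA.
- apply: (measurable_fun_fubini_tonelli_F (fun zy => f (c *: rV_cons zy : 'rV[R]_n.+1))) => //.
  exact: measurableT_comp mfc (@measurable_rV_cons R n).
- by move=> z _; exact: integral_ge0.
- by rewrite lee_fin exprn_ge0 // ltW.
Qed.

Lemma eball_measure n (r : R) : 0 < r ->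
  lebesgue_rV n (eball r) = ((r ^+ n)%:E * lebesgue_rV n (eball 1) : \bar R)%E.
Proof.
move=> r0.
have mI s : measurable_fun setT (fun x => (\1_(@eball R n s) x)%:E : \bar R).
  by apply/measurable_EFinP; apply: measurable_indic; exact: measurable_eball.
have iE s : lebesgue_rV n (eball s) = (\int[lebesgue_rV n]_x (\1_(eball s) x)%:E)%E.
  by rewrite integral_indic ?setIT //; exact: measurable_eball.
rewrite iE -(integral_dilation r0 (mI r)); last by move=> x; rewrite lee_fin indicE ler0n.
rewrite iE; congr (_ * _)%E; apply: eq_integral => x _; rewrite !indicE; congr (_%:R%:E).
congr nat_of_bool; apply/idP/idP; rewrite !inE /eball /= enormZ ?(ltW r0) // => H.
  by rewrite -(ler_pM2l r0) mulr1.
by rewrite -[leRHS]mulr1 ler_pM2l.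
Qed.

End dilation.

(** * Integrals over annuli *)

Section annuli.
Context {R : realType}.

Lemma subrX1_le (r : R) n : 1 <= r -> r ^+ n.+1 - (r - 1) ^+ n.+1 <= n.+1%:R * r ^+ n.
Proof.
move=> r1; elim: n => [|n IH]; first by rewrite !expr1 expr0; lra.
have r0 : 0 <= r ^+ n by rewrite exprn_ge0 //; lra.
have qr : (r - 1) ^+ n.+1 <= r ^+ n.+1 by apply: lerXn2r; rewrite ?nnegrE; lra.
have e : n.+2%:R = n.+1%:R + 1 :> R by rewrite natr1.
have h : n.+1%:R * r ^+ n.+1 = r * (n.+1%:R * r ^+ n) by rewrite exprS mulrCA.
have rr : 0 <= r by lra.
have := ler_wpM2l rr IH; rewrite -h [r ^+ n.+2]exprS [(r - 1) ^+ n.+2]exprS e.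
lra.
Qed.

Variable m : nat.
Local Notation mu := (@lebesgue_rV R m.+1).
Let omega : R := fine (mu (eball 1)).

(** Radii below 1 are included: the annulus is then a ball, or empty. *)
Lemma annulus_le (r tau : R) : 1 <= tau -> r <= tau ->
  (mu (eball r `\` eball (r - 1)) <= (omega * m.+1%:R * tau ^+ m)%:E)%E.
Proof.
move=> tau1 rt.
have mB s : measurable (@eball R m.+1 s) by exact: measurable_eball.
have sub s s' : s <= s' -> @eball R m.+1 s `<=` eball s'.
  by move=> ss x xs; exact: le_trans ss.
have om : mu (eball 1) = omega%:E by rewrite fineK // ge0_fin_numE // eball_fin.
have om0 : 0 < omega by exact: eball1_gt0.
have n1 : 1 <= m.+1%:R :> R by rewrite ler1n.
have t1 : 1 <= tau ^+ m by rewrite exprn_ege1.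
have [r1|r1] := leP r 1.
  apply: (@le_trans _ _ (mu (eball 1))).
    apply: le_measure; rewrite ?inE //; first exact: measurableD.
    by move=> x [xr _]; exact: sub xr.
  rewrite om lee_fin -mulrA ler_peMr ?(ltW om0) //.
  by rewrite mulr_ege1.
have -> : (mu (eball r `\` eball (r - 1)) = mu (eball r) - mu (eball (r - 1)))%E.
  have s1 : @eball R m.+1 (r - 1) `<=` eball r by apply: sub; lra.
  by rewrite -[in RHS](setIidr s1); apply: measureD => //; exact: eball_fin.
have r1' : 0 < r - 1 by rewrite subr_gt0.
rewrite (eball_measure _ (lt_trans ltr01 r1)) (eball_measure _ r1').
rewrite om -!EFinM -EFinB lee_fin -mulrBl mulrC -mulrA ler_pM2l //.
apply: (le_trans (subrX1_le m (ltW r1))); rewrite ler_wpM2l // lerXn2r ?nnegrE //; lra.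
Qed.

(** The ball is cut along the integer part of [tau - |x|] into annuli of width 1,
    each of volume at most a constant times [tau^m]. *)
Lemma integral_annuli_le (tau : R) (N : nat) (h : nat -> R) (H : 'rV[R]_m.+1 -> R) :
  1 <= tau -> tau < N.+1%:R -> measurable_fun setT H -> (forall x, 0 <= H x) ->
  (forall i, 0 <= h i) ->
  (forall x (i : nat), (0 < i)%N -> i%:R <= tau - enorm x -> H x <= h i) ->
  (\int[mu]_(x in eball (tau - 1)) (H x)%:E <=
   (omega * m.+1%:R * tau ^+ m * \sum_(i < N) h i.+1)%:E)%E.
Proof.
move=> tau1 tN mH H0 h0 Hh.
pose A (i : nat) : set 'rV[R]_m.+1 := eball (tau - i%:R) `\` eball (tau - i%:R - 1).
have mA i : measurable (A i) by apply: measurableD; exact: measurable_eball.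
apply: (@le_trans _ _ (\int[mu]_x \sum_(i < N) (h i.+1 * \1_(A i.+1) x)%:E)%E).
  rewrite integral_indic_mul; apply: ge0_le_integral => //.
  - by move=> x _; rewrite lee_fin mulr_ge0 // indicE ler0n.
  - apply/measurable_EFinP; apply: measurable_funM => //; apply: measurable_indic.
    exact: measurable_eball.
  - apply: emeasurable_sum => i; apply/measurable_EFinP; apply: measurable_funM.
      exact: measurable_cst.
    exact: measurable_indic.
  move=> x _; rewrite sumEFin lee_fin indicE.
  have S0 : 0 <= \sum_(i < N) h i.+1 * \1_(A i.+1) x.
    by apply: sumr_ge0 => i _; rewrite mulr_ge0 // indicE ler0n.
  have [xt|_] := boolP (x \in eball (tau - 1)); last by rewrite mulr0.
  move: xt; rewrite inE /eball /= => xt; rewrite mulr1.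
  pose d := tau - enorm x.
  have d1 : 1 <= d by rewrite /d; lra.
  have d0 : 0 <= d by lra.
  have := truncn_itv d0; set j := Num.truncn d => /andP[jd dj].
  have j0 : (0 < j)%N.
    by rewrite -(ltr_nat R); move: dj; rewrite -natr1; lra.
  have jN : (j.-1 < N)%N.
    rewrite prednK // -ltnS -(ltr_nat R); apply: le_lt_trans tN.
    by apply: (le_trans jd); rewrite /d; have := enorm_ge0 x; lra.
  rewrite (bigD1 (Ordinal jN)) //= prednK // [X in _ * X + _]indicE mem_set ?mulr1; last first.
    by split; rewrite /eball /=; [|move=> ?]; move: jd dj; rewrite /d -natr1; lra.
  rewrite -[leLHS]addr0; apply: lerD; first exact: Hh.
  by apply: sumr_ge0 => i _; rewrite mulr_ge0 // indicE ler0n.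
rewrite ge0_integral_sum //; last 2 first.
- move=> i; apply/measurable_EFinP; apply: measurable_funM; first exact: measurable_cst.
  exact: measurable_indic.
- by move=> i x _; rewrite lee_fin mulr_ge0 // indicE ler0n.
rewrite mulr_sumr -sumEFin; apply: lee_sum => i _.
under eq_integral do rewrite EFinM.
rewrite ge0_integralZl ?lee_fin //; last first.
  by apply/measurable_EFinP; exact: measurable_indic.
rewrite integral_indic // setIT [leRHS]EFinM muleC; apply: lee_wpmul2r; first by rewrite lee_fin.
by apply: annulus_le => //; rewrite lerBlDr lerDl ler0n.
Qed.

End annuli.

(** * Hoelder's inequality and dyadic sums *)

Section duality.
Context {R : realType} d (T : measurableType d) (mu : {measure set T -> \bar R}).
Local Notation integrableT h := (mu.-integrable setT (EFin \o h)).

(** Hoelder's inequality in the form of a lower bound for the power integral,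
    obtained by optimising Young's inequality. *)
Lemma power_integral_ge (p Z Y : R) (v b : T -> R) (B : set T) : 1 < p ->
  0 < Z -> 0 < Y -> measurable B -> measurable_fun setT b -> (forall x, 0 <= b x) ->
  measurable_fun setT v -> integrableT (fun x => `|v x| `^ p) ->
  {ae mu, forall x, ~ B x -> v x = 0} ->
  (Z%:E <= \int[mu]_x (`|v x| * b x)%:E)%E ->
  (\int[mu]_(x in B) (b x `^ (p / (p - 1)))%:E <= Y%:E)%E ->
  Z `^ p <= 2 * (2 * Y) `^ (p - 1) * \int[mu]_x (`|v x| `^ p).
Proof.
move=> p1 Z0 Y0 mB mb b0 mv iv vB ZI YI.
have p0 : 0 < p by lra.
have pp : 0 < p - 1 by lra.
pose q := p / (p - 1).
have q0 : 0 < q by rewrite divr_gt0.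
have pq : p^-1 + q^-1 = 1 by rewrite /q; field; rewrite !gt_eqF.
(* with this scale the second term of Young's inequality absorbs half of [Z] *)
pose a := 2 * Y / Z.
have a0 : 0 < a by rewrite divr_gt0 // mulr_gt0.
pose del := a `^ ((p - 1) / p).
have del0 : 0 < del by rewrite powR_gt0.
have delp : del `^ p = a `^ (p - 1).
  by rewrite -powRrM; congr powR; field; rewrite gt_eqF.
have delq : del^-1 `^ q = a^-1.
  rewrite -powR_inv1 ?(ltW del0) // -powR_inv1 ?(ltW a0) // -!powRrM; congr powR.
  by rewrite /q; field; rewrite !gt_eqF.
pose G := \int[mu]_x (`|v x| `^ p).
have young x : `|v x| * b x <= a `^ (p - 1) * `|v x| `^ p + a^-1 * b x `^ q.
  have := conjugate_powR (mulr_ge0 (ltW del0) (normr_ge0 (v x)))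
    (mulr_ge0 (ltW (_ : 0 < del^-1)) (b0 x)) p0 q0 pq.
  rewrite invr_gt0 => /(_ del0).
  have di : 0 <= del^-1 by rewrite invr_ge0 ltW.
  have -> : del * `|v x| * (del^-1 * b x) = `|v x| * b x by field; rewrite gt_eqF.
  rewrite (powRM _ (ltW del0) (normr_ge0 _)) (powRM _ di (b0 x)) delp delq.
  move=> H; apply: (le_trans H); apply: lerD.
    rewrite ler_piMr ?mulr_ge0 ?powR_ge0 // invf_le1 //; lra.
  rewrite ler_piMr ?mulr_ge0 ?powR_ge0 ?invr_ge0 ?(ltW a0) // invf_le1 //.
  by rewrite /q ler_pdivlMr //; lra.
have mvp : measurable_fun setT (fun x => `|v x| `^ p) by exact: integrable_measurable iv.
have mbq : measurable_fun setT (fun x => b x `^ q).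
  by apply: (@measurableT_comp _ _ _ _ _ _ (fun y : R => y `^ q)) => //; exact: measurable_powR.
have key : (Z%:E <= (a `^ (p - 1))%:E * G%:E + a^-1%:E * Y%:E)%E.
  apply: (le_trans ZI).
  have iG : (\int[mu]_x (`|v x| `^ p)%:E = G%:E)%E.
    by rewrite /G /Rintegral fineK //; exact: (integrable_fin_num _ iv).
  apply: (@le_trans _ _ (\int[mu]_x ((a `^ (p - 1))%:E * (`|v x| `^ p)%:E +
      a^-1%:E * (b x `^ q * \1_B x)%:E))%E).
    apply: ae_ge0_le_integral => //.
    - by move=> x _; rewrite lee_fin mulr_ge0.
    - by apply/measurable_EFinP; apply: measurable_funM => //; exact: measurableT_comp.
    - move=> x _; rewrite -!EFinM -EFinD lee_fin addr_ge0 // mulr_ge0 ?powR_ge0 ?invr_ge0 ?(ltW a0) //.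
      by rewrite mulr_ge0 ?powR_ge0 // indicE ler0n.
    - apply: emeasurable_funD; apply: measurable_funeM; apply/measurable_EFinP => //.
      by apply: measurable_funM => //; exact: measurable_indic.
    apply: filterS vB => x vx _; rewrite -!EFinM -EFinD lee_fin indicE.
    have [xB|xB] := boolP (x \in B); first by rewrite mulr1.
    have xB' : ~ B x by move/mem_set; exact/negP.
    by rewrite (vx xB') normr0 powR0 ?gt_eqF // mul0r !mulr0 addr0.
  rewrite ge0_integralD //; last 4 first.
  - by move=> x _; rewrite -EFinM lee_fin mulr_ge0 ?powR_ge0.
  - by apply: measurable_funeM; exact/measurable_EFinP.
  - move=> x _; rewrite -EFinM lee_fin mulr_ge0 ?invr_ge0 ?(ltW a0) //.
    by rewrite mulr_ge0 ?powR_ge0 // indicE ler0n.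
  - apply: measurable_funeM; apply/measurable_EFinP.
    by apply: measurable_funM => //; exact: measurable_indic.
  have mvE : measurable_fun setT (fun x => (`|v x| `^ p)%:E) by exact/measurable_EFinP.
  have mbE : measurable_fun setT (fun x => (b x `^ q * \1_B x)%:E).
    by apply/measurable_EFinP; apply: measurable_funM => //; exact: measurable_indic.
  have vE0 x : setT x -> (0 <= (`|v x| `^ p)%:E)%E by rewrite lee_fin powR_ge0.
  have bE0 x : setT x -> (0 <= (b x `^ q * \1_B x)%:E)%E.
    by rewrite lee_fin mulr_ge0 ?powR_ge0 // indicE ler0n.
  have a1 : (0 <= (a `^ (p - 1))%:E)%E by rewrite lee_fin powR_ge0.
  have a2 : (0 <= a^-1%:E)%E by rewrite lee_fin invr_ge0 ltW.
  rewrite (ge0_integralZl mu measurableT mvE vE0 a1) (ge0_integralZl mu measurableT mbE bE0 a2).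
  rewrite iG -integral_indic_mul leeD2lE // lee_wpmul2l // lee_fin invr_ge0 ltW.
rewrite -!EFinM -EFinD lee_fin in key.
have aY : a^-1 * Y = Z / 2 by rewrite /a; field; rewrite !gt_eqF.
have Zh : Z / 2 <= a `^ (p - 1) * G by move: key; rewrite aY; lra.
rewrite -(mulr_powRB1 (ltW Z0) p0).
have aE : a `^ (p - 1) * Z `^ (p - 1) = (2 * Y) `^ (p - 1).
  rewrite -powRM ?(ltW a0) ?(ltW Z0) //; congr powR; rewrite /a divfK // gt_eqF //.
rewrite -aE; have := ler_wpM2r (powR_ge0 Z (p - 1)) Zh; rewrite -/G; lra.
Qed.

End duality.

Section sums.
Context {R : realType}.

Lemma sum_half_le1 N : \sum_(i < N) (2^-1 : R) ^+ i.+1 <= 1.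
Proof.
have -> : \sum_(i < N) (2^-1 : R) ^+ i.+1 = 1 - 2^-1 ^+ N.
  elim: N => [|N IH]; first by rewrite big_ord0 expr0 subrr.
  by rewrite big_ord_recr /= IH exprS; field.
by rewrite gerBl exprn_ge0.
Qed.

Lemma sum_harmonic_le N : \sum_(i < N.+1) (i.+1%:R^-1 : R) <= 1 + ln (N.+1%:R).
Proof.
elim: N => [|N IH]; first by rewrite big_ord_recl big_ord0 ln1 invr1.
rewrite big_ord_recr /=; apply: (le_trans (lerD IH (lexx _))).
rewrite -addrA lerD2l.
have n1 : 0 < N.+1%:R :> R by rewrite ltr0n.
have n2 : 0 < N.+2%:R :> R by rewrite ltr0n.
have e2 : N.+2%:R = N.+1%:R + 1 :> R by rewrite natr1.
have : ln (N.+1%:R / N.+2%:R) <= - (N.+2%:R : R)^-1.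
  have -> : N.+1%:R / N.+2%:R = 1 + - (N.+2%:R : R)^-1.
    rewrite e2; move: (N.+1%:R : R) n1 => c c0; field.
    by apply/lt0r_neq0; lra.
  apply: le_ln1Dx; rewrite ltrN2 invf_lt1 // ltr1n //.
rewrite ln_div ?posrE //.
by move: (ln _) (ln _) (_^-1) => a b c; lra.
Qed.

(** The terms are dominated by a telescoping sum of [z^a / (1 + z^a)] over the
    dyadic points [z = d / 2^j], hence the bound is uniform in the number of terms. *)
Lemma dyadic_sum_le (a dd : R) J : 0 < a <= 1 -> 0 < dd ->
  \sum_(j < J) ((2^-1 ^+ j) `^ a * expR (- (2^-1 ^+ j * dd / 2))) <=
  16 / (1 - 2^-1 `^ a) * dd `^ (- a).
Proof.
move=> /andP[a0 a1] d0.
pose r : R := 2^-1 `^ a.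
have r0 : 0 < r by rewrite powR_gt0.
have r1 : r < 1.
  have e1 : 1 `^ a = 1 :> R by rewrite powR1.
  by rewrite /r -[X in _ < X]e1; apply: gt0_ltr_powR; rewrite ?nnegrE //; lra.
pose h (z : R) : R := z / (1 + z).
pose zz j : R := (2^-1 ^+ j * dd).
have zz0 j : 0 < zz j by rewrite mulr_gt0 // exprn_gt0.
have zzS j : (zz j.+1) `^ a = r * zz j `^ a.
  by rewrite /zz exprS -mulrA powRM // ltW // zz0.
have term j : zz j `^ a * expR (- (zz j / 2)) <=
    16 / (1 - r) * (h (zz j `^ a) - h (zz j.+1 `^ a)).
  rewrite zzS; set z := zz j; set y := z `^ a.
  have z0 : 0 < z by exact: zz0.
  have y0 : 0 < y by rewrite powR_gt0.
  have yz : y <= 1 + z.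
    have [z1|z1] := leP z 1.
      apply: (@le_trans _ _ 1); last lra.
      have e1 : 1 `^ a = 1 :> R by rewrite powR1.
      by rewrite -[X in _ <= X]e1; apply: ge0_ler_powR; rewrite ?nnegrE; lra.
    by apply: (@le_trans _ _ z); [apply: ler1_powR; lra|lra].
  have E : (1 + y) ^+ 2 <= 16 * expR (z / 2).
    have e4 := expR_ge1Dx (z / 4).
    have -> : expR (z / 2) = expR (z / 4) ^+ 2.
      by rewrite -expRM_natr; congr expR; field.
    have : (1 + z / 4) ^+ 2 <= expR (z / 4) ^+ 2.
      by rewrite ler_sqr ?nnegrE ?expR_ge0 //; lra.
    have : (1 + y) ^+ 2 <= (2 + z) ^+ 2 by rewrite ler_sqr ?nnegrE; lra.
    nra.
  have e0 := expR_gt0 (- (z / 2)).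
  have ee : expR (z / 2) * expR (- (z / 2)) = 1 by rewrite -expRD subrr expR0.
  have y1 : 0 < 1 + y by lra.
  have y2 : 0 < 1 + r * y by rewrite addr_gt0 // mulr_gt0.
  have -> : 16 / (1 - r) * (h y - h (r * y)) = 16 * y / ((1 + y) * (1 + r * y)).
    by rewrite /h; field; rewrite !gt_eqF // subr_gt0.
  rewrite ler_pdivlMr; last by rewrite mulr_gt0.
  apply: (@le_trans _ _ (y * expR (- (z / 2)) * (1 + y) ^+ 2)).
    rewrite ler_wpM2l ?mulr_ge0 ?(ltW y0) ?(ltW e0) // expr2 ler_pM2l //.
    rewrite lerD2l ler_piMl //; exact: ltW.
  rewrite -mulrA [leRHS]mulrC ler_pM2l //.
  apply: (le_trans (ler_wpM2l (ltW e0) E)).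
  by rewrite mulrCA [X in _ * X]mulrC ee mulr1.
have tele : \sum_(j < J) (h (zz j `^ a) - h (zz j.+1 `^ a)) <= 1.
  have -> : \sum_(j < J) (h (zz j `^ a) - h (zz j.+1 `^ a)) =
      h (zz 0 `^ a) - h (zz J `^ a).
    elim: (J) => [|N IH]; first by rewrite big_ord0 subrr.
    by rewrite big_ord_recr /= IH; ring.
  have h0 : 0 <= h (zz J `^ a) by rewrite divr_ge0 ?addr_ge0 ?powR_ge0.
  have h1 : h (zz 0 `^ a) <= 1.
    have y0 := powR_ge0 (zz 0) a.
    by rewrite /h ler_pdivrMr; lra.
  lra.
have da : dd `^ (- a) * dd `^ a = 1.
  by rewrite powRN mulVf // gt_eqF // powR_gt0.
have -> : \sum_(j < J) ((2^-1 ^+ j) `^ a * expR (- (2^-1 ^+ j * dd / 2))) =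
    dd `^ (- a) * \sum_(j < J) (zz j `^ a * expR (- (zz j / 2))).
  rewrite mulr_sumr; apply: eq_bigr => j _.
  rewrite /zz powRM ?exprn_ge0 ?(ltW d0) //.
  by rewrite -[LHS]mul1r -da; ring.
rewrite [leRHS]mulrC ler_wpM2l ?powR_ge0 //.
apply: (@le_trans _ _ (\sum_(j < J) 16 / (1 - r) * (h (zz j `^ a) - h (zz j.+1 `^ a)))).
  by apply: ler_sum => j _; exact: term.
rewrite -mulr_sumr ler_piMr //.
by rewrite divr_ge0 // subr_ge0 ltW.
Qed.

End sums.

(** * Pairings at the critical exponent *)

Section critical_estimates.
Context {R : realType}.

Definition conjugate_exponent (p : R) : R := p / (p - 1).

(** The rate at which the memory of earlier times decays: the factor
    [(s + b)^(- q)] of [memory_kernel] below. *)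
Definition critical_decay (m : nat) (p : R) : R := m%:R / 2 - p^-1.

Definition bump_constant (m : nat) (p : R) : R :=
  fine (lebesgue_rV m.+1 (eball 1)) * m.+1%:R *
  (2 * pi) `^ (m%:R * conjugate_exponent p / 2).

Variables (m : nat) (p : R).
Hypothesis p12 : 1 < p <= 2.
Hypothesis crit : 2 + (m%:R + 2) * p - m%:R * p ^+ 2 = 0.
Local Notation mu := (@lebesgue_rV R m.+1).
Local Notation integrableT h := (mu.-integrable setT (EFin \o h)).

Local Notation pc := (conjugate_exponent p).
Local Notation q := (critical_decay m p).
Local Notation kappa := (bump_constant m p).

Let p1 : 1 < p. Proof. by case/andP : p12. Qed.
Let p0 : 0 < p. Proof. exact: lt_trans p1. Qed.
Let pp : 0 < p - 1. Proof. by rewrite subr_gt0. Qed.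
Let pc2 : 2 <= pc.
Proof. by rewrite /conjugate_exponent ler_pdivlMr //; case/andP : p12 => _; lra. Qed.
Let pc0 : 0 < pc. Proof. exact: lt_le_trans pc2. Qed.

(** The left side collects the volume of the annuli and the amplitude of the waves
    after Hoelder's inequality. Its equality with [1 - q] is the quadratic
    equation of the critical exponent. *)
Lemma critical_exponent : (m%:R - m%:R * pc / 2) * (p - 1) = - (q - 1).
Proof.
have c : m%:R * p ^+ 2 = 2 + (m%:R + 2) * p by move: crit; lra.
have e : - (q - 1) = (2 * p - m%:R * p + 2) / (2 * p).
  by rewrite /critical_decay; field; rewrite gt_eqF.
have -> : (m%:R - m%:R * pc / 2) * (p - 1) = (2 * m%:R * p ^+ 2 - m%:R * 2 * p - m%:R * p ^+ 2) / (2 * p).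
  by rewrite /conjugate_exponent; field; rewrite !gt_eqF.
by rewrite e -[2 * m%:R * _]mulrA c; congr (_ / _); lra.
Qed.

Lemma bump_constant_gt0 : 0 < kappa.
Proof.
rewrite /bump_constant mulr_gt0 ?powR_gt0 ?mulr_gt0 ?pi_gt0 //; first exact: eball1_gt0.
Qed.

Lemma bump_power (z : R) : 0 < z ->
  (Num.sqrt z ^+ m) `^ pc = z `^ (m%:R * pc / 2).
Proof.
move=> z0; rewrite -powR12_sqrt ?(ltW z0) // -powR_mulrn ?powR_ge0 // -!powRrM.
by congr powR; ring.
Qed.

(** The dual norm of a superposition of bumps with profile [bet]: the amplitude is
    constant on the ball, so the radial profile alone decides. *)
Lemma integral_bump_le (tau : R) (N : nat) (h : nat -> R) (bet : 'rV[R]_m.+1 -> R) :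
  1 <= tau -> tau < N.+1%:R -> measurable_fun setT bet -> (forall x, 0 <= bet x) ->
  (forall i, 0 <= h i) ->
  (forall x (i : nat), (0 < i)%N -> i%:R <= tau - enorm x -> bet x `^ pc <= h i) ->
  (\int[mu]_(x in eball (tau - 1)) ((Num.sqrt (2 * pi / tau) ^+ m * bet x) `^ pc)%:E <=
   (kappa * tau `^ (m%:R - m%:R * pc / 2) * \sum_(i < N) h i.+1)%:E)%E.
Proof.
move=> tau1 tN mbet bet0 h0 Hh.
have tau0 : 0 < tau by exact: lt_le_trans tau1.
have z0 : 0 < 2 * pi / tau by rewrite divr_gt0 // mulr_gt0 // pi_gt0.
pose S := (2 * pi / tau) `^ (m%:R * pc / 2).
have S0 : 0 <= S by exact: powR_ge0.
have HE x : (Num.sqrt (2 * pi / tau) ^+ m * bet x) `^ pc = S * bet x `^ pc.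
  by rewrite powRM ?exprn_ge0 ?sqrtr_ge0 // bump_power.
have mbp : measurable_fun setT (fun x => bet x `^ pc).
  by apply: (@measurableT_comp _ _ _ _ _ _ (fun y : R => y `^ pc)) => //; exact: measurable_powR.
under eq_integral do rewrite HE.
apply: (le_trans (@integral_annuli_le R m tau N (fun i => S * h i) (fun x => S * bet x `^ pc) tau1 tN _ _ _ _)).
- by apply: measurable_funM => //; exact: measurable_cst.
- by move=> x; rewrite mulr_ge0 ?powR_ge0.
- by move=> i; rewrite mulr_ge0.
- by move=> x i i0 ix; rewrite ler_wpM2l //; exact: Hh.
rewrite lee_fin -mulr_sumr le_eqVlt; apply/orP; left; apply/eqP.
have -> : tau `^ (m%:R - m%:R * pc / 2) = tau ^+ m * tau `^ (- (m%:R * pc / 2)).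
  by rewrite powRD ?powR_mulrn ?(ltW tau0) // (gt_eqF tau0) implybT.
have -> : S = (2 * pi) `^ (m%:R * pc / 2) * tau `^ (- (m%:R * pc / 2)).
  rewrite /S powRM ?invr_ge0 ?(ltW tau0) ?mulr_ge0 ?pi_ge0 //.
  by rewrite -(powR_inv1 (ltW tau0)) -powRrM mulN1r.
by rewrite /bump_constant; ring.
Qed.

(** All powers of [tau] in Hoelder's inequality combine to [1 - q], whatever the
    profile; the profile contributes through [D]. *)
Lemma pairing_lower (tau Z D : R) (v bb : 'rV[R]_m.+1 -> R) :
  1 <= tau -> 0 <= Z -> 0 < D ->
  measurable_fun setT bb -> (forall x, 0 <= bb x) ->
  measurable_fun setT v -> integrableT (fun x => `|v x| `^ p) ->
  supp_in_ball (tau - 1) v ->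
  (Z%:E <= \int[mu]_x (`|v x| * bb x)%:E)%E ->
  (\int[mu]_(x in eball (tau - 1)) (bb x `^ pc)%:E <=
    (kappa * tau `^ (m%:R - m%:R * pc / 2) * D)%:E)%E ->
  Z `^ p * tau `^ (q - 1) <=
  2 * (2 * kappa) `^ (p - 1) * D `^ (p - 1) * \int[mu]_x (`|v x| `^ p).
Proof.
move=> tau1 Z0 D0 mbb bb0 mv iv sv ZI YI.
have tau0 : 0 < tau by exact: lt_le_trans tau1.
have G0 : 0 <= \int[mu]_x (`|v x| `^ p) by apply: Rintegral_ge0 => x _; exact: powR_ge0.
have [Zz|Z_neq0] := eqVneq Z 0.
  by rewrite Zz powR0 ?gt_eqF // mul0r !mulr_ge0 ?powR_ge0.
have {Z0 Z_neq0} Z0 : 0 < Z by rewrite lt_neqAle eq_sym Z_neq0.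
have Y0 : 0 < kappa * tau `^ (m%:R - m%:R * pc / 2) * D.
  by apply: mulr_gt0 => //; apply: mulr_gt0; [exact: bump_constant_gt0|exact: powR_gt0].
have vB : {ae mu, forall x, ~ eball (tau - 1) x -> v x = 0}.
  by apply: filterS sv => x H /negP; rewrite -ltNge; exact: H.
have H := power_integral_ge p1 Z0 Y0 (measurable_eball _) mbb bb0 mv iv vB ZI YI.
have E : (2 * (kappa * tau `^ (m%:R - m%:R * pc / 2) * D)) `^ (p - 1) =
    (2 * kappa) `^ (p - 1) * D `^ (p - 1) * tau `^ (- (q - 1)).
  have -> : 2 * (kappa * tau `^ (m%:R - m%:R * pc / 2) * D) =
    (2 * kappa) * D * tau `^ (m%:R - m%:R * pc / 2) by ring.
  have k2 : 0 <= 2 * kappa by apply: mulr_ge0 => //; exact: ltW bump_constant_gt0.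
  rewrite (powRM _ (mulr_ge0 k2 (ltW D0)) (powR_ge0 _ _)) (powRM _ k2 (ltW D0)).
  by rewrite -powRrM critical_exponent.
have tq : tau `^ (- (q - 1)) * tau `^ (q - 1) = 1.
  by rewrite powRN mulVf // gt_eqF // powR_gt0.
have := ler_wpM2r (powR_ge0 tau (q - 1)) H; rewrite E => {}H; apply: (le_trans H).
rewrite le_eqVlt; apply/orP; left; apply/eqP.
set G := \int[mu]_x _; set A := (2 * kappa) `^ _; set B := D `^ _.
transitivity (2 * A * B * G * (tau `^ (- (q - 1)) * tau `^ (q - 1))); first by ring.
by rewrite tq mulr1.
Qed.

End critical_estimates.

(** * Lower bounds of the power integral *)

Section lower_bounds.
Context {R : realType}.
Variables (m : nat) (p rad : R) (f g : 'rV[R]_m.+1 -> R).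
Local Notation mu := (@lebesgue_rV R m.+1).
Hypothesis p12 : 1 < p <= 2.
Hypothesis crit : 2 + (m%:R + 2) * p - m%:R * p ^+ 2 = 0.
Hypothesis rad0 : 0 < rad.
Hypotheses (f2 : in_L2 f) (g2 : in_L2 g).
Hypotheses (f0 : {ae mu, forall x, 0 <= f x}) (g0 : {ae mu, forall x, 0 <= g x}).
Hypotheses (fr : supp_in_ball rad f) (gr : supp_in_ball rad g).

Local Notation pc := (conjugate_exponent p).
Local Notation q := (critical_decay m p).
Local Notation kappa := (bump_constant m p).
Local Notation b := (rad + 1).
Local Notation V := (fine (lebesgue_rV m (eball 1) : \bar R)).

Definition power_integral (u : R -> 'rV[R]_m.+1 -> R) (s : R) : R :=
  \int[mu]_x (`|u s x| `^ p).

Definition supported_solution (eps : R) (T : \bar R) (u ut : R -> 'rV[R]_m.+1 -> R) :=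
  wave_solution p (eps \*o f) (eps \*o g) T u ut /\
  forall s, 0 <= s -> (s%:E < T)%E -> supp_in_ball (s + rad) (u s).

Let p1 : 1 < p. Proof. by case/andP : p12. Qed.
Let p0 : 0 < p. Proof. exact: lt_trans p1. Qed.
Let pp : 0 < p - 1. Proof. by rewrite subr_gt0. Qed.
Let pc2 : 2 <= pc.
Proof. by rewrite /conjugate_exponent ler_pdivlMr //; case/andP : p12 => _; lra. Qed.

Let F : R := \int[mu]_x f x.
Let F0 : 0 <= F.
Proof. by apply: Rintegral_ae_ge0 => //; exact: in_L2_integrable f2 fr. Qed.

Lemma power_integral_ge0 u s : 0 <= power_integral u s.
Proof. by apply: Rintegral_ge0 => x _; exact: powR_ge0. Qed.

Lemma light_bumpE k tau (x : 'rV[R]_m.+1) : 0 < k -> 0 < tau ->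
  light_bump k tau x = Num.sqrt (2 * pi / tau) ^+ m *
    (k `^ (- (m%:R / 2)) * expR (- (k * (tau - enorm x) / 2))).
Proof.
move=> k0 tau0; rewrite /light_bump mulrA; congr (_ * _).
have z0 : 0 <= 2 * pi / tau by rewrite divr_ge0 ?mulr_ge0 ?pi_ge0 // ltW.
have ki : 0 <= k^-1 by rewrite invr_ge0 ltW.
have -> : 2 * pi / (k * tau) = 2 * pi / tau * k^-1 by rewrite invfM; ring.
rewrite sqrtrM // exprMn; congr (_ * _).
rewrite -powR12_sqrt // -powR_mulrn ?powR_ge0 // -(powR_inv1 (ltW k0)) -!powRrM.
by congr powR; ring.
Qed.

Section at_time.
Variables (eps : R) (T : \bar R) (u ut : R -> 'rV[R]_m.+1 -> R) (t : R).
Hypothesis eps0 : 0 < eps.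
Hypothesis sol : supported_solution eps T u ut.
Hypotheses (t0 : 0 <= t) (tT : (t%:E < T)%E).
Let tau : R := t + b.

Let tau1 : 1 <= tau. Proof. by have A := t0; have B := rad0; rewrite /tau; lra. Qed.
Let tau0 : 0 < tau. Proof. exact: lt_le_trans tau1. Qed.

Let G := power_integral u.
Let G0 s : 0 <= G s. Proof. exact: power_integral_ge0. Qed.

Let iut : mu.-integrable setT (EFin \o u t).
Proof. by case: sol => -[_ _ _ _ ie] _; have [] := ie _ (conj t0 tT). Qed.

Let iup : mu.-integrable setT (EFin \o (fun x => `|u t x| `^ p)).
Proof. by case: sol => -[_ _ _ _ ie] _; have [] := ie _ (conj t0 tT). Qed.

Let iG : lebesgue_measure.-integrable `[0, t] (EFin \o G).
Proof. by case: sol => -[_ _ _ _ ie] _; have [] := ie _ (conj t0 tT). Qed.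

Let sut : supp_in_ball (tau - 1) (u t).
Proof.
have -> : tau - 1 = t + rad by rewrite /tau; lra.
by case: sol => _; exact.
Qed.

Let K k := \int[lebesgue_measure]_(s in `[0, t]) (wave_kernel b k t s * G s).

Let moment k : 0 < k ->
  ((V * (eps * F / 2 * expR (- (k * b)) + K k))%:E <=
   \int[mu]_x (`|u t x| * light_bump k tau x)%:E)%E.
Proof.
move=> k0; case: sol => ws su.
exact: (light_moment_ge p12 rad0 eps0 f2 g2 f0 g0 fr gr ws su t0 tT k0).
Qed.

Let V0 : 0 < V. Proof. exact: eball1_gt0. Qed.

Let K0 k : 0 < k -> 0 <= K k.
Proof.
move=> k0; apply: Rintegral_ge0 => s; rewrite /= in_itv /= => /andP[_ st].
by apply: mulr_ge0; [exact: wave_kernel_ge0|exact: G0].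
Qed.

Let N : nat := Num.truncn tau.

Let tauN : tau < N.+1%:R. Proof. exact: truncnS_gt. Qed.

Let measurable_expd (k : R) :
  measurable_fun setT (fun x : 'rV[R]_m.+1 => expR (- (k * (tau - enorm x) / 2))).
Proof.
apply: (@measurableT_comp _ _ _ _ _ _ (@expR R)); first exact: measurable_expR.
apply: measurableT_comp => //; apply: measurable_funM; last exact: measurable_cst.
apply: measurable_funM; first exact: measurable_cst.
by apply: measurable_funB; [exact: measurable_cst|exact: measurable_enorm].
Qed.

(** Testing with a single frequency: the wave emitted by the data alone. *)
Lemma power_integral_data :
  (V * (eps * F / 2 * expR (- b))) `^ p * tau `^ (q - 1) <=
  2 * (2 * kappa) `^ (p - 1) * G t.
Proof.
pose bet (x : 'rV[R]_m.+1) := expR (- (1 * (tau - enorm x) / 2)).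
pose bb (x : 'rV[R]_m.+1) := Num.sqrt (2 * pi / tau) ^+ m * bet x.
have mbet : measurable_fun setT bet by exact: measurable_expd.
have bbE x : bb x = light_bump 1 tau x.
  by rewrite light_bumpE // powR1 mul1r.
have B := @integral_bump_le R m p tau N (fun i => 2^-1 ^+ i) bet tau1 tauN mbet
  (fun x => expR_ge0 _) (fun i => exprn_ge0 _ (ltac:(by rewrite invr_ge0) : 0 <= 2^-1 :> R)).
have -> : 2 * (2 * kappa) `^ (p - 1) * G t =
  2 * (2 * kappa) `^ (p - 1) * 1 `^ (p - 1) * G t by rewrite powR1 mulr1.
apply: (@pairing_lower R m p p12 crit tau _ 1 (u t) bb) => //.
- by rewrite !mulr_ge0 ?expR_ge0 ?invr_ge0 ?(ltW V0) ?(ltW eps0).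
- by apply: measurable_funM => //; exact: measurable_cst.
- by move=> x; rewrite mulr_ge0 ?exprn_ge0 ?sqrtr_ge0 ?expR_ge0.
- exact: integrable_measurable iut.
- under eq_integral do rewrite bbE.
  apply: le_trans (moment (ltr01)); rewrite lee_fin ler_pM2l // mul1r lerDl.
  exact: K0.
- apply: (le_trans (B _)).
    move=> x i i0 ix; rewrite /bet -expRM mul1r.
    have h2 : expR (-1) <= 2^-1 :> R.
      rewrite expRN lef_pV2 ?posrE ?expR_gt0 //; have := expR_ge1Dx (1 : R); lra.
    apply: (@le_trans _ _ (expR (-1) ^+ i)).
      rewrite -expRM_natl ler_expR.
      have i00 : 0 <= i%:R :> R by exact: ler0n.
      have := pc2; nra.
    by apply: lerXn2r; rewrite ?nnegrE ?expR_ge0 // invr_ge0.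
  rewrite lee_fin mulr1 ler_piMr ?sum_half_le1 // mulr_ge0 ?powR_ge0 //.
  by rewrite !mulr_ge0 ?powR_ge0 ?fine_ge0.
Qed.

Lemma critical_decay_gt0 : 0 < q.
Proof.
have c : m%:R * p ^+ 2 = 2 + (m%:R + 2) * p by have := crit; lra.
have -> : q = 2 / (p * (p - 1)).
  apply/eqP; rewrite -subr_eq0; apply/eqP.
  have -> : q - 2 / (p * (p - 1)) = (m%:R * p ^+ 2 - 2 - (m%:R + 2) * p) / (2 * p * (p - 1)).
    by rewrite /critical_decay; field; rewrite !gt_eqF.
  have z : 2 + (m%:R + 2) * p - 2 - (m%:R + 2) * p = 0 by ring.
  by rewrite c z mul0r.
by rewrite divr_gt0 // mulr_gt0.
Qed.

(** What survives of the dyadic superposition of the wave kernels, see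
    [memory_kernel_dyadic]. *)
Definition memory_kernel (s : R) : R := (t - s) / (t + b) * (s + b) `^ (- q).

Definition memory : R :=
  \int[lebesgue_measure]_(s in `[0, t]) (memory_kernel s * G s).

Lemma memory_kernel_bound s : 0 <= s <= t -> 0 <= memory_kernel s <= 1.
Proof.
move=> /andP[s0 st]; have r0 := rad0.
have tb : 0 < t + b by lra.
have sb : 1 <= s + b by lra.
have h1 : 0 <= (t - s) / (t + b) <= 1.
  by rewrite divr_ge0 ?subr_ge0 ?(ltW tb) //= ler_pdivrMr // mul1r; lra.
have h2 : (s + b) `^ (- q) <= 1.
  rewrite powRN invf_le1 ?powR_gt0 //; last lra.
  by rewrite -[leLHS](powRr0 (s + b)) ler_powR // ltW // critical_decay_gt0.
have h3 := powR_ge0 (s + b) (- q).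
by case/andP: h1 => h0 h1; rewrite mulr_ge0 //= mulr_ile1.
Qed.

Lemma measurable_memory_kernel : measurable_fun setT memory_kernel.
Proof.
apply: measurable_funM.
  apply: measurable_funM; last exact: measurable_cst.
  by apply: measurable_funB => //; exact: measurable_cst.
apply: (@measurableT_comp _ _ _ _ _ _ (fun y : R => y `^ (- q))).
  exact: measurable_powR.
by apply: measurable_funD => //; exact: measurable_cst.
Qed.

Lemma memory_integrable : lebesgue_measure.-integrable `[0, t]
  (EFin \o (fun s => memory_kernel s * G s)).
Proof.
apply: le_integrable iG => //.
  apply/measurable_EFinP; apply: measurable_funM.
    by apply: measurable_funTS; exact: measurable_memory_kernel.
  by apply/measurable_EFinP; exact: measurable_int iG.
move=> s /=; rewrite in_itv /= => st; rewrite lee_fin normrM.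
have /andP[k0 k1] := memory_kernel_bound st.
by rewrite (ger0_norm k0) ler_piMl.
Qed.

Let kk (j : nat) : R := 2^-1 ^+ j.
Let kk0 j : 0 < kk j. Proof. by rewrite exprn_gt0 // invr_gt0. Qed.

(** At time [s] only the dyadic frequency comparable to [1 / (s + b)] is used. *)
Lemma memory_kernel_dyadic J s : tau < 2 ^+ J -> 0 <= s <= t ->
  expR (- 2) / 2 * memory_kernel s <=
  \sum_(j < J) (kk j `^ (q + 1) * wave_kernel b (kk j) t s).
Proof.
move=> tJ /andP[s0 st]; have r0 := rad0; have q0 := critical_decay_gt0.
have sb : 1 <= s + b by lra.
have sb0 : 0 < s + b by lra.
have tb : 0 < t + b by lra.
pose M := Num.truncn (s + b).
have /andP[M1 M2] : M%:R <= s + b < M.+1%:R by apply: truncn_itv; lra.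
have M0 : (0 < M)%N by rewrite -(ltr_nat R); move: M2; rewrite -natr1; lra.
pose j := trunc_log 2 M.
have j1 : 2 ^+ j <= s + b.
  apply: le_trans M1; rewrite -natrX ler_nat; exact: trunc_logP.
have j2 : s + b < 2 ^+ j.+1.
  apply: (lt_le_trans M2); rewrite -natrX ler_nat; exact: trunc_log_ltn.
have jJ : (j < J)%N.
  have : (2 : R) ^+ j < 2 ^+ J by apply: (le_lt_trans j1); apply: le_lt_trans tJ; rewrite /tau; lra.
  by rewrite ltr_eXn2l // ltr1n.
have pj : 0 < (2 : R) ^+ j by rewrite exprn_gt0.
have kE : kk j = (2 ^+ j)^-1 by rewrite /kk exprVn.
have ks1 : 1 <= kk j * (s + b) by rewrite kE mulrC ler_pdivlMr // mul1r.
have ks2 : kk j * (s + b) <= 2.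
  by rewrite kE mulrC ler_pdivrMr //; move: j2; rewrite exprS => /ltW.
rewrite (bigD1 (Ordinal jJ)) //= -[leLHS]addr0; apply: lerD; last first.
  apply: sumr_ge0 => i _; rewrite mulr_ge0 ?powR_ge0 //.
  exact: wave_kernel_ge0.
set k := kk j in kE ks1 ks2 *; have k0 : 0 < k by exact: kk0.
have -> : k `^ (q + 1) * wave_kernel b k t s =
    (expR (- (k * (s + b))) / 2) * ((1 - expR (- (k * (t - s)))) * k `^ q).
  rewrite powRD ?(gt_eqF k0) ?implybT // powRr1 ?(ltW k0) // /wave_kernel.
  by field; rewrite gt_eqF.
have z0 : 0 <= (t - s) / (s + b) by rewrite divr_ge0 ?subr_ge0 // ltW.
apply: ler_pM.
- by rewrite divr_ge0 ?expR_ge0.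
- by rewrite mulr_ge0 ?powR_ge0 // divr_ge0 ?subr_ge0 // ltW.
- by rewrite ler_pM2r ?invr_gt0 // ler_expR lerN2.
apply: ler_pM; rewrite ?powR_ge0 //.
- by rewrite divr_ge0 ?subr_ge0 // ltW.
- have e1 : expR (- (k * (t - s))) <= expR (- ((t - s) / (s + b))).
    rewrite ler_expR lerN2 ler_pdivrMr // mulrAC mulrC ler_peMr // subr_ge0 //.
  have e2 : expR (- ((t - s) / (s + b))) <= (1 + (t - s) / (s + b))^-1.
    rewrite expRN lef_pV2 ?posrE ?expR_gt0 //; last lra.
    exact: expR_ge1Dx.
  have -> : (t - s) / (t + b) = 1 - (1 + (t - s) / (s + b))^-1.
    have -> : 1 + (t - s) / (s + b) = (t + b) / (s + b) by field; rewrite gt_eqF.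
    by rewrite invf_div; field; rewrite gt_eqF.
  lra.
- rewrite powRN -powR_inv1 ?powR_ge0 // -powRrM mulrN1 powRN.
  have e1 : (s + b) `^ q * k `^ q = ((s + b) * k) `^ q by rewrite powRM // ltW.
  rewrite -[leLHS]mul1r ler_pdivrMr ?powR_gt0 // mulrC e1 mulrC.
  rewrite -[leLHS](powRr0 (k * (s + b))); apply: ler_powR => //; exact: ltW.
Qed.

Definition feedback_constant : R :=
  (16 / (1 - 2^-1 `^ (1 - p^-1))) `^ pc.

Let a := 1 - p^-1.
Let a01 : 0 < a <= 1.
Proof.
by rewrite /a subr_gt0 invf_lt1 // p1 /= gerBl invr_ge0 ltW.
Qed.

Let C16 : 0 < 16 / (1 - 2^-1 `^ a) :> R.
Proof.
have /andP[a0 _] := a01.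
rewrite divr_gt0 // subr_gt0.
have e1 : 1 `^ a = 1 :> R by rewrite powR1.
by rewrite -[X in _ < X]e1; apply: gt0_ltr_powR; rewrite ?nnegrE //; lra.
Qed.

Lemma feedback_constant_gt0 : 0 < feedback_constant.
Proof. by rewrite powR_gt0. Qed.

Lemma Rintegral_sum_ord J (c : nat -> R) (h : nat -> R -> R) :
  (forall j, lebesgue_measure.-integrable `[0, t] (EFin \o h j)) ->
  lebesgue_measure.-integrable `[0, t] (EFin \o (fun s => \sum_(j < J) (c j * h j s))) /\
  \int[lebesgue_measure]_(s in `[0, t]) (\sum_(j < J) (c j * h j s)) =
  \sum_(j < J) (c j * \int[lebesgue_measure]_(s in `[0, t]) h j s).
Proof.
move=> ih.
have mI : measurable (`[0, t]%classic : set (measurableTypeR R)) by exact: measurable_itv.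
elim: J => [|J [IH1 IH2]].
  have -> : (fun s => \sum_(j < 0) (c j * h j s)) = cst 0.
    by apply/funext => s; rewrite big_ord0.
  split; last by rewrite big_ord0 Rintegral_cst // mul0r.
  exact: integrable0.
have icJ : lebesgue_measure.-integrable `[0, t] (EFin \o (fun s => c J * h J s)).
  by have := integrableZl mI (c J) (ih J); apply: eq_integrable.
have E : (fun s => \sum_(j < J.+1) (c j * h j s)) =
    (fun s => \sum_(j < J) (c j * h j s) + c J * h J s).
  by apply/funext => s; rewrite big_ord_recr.
rewrite E; split; first by have := integrableD mI IH1 icJ; apply: eq_integrable.
by rewrite RintegralD // IH2 RintegralZl // big_ord_recr.
Qed.

(** Testing with all dyadic frequencies at once: the effect of the nonlinearity
    at earlier times. The decay exponent [q] makes the weight of each dyadic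
    shell the same, so their superposition costs only a logarithm. *)
Lemma power_integral_memory :
  (V * (expR (- 2) / 2 * memory)) `^ p * tau `^ (q - 1) <=
  2 * (2 * kappa) `^ (p - 1) * (feedback_constant * (1 + ln tau)) `^ (p - 1) * G t.
Proof.
have /andP[a0 a1] := a01.
have [J tJ] : exists J, tau < 2 ^+ J.
  exists N.+1; apply: (lt_le_trans tauN); rewrite -natrX ler_nat; exact/ltnW/ltn_expl.
pose bet (x : 'rV[R]_m.+1) :=
  \sum_(j < J) (kk j `^ a * expR (- (kk j * (tau - enorm x) / 2))).
pose bb (x : 'rV[R]_m.+1) := Num.sqrt (2 * pi / tau) ^+ m * bet x.
have mbet : measurable_fun setT bet.
  apply: measurable_sum => j; apply: measurable_funM; first exact: measurable_cst.
  exact: measurable_expd.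
have bet0 x : 0 <= bet x.
  by apply: sumr_ge0 => j _; rewrite mulr_ge0 ?powR_ge0 ?expR_ge0.
have bbE x : bb x = \sum_(j < J) (kk j `^ (q + 1) * light_bump (kk j) tau x).
  rewrite /bb /bet mulr_sumr; apply: eq_bigr => j _.
  have -> : kk j `^ a = kk j `^ (q + 1) * kk j `^ (- (m%:R / 2)).
    rewrite -powRD ?(gt_eqF (kk0 j)) ?implybT //; congr powR.
    by rewrite /a /critical_decay; lra.
  by rewrite light_bumpE //; ring.
have ln0 : 0 <= ln tau by rewrite ln_ge0.
have D0 : 0 < feedback_constant * (1 + ln tau).
  by rewrite mulr_gt0 ?feedback_constant_gt0 // ltr_pwDl.
have M0 : 0 <= memory.
  apply: Rintegral_ge0 => s; rewrite /= in_itv /= => /memory_kernel_bound/andP[k0 _].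
  by rewrite mulr_ge0.
apply: (@pairing_lower R m p p12 crit tau _ _ (u t) bb) => //.
- by rewrite !mulr_ge0 ?expR_ge0 ?invr_ge0 ?(ltW V0).
- by apply: measurable_funM => //; exact: measurable_cst.
- by move=> x; rewrite mulr_ge0 ?exprn_ge0 ?sqrtr_ge0.
- exact: integrable_measurable iut.
- have mu_ : measurable_fun setT (u t) by exact: integrable_measurable iut.
  apply: (@le_trans _ _ (\sum_(j < J) ((kk j `^ (q + 1))%:E *
     \int[mu]_x (`|u t x| * light_bump (kk j) tau x)%:E))%E).
    apply: (@le_trans _ _ (\sum_(j < J) (kk j `^ (q + 1) * (V * K (kk j)))%:E)%E).
      rewrite sumEFin lee_fin.
      have -> : \sum_(j < J) kk j `^ (q + 1) * (V * K (kk j)) =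
          V * \sum_(j < J) (kk j `^ (q + 1) * K (kk j)).
        by rewrite mulr_sumr; apply: eq_bigr => j _; rewrite mulrCA.
      rewrite ler_pM2l //.
      have b0 : 0 <= b by have := rad0; lra.
      have [iS <-] := @Rintegral_sum_ord J (fun j => kk j `^ (q + 1))
        (fun j s => wave_kernel b (kk j) t s * G s)
        (fun j => wave_kernel_integrable (kk0 j) b0 iG).
      have mI : measurable (`[0, t]%classic : set (measurableTypeR R)) by exact: measurable_itv.
      rewrite /memory -RintegralZl //; last exact: memory_integrable.
      apply: le_Rintegral => //.
        by have := integrableZl mI (expR (- 2) / 2) memory_integrable; apply: eq_integrable.
      move=> s /=; rewrite in_itv /= => st.
      rewrite mulrA (eq_bigr (fun j : 'I_J => (kk j `^ (q + 1) * wave_kernel b (kk j) t s) * G s)); last first.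
        by move=> j _; rewrite mulrA.
      by rewrite -mulr_suml ler_wpM2r //; exact: memory_kernel_dyadic.
    apply: lee_sum => j _; rewrite EFinM; apply: lee_wpmul2l; first by rewrite lee_fin powR_ge0.
    apply: le_trans (moment (kk0 j)); rewrite lee_fin ler_pM2l // lerDr.
    by rewrite !mulr_ge0 ?expR_ge0 ?invr_ge0 ?(ltW eps0).
  have mlb k : measurable_fun setT (light_bump k tau : 'rV[R]_m.+1 -> R).
    by apply: measurable_funM; [exact: measurable_cst|exact: measurable_expd].
  have lb0 k (x : 'rV[R]_m.+1) : 0 <= light_bump k tau x.
    by rewrite mulr_ge0 ?exprn_ge0 ?sqrtr_ge0 ?expR_ge0.
  have mE (j : nat) : measurable_fun setT (fun x => (`|u t x| * light_bump (kk j) tau x)%:E).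
    by apply/measurable_EFinP; apply: measurable_funM => //; exact: measurableT_comp.
  rewrite le_eqVlt; apply/orP; left; apply/eqP.
  transitivity (\int[mu]_x (\sum_(j < J) ((kk j `^ (q + 1))%:E * (`|u t x| * light_bump (kk j) tau x)%:E)))%E.
    rewrite ge0_integral_sum //.
    - apply: eq_bigr => j _; rewrite ge0_integralZl ?lee_fin ?powR_ge0 //.
      by move=> x _; rewrite lee_fin mulr_ge0.
    - by move=> j; exact: measurable_funeM.
    - by move=> j x _; rewrite -EFinM lee_fin !mulr_ge0 ?powR_ge0.
  apply: eq_integral => x _; rewrite bbE mulr_sumr -sumEFin; apply: eq_bigr => j _.
  by rewrite -EFinM; congr (_%:E); rewrite mulrCA.
pose h (i : nat) : R := feedback_constant / i%:R.
have h0 i : 0 <= h i by rewrite divr_ge0 // ltW // feedback_constant_gt0.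
have B := @integral_bump_le R m p tau N h bet tau1 tauN mbet bet0 h0.
apply: (le_trans (B _)).
  move=> x i i0 ix.
  have ip : 0 < i%:R :> R by rewrite ltr0n.
  have d0 : 0 < tau - enorm x by exact: lt_le_trans ix.
  have le := dyadic_sum_le J a01 d0.
  have : bet x `^ pc <= (16 / (1 - 2^-1 `^ a) * (tau - enorm x) `^ (- a)) `^ pc.
    apply: ge0_ler_powR; last exact: le.
    - by apply: le_trans pc2.
    - by rewrite nnegrE.
    - by rewrite nnegrE; apply: mulr_ge0; [exact: ltW C16|exact: powR_ge0].
  move=> /le_trans; apply.
  rewrite powRM ?powR_ge0 ?(ltW C16) // -powRrM.
  have -> : - a * pc = -1.
    by rewrite /a /conjugate_exponent; field; rewrite !gt_eqF.
  rewrite powR_inv1 ?(ltW d0) // /h ler_wpM2l ?powR_ge0 // lef_pV2 ?posrE //.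
have N0 : (0 < N)%N by rewrite -(ltr_nat R); move: tauN; have := tau1; rewrite -natr1; lra.
have Ntau : N%:R <= tau by have /andP[] := truncn_itv (ltW tau0).
rewrite lee_fin ler_wpM2l ?mulr_ge0 ?powR_ge0 ?fine_ge0 // -mulr_sumr ler_wpM2l ?powR_ge0 //.
have harm k : (0 < k)%N -> \sum_(i < k) (i.+1%:R^-1 : R) <= 1 + ln k%:R.
  by case: k => // k _; exact: sum_harmonic_le.
apply: (le_trans (harm _ N0)); rewrite lerD2l.
by rewrite ler_ln ?posrE // ltr0n.
Qed.

End at_time.
End lower_bounds.

(** * Iteration in logarithmic time *)

Section iteration.
Context {R : realType}.

Lemma onem_expRN_ge (z : R) : 0 <= z -> z / (1 + z) <= 1 - expR (- z).
Proof.
move=> z0; have z1 : 0 < 1 + z by lra.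
have : expR (- z) <= (1 + z)^-1.
  by rewrite expRN lef_pV2 ?posrE ?expR_gt0 //; exact: expR_ge1Dx.
have -> : z / (1 + z) = 1 - (1 + z)^-1 by field; rewrite gt_eqF.
lra.
Qed.

(** A lower bound [L m0 A^j] of [M] between the times [L (1 - 2^(-j-1))] and [L] gives,
    through [beta M^p <= (1 + s)^(p - 1) g], one of [g], and integrating it over the
    first half of the gap to the next time yields the bound with [j + 1]. Each step
    raises the bound to the power [p] and loses a factor [4^j]; with
    [A^(p - 1) = 4] these balance as soon as [L] is large. The bounds are
    unbounded in [j] at the time [L]. *)
Lemma iteration_bound (p alpha beta L lb : R) (M g : R -> R) : 1 < p <= 2 ->
  0 < alpha -> 0 < beta -> 4 <= L -> 8 * lb <= L ->
  (forall th1 th2 th gam, lb <= th1 -> th1 < th2 -> th2 <= th -> th <= L ->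
     0 <= gam -> (forall s, th1 <= s <= th2 -> gam <= g s) ->
     gam * (1 - expR (- (th - th2))) * (th2 - th1) <= M th) ->
  (forall s, lb <= s <= L -> 0 <= s) ->
  (forall s, lb <= s <= L -> alpha <= g s) ->
  (forall s, lb <= s <= L -> beta * M s `^ p <= (1 + s) `^ (p - 1) * g s) ->
  beta * alpha `^ (p - 1) * L < 128 * 32 `^ (p - 1) * 4 `^ ((p - 1)^-1).
Proof.
move=> /andP[p1 p2] al0 be0 L4 Llb HM Hpos HA HB; rewrite ltNge; apply/negP => big.
have pp : 0 < p - 1 by rewrite subr_gt0.
have p0 : 0 < p by lra.
have L0 : 0 < L by lra.
pose A : R := 4 `^ ((p - 1)^-1).
have A4 : 4 <= A.
  rewrite /A -[leLHS]powRr1 // ler_powR ?ler1n // -invr1 lef_pV2 ?posrE //; lra.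
have AP : A `^ (p - 1) = 4 by rewrite /A -powRrM mulVf ?powRr1 // gt_eqF.
pose m0 := alpha / 16.
have m00 : 0 < m0 by rewrite divr_gt0.
pose ell (j : nat) := L * (1 - 2^-1 ^+ j.+1).
have hp (j : nat) : 0 < 2^-1 ^+ j :> R by rewrite exprn_gt0 // invr_gt0.
have hl (j : nat) : 2^-1 ^+ j <= 1 :> R.
  by rewrite exprn_ile1 ?invr_ge0 // invf_le1 // ler1n.
have ell_ge j : L / 2 <= ell j.
  rewrite /ell ler_pM2l // exprS; have := hl j; lra.
have main j : forall th, ell j <= th <= L -> L * (m0 * A ^+ j) <= M th.
  elim: j => [|j IH] th /andP[th1 thL].
    have : L / 2 <= th by apply: le_trans th1.
    move=> Lth; rewrite expr0 mulr1.
    have lb4 : lb < L / 4 by lra.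
    have := HM lb (L / 4) th alpha (lexx _) lb4.
    have -> : L / 4 <= th by lra.
    move=> /(_ isT thL (ltW al0)) H.
    apply: le_trans (H _); last by move=> s /andP[s1 s2]; apply: HA; rewrite s1; lra.
    have z1 := onem_expRN_ge (_ : 0 <= th - L / 4).
    have /z1 {}z1 : 0 <= th - L / 4 by lra.
    have h2 : 2^-1 <= 1 - expR (- (th - L / 4)).
      apply: le_trans z1; rewrite ler_pdivlMr; lra.
    have h8 : L / 8 <= L / 4 - lb by lra.
    have : alpha * 2^-1 * (L / 8) <= alpha * (1 - expR (- (th - L / 4))) * (L / 4 - lb).
      apply: ler_pM => //; [by rewrite mulr_ge0 ?invr_ge0 ?ltW|by rewrite divr_ge0 ?ltW|].
      by rewrite ler_pM2l.
    by rewrite /m0; lra.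
  (* a quarter of the distance between [ell j] and [L], half of the step *)
  pose z := L * 2^-1 ^+ j / 8.
  have z0 : 0 < z by rewrite divr_gt0 // mulr_gt0.
  have ellS : ell j.+1 = ell j + 2 * z.
    by rewrite /ell /z !exprS; field.
  have zL : 1 + z <= 2 * L.
    have : z <= L / 8 by rewrite /z ler_pM2r ?invr_gt0 // ler_piMr ?(ltW L0).
    lra.
  pose Q := L * (m0 * A ^+ j).
  have Aj0 : 0 < A ^+ j by rewrite exprn_gt0 //; lra.
  have Q0 : 0 < Q by rewrite !mulr_gt0.
  pose gam := beta * Q `^ p / (2 * L) `^ (p - 1).
  have P0 : 0 < (2 * L) `^ (p - 1) by rewrite powR_gt0 // mulr_gt0.
  have gam0 : 0 <= gam by rewrite /gam divr_ge0 ?mulr_ge0 ?powR_ge0 // ltW.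
  have e1 := ell_ge j.
  have lbe : lb <= ell j by lra.
  have := HM (ell j) (ell j + z) th gam lbe.
  have -> : ell j < ell j + z by rewrite ltrDl.
  have -> : ell j + z <= th by move: th1; rewrite ellS; lra.
  move=> /(_ isT isT thL gam0) H.
  apply: le_trans (H _); last first.
    move=> s /andP[s1 s2].
    have sL : s <= L by move: th1; rewrite ellS; lra.
    have sb : lb <= s <= L by rewrite sL andbT; lra.
    have s0 := Hpos _ sb.
    have Ms : Q <= M s by apply: IH; rewrite s1.
    have g0 : 0 <= g s by apply: le_trans (HA _ sb); exact: ltW.
    rewrite /gam ler_pdivrMr //.
    apply: (@le_trans _ _ (beta * M s `^ p)).
      rewrite ler_pM2l //; apply: ge0_ler_powR => //; rewrite ?nnegrE ?(ltW p0) ?(ltW Q0) //.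
      exact: le_trans (ltW Q0) Ms.
    apply: (le_trans (HB _ sb)); rewrite mulrC ler_wpM2l //.
    apply: ge0_ler_powR; rewrite ?nnegrE ?(ltW pp) //; lra.
  have h1 : z / (2 * L) <= 1 - expR (- (th - (ell j + z))).
    have thz : z <= th - (ell j + z) by move: th1; rewrite ellS; lra.
    have : 1 - expR (- z) <= 1 - expR (- (th - (ell j + z))).
      by rewrite lerD2l lerN2 ler_expR lerN2.
    apply: le_trans; apply: le_trans (onem_expRN_ge (ltW z0)).
    by rewrite ler_pM2l // lef_pV2 ?posrE //; lra.
  have -> : ell j + z - ell j = z by lra.
  apply: (@le_trans _ _ (gam * (z / (2 * L)) * z)); last first.
    by rewrite ler_pM2r // ler_wpM2l.
  have QE : Q `^ p = L `^ p * m0 `^ p * (A ^+ j * 4 ^+ j).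
    rewrite /Q powRM ?(ltW L0) ?(ltW (mulr_gt0 m00 Aj0)) //.
    rewrite powRM ?(ltW m00) ?(ltW Aj0) // mulrA; congr (_ * _).
    rewrite -mulr_powRB1 ?(ltW Aj0) //; congr (_ * _).
    have A0 : 0 <= A by lra.
    by rewrite -[A ^+ j]powR_mulrn // powRAC AP powR_mulrn.
  have LE : L `^ p = L * L `^ (p - 1) by rewrite mulr_powRB1 // ltW.
  have mE : m0 `^ p = m0 * m0 `^ (p - 1) by rewrite mulr_powRB1 // ltW.
  have PE : (2 * L) `^ (p - 1) = 2 `^ (p - 1) * L `^ (p - 1) by rewrite powRM // ltW.
  have q4 : (4 : R) ^+ j * (2^-1 ^+ j) ^+ 2 = 1.
    by rewrite exprAC -exprMn (_ : 4 * 2^-1 ^+ 2 = 1) ?expr1n //; field.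
  have Lp0 : 0 < L `^ (p - 1) by rewrite powR_gt0.
  have tp0 : 0 < (2 : R) `^ (p - 1) by rewrite powR_gt0.
  rewrite [leRHS](_ : _ =
      L * (m0 * A ^+ j) * (beta * m0 `^ (p - 1) * L / (128 * 2 `^ (p - 1)))); last first.
    rewrite /gam QE LE mE PE /z.
    transitivity (L * (m0 * A ^+ j) * (beta * m0 `^ (p - 1) * L / (128 * 2 `^ (p - 1))) *
      (4 ^+ j * (2^-1 ^+ j) ^+ 2)); last by rewrite q4 mulr1.
    by field; rewrite !gt_eqF.
  rewrite exprS [leLHS](_ : _ = L * (m0 * A ^+ j) * A); last by ring.
  rewrite ler_pM2l //.
  have m0E : m0 `^ (p - 1) = alpha `^ (p - 1) / 16 `^ (p - 1).
    rewrite /m0 powRM ?invr_ge0 ?(ltW al0) //; congr (_ * _).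
    by rewrite -powR_inv1 // powRAC powR_inv1 ?powR_ge0.
  have t32 : (32 : R) `^ (p - 1) = 2 `^ (p - 1) * 16 `^ (p - 1).
    by rewrite -powRM //; congr powR; lra.
  have s0 : 0 < (16 : R) `^ (p - 1) by rewrite powR_gt0.
  rewrite m0E ler_pdivlMr ?mulr_gt0 //.
  rewrite mulrA mulrAC ler_pdivlMr //.
  move: big; rewrite t32 -/A; lra.
have MB : forall j, L * (m0 * A ^+ j) <= M L.
  move=> j; apply: main; rewrite lexx andbT /ell ler_piMr ?(ltW L0) //.
have Lm0 : 0 < L * m0 by rewrite mulr_gt0.
pose j := Num.truncn (M L / (L * m0)).
have jM : M L / (L * m0) < j.+1%:R by exact: truncnS_gt.
have Aj : j.+1%:R <= A ^+ j.+1.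
  apply: (@le_trans _ _ (4 ^+ j.+1)).
    by rewrite -natrX ler_nat ltnW // ltn_expl.
  by apply: lerXn2r; rewrite ?nnegrE //; lra.
have := MB j.+1; apply/negP; rewrite -ltNge mulrA mulrC -ltr_pdivrMr //.
exact: lt_le_trans Aj.
Qed.

End iteration.

(** * The memory term in logarithmic time *)

Section memory_lower_bound.
Context {R : realType}.

Lemma continuous_inverse_shift (b t1 t2 : R) : 0 < t1 + b ->
  {within `[t1, t2], continuous (fun s : R => (s + b)^-1)}.
Proof.
move=> b1; apply: continuous_in_subspaceT => x; rewrite inE /= in_itv /= => /andP[x1 _].
apply: cvgV; first by rewrite gt_eqF //; lra.
by apply: cvgD; [exact: cvg_id|exact: cvg_cst].
Qed.

Lemma integral_inverse_shift (b t1 t2 : R) : 0 < t1 + b -> t1 < t2 ->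
  (\int[lebesgue_measure]_(s in `[t1, t2]) ((s + b)^-1)%:E =
   (ln (t2 + b) - ln (t1 + b))%:E)%E.
Proof.
move=> b1 t12.
have pos x : t1 <= x -> 0 < x + b by lra.
have dln (x : R) : t1 <= x -> is_derive x (1 : R) (fun s : R => ln (s + b)) ((x + b)^-1).
  move=> /pos x0.
  have dx : is_derive x (1 : R) (fun s : R => s + b) 1.
    rewrite -[X in is_derive _ _ _ X]addr0; exact: is_deriveD.
  have := @is_derive1_comp R (@ln R) (fun s => s + b) x _ _ (is_derive1_ln x0) dx.
  by rewrite mulr1.
have cln x : t1 <= x -> {for x, continuous (fun s : R => ln (s + b))}.
  by move=> /dln dx; apply/differentiable_continuous/derivable1_diffP; exact: ex_derive.
rewrite EFinB (@continuous_FTC2 R (fun s => (s + b)^-1) (fun s => ln (s + b))) //.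
- exact: continuous_inverse_shift.
- split.
  + by move=> x; rewrite in_itv /= => /andP[/ltW/dln dx _]; exact: ex_derive.
  + by apply: cvg_at_right_filter; exact: (cln t1 (lexx _)).
  + by apply: cvg_at_left_filter; exact: (cln t2 (ltW t12)).
- by move=> x; rewrite in_itv /= => /andP[/ltW/dln dx _]; rewrite derive1E derive_val.
Qed.

(** In the variable [ln (s + b)] the measure [ds / (s + b)] is uniform, so a
    lower bound of [G] at the critical rate on a stretch of logarithmic time
    contributes its length. *)
Lemma memory_ge (m : nat) (p rad eps : R) (f g : 'rV[R]_m.+1 -> R) (T : \bar R)
    (u ut : R -> 'rV[R]_m.+1 -> R) (t t1 t2 gam : R) (b := rad + 1) :
  1 < p <= 2 -> 2 + (m%:R + 2) * p - m%:R * p ^+ 2 = 0 -> 0 < rad ->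
  supported_solution p rad f g eps T u ut -> (t%:E < T)%E ->
  0 <= t1 -> t1 < t2 -> t2 <= t -> 0 <= gam ->
  (forall s, t1 <= s <= t2 ->
     gam <= power_integral p u s * (s + b) `^ (1 - critical_decay m p)) ->
  gam * ((t - t2) / (t + b)) * (ln (t2 + b) - ln (t1 + b)) <= memory p rad u t.
Proof.
move=> p12 crit rad0 sol tT t10 t12 t2t gam0 HG.
have t0 : 0 <= t by lra.
have b1 : 0 < b by rewrite /b; lra.
have tb : 0 < t + b by lra.
have pos x : t1 <= x -> 0 < x + b by lra.
set q := critical_decay m p in HG *.
set h := fun s => memory_kernel m p rad t s * power_integral p u s.
have ih : lebesgue_measure.-integrable `[0, t] (EFin \o h).
  exact: (memory_integrable p12 crit rad0 sol t0 tT).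
have h0 s : 0 <= s <= t -> 0 <= h s.
  move=> st; rewrite mulr_ge0 ?power_integral_ge0 //.
  by have /andP[] := memory_kernel_bound p12 crit rad0 st.
have mI (x y : R) : measurable (`[x, y]%classic : set (measurableTypeR R)).
  exact: measurable_itv.
have sub : `[t1, t2]%classic `<=` `[0, t]%classic.
  by move=> s /=; rewrite !in_itv /= => /andP[s1 s2]; apply/andP; split; lra.
rewrite -lee_fin /memory /Rintegral fineK; last exact: integrable_fin_num ih.
set c := gam * ((t - t2) / (t + b)).
have r0 : 0 <= (t - t2) / (t + b) by rewrite divr_ge0 ?subr_ge0 // ltW.
have c0 : 0 <= c by exact: mulr_ge0.
apply: (@le_trans _ _ (\int[lebesgue_measure]_(s in `[t1, t2]) (h s)%:E)%E); last first.
  apply: ge0_subset_integral => //; exact: measurable_int ih.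
rewrite EFinM -integral_inverse_shift ?pos //.
have minv : measurable_fun (`[t1, t2]%classic : set (measurableTypeR R))
    (fun s => ((s + b)^-1)%:E).
  apply: (@measurable_int _ _ _ lebesgue_measure); apply: continuous_compact_integrable.
    exact: segment_compact.
  by apply: continuous_inverse_shift; exact: pos.
rewrite -ge0_integralZl //; last first.
  by move=> s /=; rewrite in_itv /= => /andP[/pos s0 _]; rewrite lee_fin invr_ge0 ltW.
apply: ge0_le_integral => //.
- move=> s /=; rewrite in_itv /= => /andP[/pos s0 _].
  by rewrite -EFinM lee_fin mulr_ge0 // invr_ge0 ltW.
- exact: measurable_funeM.
- by exact: measurable_funS (mI 0 t) sub (measurable_int _ ih).
move=> s /=; rewrite in_itv /= => /andP[s1 s2].
have sb := pos _ s1.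
rewrite -EFinM lee_fin /h /memory_kernel -/b -/q /c -[leRHS]mulrA.
rewrite [leLHS](_ : _ = (t - t2) / (t + b) * (gam / (s + b))); last by ring.
have -> : (s + b) `^ (- q) * power_integral p u s =
  (power_integral p u s * (s + b) `^ (1 - q)) / (s + b).
  rewrite powRD ?(gt_eqF sb) ?implybT // powRr1 ?(ltW sb) //.
  by field; rewrite gt_eqF.
apply: ler_pM => //.
- by rewrite mulr_ge0 // invr_ge0 ltW.
- by rewrite ler_pM2r ?invr_gt0 // lerD2l lerN2.
- by rewrite ler_pM2r ?invr_gt0 // HG // s1.
Qed.

End memory_lower_bound.

(** * The lifespan *)

Section lifespan_estimate.
Context {R : realType}.
Variables (m : nat) (p rad : R) (f g : 'rV[R]_m.+1 -> R).
Local Notation mu := (@lebesgue_rV R m.+1).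
Hypothesis p12 : 1 < p <= 2.
Hypothesis crit : 2 + (m%:R + 2) * p - m%:R * p ^+ 2 = 0.
Hypothesis rad0 : 0 < rad.
Hypotheses (f2 : in_L2 f) (g2 : in_L2 g).
Hypotheses (f0 : {ae mu, forall x, 0 <= f x}) (g0 : {ae mu, forall x, 0 <= g x}).
Hypotheses (fr : supp_in_ball rad f) (gr : supp_in_ball rad g).

Local Notation q := (critical_decay m p).
Local Notation b := (rad + 1).
Local Notation V := (fine (lebesgue_rV m (eball 1) : \bar R)).
Local Notation F := (\int[mu]_x f x).
Local Notation D := (2 * (2 * bump_constant m p) `^ (p - 1)).

Definition data_coefficient : R := (V * (F / 2 * expR (- b))) `^ p / D.

Definition feedback_coefficient : R :=
  (V * (expR (- 2) / 2)) `^ p / (D * feedback_constant p `^ (p - 1)).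

Let pp : 0 < p - 1. Proof. by case/andP : p12; rewrite subr_gt0. Qed.
Let p0 : 0 < p. Proof. by case/andP : p12 => + _; exact: lt_trans. Qed.
Let V0 : 0 < V. Proof. exact: eball1_gt0. Qed.
Let D0 : 0 < D.
Proof. by apply: mulr_gt0 => //; rewrite powR_gt0 // mulr_gt0 ?bump_constant_gt0. Qed.
Let fc0 : 0 < feedback_constant p. Proof. exact: feedback_constant_gt0. Qed.

Lemma feedback_coefficient_gt0 : 0 < feedback_coefficient.
Proof.
apply: divr_gt0; last by apply: mulr_gt0 => //; exact: powR_gt0.
by rewrite powR_gt0 // mulr_gt0 // divr_gt0 // expR_gt0.
Qed.

Lemma data_coefficient_gt0 : 0 < F -> 0 < data_coefficient.
Proof.
by move=> F0; rewrite divr_gt0 // powR_gt0 // !mulr_gt0 ?expR_gt0.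
Qed.

(** The logarithmic time [s] corresponds to [tm s = exp s - b]. In it the two lower
    bounds of the power integral carry the same power [exp (s (q - 1))],
    which is absorbed into [gg]. *)
Lemma logarithmic_lifespan_bound (eps : R) (T : \bar R) (u ut : R -> 'rV[R]_m.+1 -> R)
    (t : R) (L := ln (t + b)) :
  0 < F -> 0 < eps -> supported_solution p rad f g eps T u ut ->
  0 <= t -> (t%:E < T)%E -> 4 <= L -> 8 * ln b <= L ->
  feedback_coefficient * data_coefficient `^ (p - 1) * eps `^ (p * (p - 1)) * L <
  128 * 32 `^ (p - 1) * 4 `^ ((p - 1)^-1).
Proof.
move=> F0 eps0 sol t0 tT L4 Lb.
have b1 : 1 < b by have := rad0; lra.
have b0 : 0 < b by lra.
pose G := power_integral p u.
pose tm s := expR s - b.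
have tmE s : tm s + b = expR s by rewrite /tm; lra.
have tm0 s : ln b <= s -> 0 <= tm s.
  by move=> bs; rewrite subr_ge0 -[leLHS]lnK ?posrE // ler_expR.
have tmT s : s <= L -> ((tm s)%:E < T)%E.
  move=> sL; apply: le_lt_trans tT; rewrite lee_fin /tm.
  have : expR s <= expR L by rewrite ler_expR.
  by rewrite /L lnK ?posrE; lra.
have dc0 := data_coefficient_gt0 F0.
have rpow s : expR s `^ (q - 1) * expR s `^ (1 - q) = 1.
  rewrite -powRD ?(gt_eqF (expR_gt0 _)) ?implybT //.
  by rewrite (_ : q - 1 + (1 - q) = 0) ?powRr0 //; ring.
pose gg s := G (tm s) * expR s `^ (1 - q).
(* multiplies a bound of [G] by the critical rate [expR s `^ (1 - q)] *)
have resc s (Z c : R) : 0 < c -> Z * expR s `^ (q - 1) <= c * G (tm s) ->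
    Z / c <= gg s.
  move=> c0 ZG; rewrite ler_pdivrMr // -[leLHS]mulr1 -(rpow s) mulrA /gg [leRHS]mulrAC.
  by rewrite ler_wpM2r ?powR_ge0 // [leRHS]mulrC.
have -> : feedback_coefficient * data_coefficient `^ (p - 1) * eps `^ (p * (p - 1)) * L =
    feedback_coefficient * (data_coefficient * eps `^ p) `^ (p - 1) * L.
  by rewrite powRM ?(ltW dc0) ?powR_ge0 // -powRrM mulrA.
apply: (@iteration_bound _ p _ _ L (ln b) (fun s => memory p rad u (tm s)) gg) => //.
- by rewrite mulr_gt0 // powR_gt0.
- exact: feedback_coefficient_gt0.
- move=> th1 th2 th gam h1 h12 h2 hL gam0 Hg.
  have e12 : tm th1 < tm th2 by rewrite ltrD2r ltr_expR.
  have e2 : tm th2 <= tm th by rewrite lerD2r ler_expR.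
  have := @memory_ge R m p rad eps f g T u ut (tm th) (tm th1) (tm th2) gam p12 crit rad0
    sol (tmT _ hL) (tm0 _ h1) e12 e2 gam0.
  have -> : (tm th - tm th2) / (tm th + b) = 1 - expR (- (th - th2)).
    rewrite tmE [- (th - th2)]opprB expRD expRN /tm; field.
    by rewrite gt_eqF ?expR_gt0.
  rewrite !tmE !expRK; apply=> s /andP[s1 s2].
  have sb : 0 < s + b by have := tm0 _ h1; lra.
  have sE : tm (ln (s + b)) = s by rewrite /tm lnK ?posrE //; lra.
  have := Hg (ln (s + b)); rewrite /gg sE lnK ?posrE //; apply.
  have z1 : expR th1 <= s + b by rewrite -tmE lerD2r.
  have z2 : s + b <= expR th2 by rewrite -[leRHS]tmE lerD2r.
  by rewrite -[th1]expRK -[th2]expRK !ler_ln ?posrE ?expR_gt0 ?z1.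
- move=> s /andP[s1 _]; apply: le_trans s1; rewrite ln_ge0 //; lra.
- move=> s /andP[s1 s2].
  have := power_integral_data p12 crit rad0 f2 g2 f0 g0 fr gr eps0 sol (tm0 _ s1) (tmT _ s2).
  rewrite tmE => /(resc _ _ _ D0); apply: le_trans.
  rewrite /data_coefficient mulrAC ler_pM2r ?invr_gt0 //.
  rewrite -powRM ?(ltW eps0) //; last first.
    by rewrite !mulr_ge0 ?(ltW V0) ?(ltW F0) ?expR_ge0.
  by rewrite (_ : V * (F / 2 * expR (- b)) * eps = V * (eps * F / 2 * expR (- b))) //; ring.
- move=> s /andP[s1 s2].
  have s0 : 0 <= s by apply: le_trans s1; rewrite ln_ge0 //; lra.
  have := power_integral_memory p12 crit rad0 f2 g2 f0 g0 fr gr eps0 sol (tm0 _ s1) (tmT _ s2).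
  rewrite tmE expRK [(feedback_constant p * _) `^ _]powRM ?(ltW fc0) //; last lra.
  have sp : 0 < (1 + s) `^ (p - 1) by rewrite powR_gt0; lra.
  have fp : 0 < feedback_constant p `^ (p - 1) by rewrite powR_gt0.
  have Dp : 0 < D * (feedback_constant p `^ (p - 1) * (1 + s) `^ (p - 1)).
    by apply: mulr_gt0 => //; apply: mulr_gt0.
  move=> /(resc _ _ _ Dp); rewrite -(ler_pM2l sp); apply: le_trans.
  set M := memory _ _ _ _.
  have M0 : 0 <= M.
    apply: Rintegral_ge0 => x; rewrite /= in_itv /= => xs.
    apply: mulr_ge0; last exact: power_integral_ge0.
    by have /andP[] := memory_kernel_bound p12 crit rad0 xs.
  have -> : V * (expR (- 2) / 2 * M) = V * (expR (- 2) / 2) * M by ring.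
  rewrite [X in _ * (X / _)]powRM //; last first.
    by rewrite mulr_ge0 ?(ltW V0) ?divr_ge0 ?expR_ge0.
  rewrite le_eqVlt /feedback_coefficient; apply/orP; left; apply/eqP.
  move: D0 fp sp; set D' := D.
  move: (_ `^ p) (M `^ p) (feedback_constant p `^ _) ((1 + s) `^ _) => x y z w d zz ww.
  by field; rewrite !gt_eqF.
Qed.

End lifespan_estimate.

Lemma Rintegral_gt0 {R : realType} (n : nat) (h : 'rV[R]_n -> R) (r : R) :
  in_L2 h -> supp_in_ball r h -> {ae lebesgue_rV n, forall x, 0 <= h x} ->
  ~ {ae lebesgue_rV n, forall x, h x = 0} ->
  0 < \int[lebesgue_rV n]_x h x.
Proof.
move=> h2 hr h0 hN; have ih := in_L2_integrable h2 hr.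
rewrite lt_neqAle; apply/andP; split; last exact: Rintegral_ae_ge0.
apply/negP => /eqP I0; apply: hN.
have /(ae_eq_integral_abs (lebesgue_rV n) measurableT (measurable_int _ ih)) : 
    (\int[lebesgue_rV n]_x `|(EFin \o h) x| = 0)%E.
  transitivity (\int[lebesgue_rV n]_x (h x)%:E)%E.
    apply: ae_eq_integral => //.
    - by apply: measurableT_comp => //; exact: measurable_int ih.
    - exact: measurable_int ih.
    - by apply: filterS h0 => x hx _ /=; rewrite ger0_norm.
  by rewrite -(fineK (integrable_fin_num measurableT ih)); congr (_%:E).
by apply: filterS => x /(_ I) /= [].
Qed.


Theorem theorem1p1 (R : realType) (n : nat) (hn : (4 <= n)%N)
    (p : R) (hp : p = p0 n) (rad : R) (hrad : 0 < rad)
    (f g : 'rV[R]_n -> R)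
    (hf : in_H1 f) (hg : in_L2 g)
    (f_ge0 : {ae lebesgue_rV n, forall x, 0 <= f x})
    (g_ge0 : {ae lebesgue_rV n, forall x, 0 <= g x})
    (f_neq0 : ~ {ae lebesgue_rV n, forall x, f x = 0})
    (g_neq0 : ~ {ae lebesgue_rV n, forall x, g x = 0})
    (f_supp : supp_in_ball rad f) (g_supp : supp_in_ball rad g) :
  exists eps0 C : R, [/\ 0 < eps0, 0 < C &
    forall eps : R, 0 < eps <= eps0 ->
      (exists u ut : R -> 'rV[R]_n -> R,
         wave_solution p (eps \*o f) (eps \*o g) (lifespan p f g eps) u ut /\
         forall t : R, 0 <= t -> (t%:E < lifespan p f g eps)%E ->
           supp_in_ball (t + rad) (u t) /\ supp_in_ball (t + rad) (ut t)) ->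
      (lifespan p f g eps <= (expR (C * eps `^ (- (p * (p - 1)))))%:E)%E].
Proof.
case: n hn hp f g hf hg f_ge0 g_ge0 f_neq0 g_neq0 f_supp g_supp => // m m3.
move=> hp f g [f2 _] g2 f0 g0 fN _ fr gr.
have [p0 crit'] := (p0P p (ltac:(by apply: leq_trans m3) : (1 < m.+1)%N)).1 hp.
have m3R : 3 <= m%:R :> R by rewrite ler_nat.
have crit : 2 + (m%:R + 2) * p - m%:R * p ^+ 2 = 0.
  by rewrite -[RHS]crit' -natr1; ring.
have p12 : 1 < p <= 2.
  have mp : 0 <= (m%:R - 3) * p by rewrite mulr_ge0 ?subr_ge0 // ltW.
  have mp0 : 0 <= m%:R * p by rewrite mulr_ge0 // ltW.
  apply/andP; split; [rewrite ltNge|rewrite leNgt]; apply/negP => H.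
    have : 0 <= m%:R * p * (1 - p) by rewrite mulr_ge0 // subr_ge0.
    by lra.
  have : 0 <= m%:R * p * (p - 2) by rewrite mulr_ge0 // subr_ge0 ltW.
  by lra.
have F0 := Rintegral_gt0 f2 fr f0 fN.
have pp : 0 < p - 1 by case/andP: p12; rewrite subr_gt0.
have a0 := @data_coefficient_gt0 R m p rad f F0.
have c0 := @feedback_coefficient_gt0 R m p p12.
have b1 : 1 < rad + 1 by lra.
have lb0 : 0 <= ln (rad + 1) by rewrite ln_ge0 // ltW.
pose c := feedback_coefficient m p * data_coefficient p rad f `^ (p - 1).
have cp : 0 < c by rewrite mulr_gt0 // powR_gt0.
pose N : R := 128 * 32 `^ (p - 1) * 4 `^ ((p - 1)^-1).
have N0 : 0 < N by rewrite !mulr_gt0 ?powR_gt0.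
(* the first summand contradicts the iteration, the others ensure that the
   logarithmic time exceeds [4] and [8 ln (rad + 1)], as the iteration needs *)
pose C := N / c + 4 + 8 * ln (rad + 1).
have Nc0 : 0 < N / c by rewrite divr_gt0.
have C0 : 0 < C by rewrite /C; lra.
exists 1, C; split=> // eps /andP[eps0 eps1] [u [ut [sol su]]].
rewrite leNgt; apply/negP.
set E := eps `^ (- (p * (p - 1))); set t := expR _ => tT.
have E1 : 1 <= E.
  rewrite /E powRN invf_ge1 ?powR_gt0 //.
  rewrite [leRHS](_ : 1 = 1 `^ (p * (p - 1))); last by rewrite powR1.
  by apply: ge0_ler_powR => //; rewrite ?nnegrE ?(ltW eps0) ?mulr_ge0 ?(ltW pp) ?(ltW p0).
have CE : C <= C * E by rewrite ler_peMr // ltW.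
have tL : C * E <= ln (t + (rad + 1)).
  rewrite -[leLHS](expRK) -/t ler_ln ?posrE ?lerDl ?expR_gt0 //; first lra.
  by rewrite addr_gt0 ?expR_gt0 //; lra.
have sol' : supported_solution p rad f g eps (lifespan p f g eps) u ut.
  by split=> // s s0 sT; have [] := su s s0 sT.
have := logarithmic_lifespan_bound p12 crit hrad f2 g2 f0 g0 fr gr F0 eps0 sol'
  (expR_ge0 _ : 0 <= t) tT.
have -> : 4 <= ln (t + (rad + 1)) by move: (le_trans CE tL); rewrite /C; lra.
have -> : 8 * ln (rad + 1) <= ln (t + (rad + 1)) by move: (le_trans CE tL); rewrite /C; lra.
move=> /(_ isT isT); rewrite -/N -/c; apply/negP; rewrite -leNgt.
have epE : eps `^ (p * (p - 1)) * E = 1.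
  by rewrite /E -powRD ?subrr ?powRr0 // (gt_eqF eps0) implybT.
have NC : N / c * E <= ln (t + (rad + 1)).
  by apply: le_trans tL; rewrite ler_pM2r ?(lt_le_trans ltr01) // /C; lra.
have -> : N = c * eps `^ (p * (p - 1)) * (N / c * E).
  transitivity (N * (eps `^ (p * (p - 1)) * E)); first by rewrite epE mulr1.
  by field; rewrite gt_eqF.
by rewrite ler_pM2l // mulr_gt0 ?powR_gt0.
Qed.
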